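(* Let $T>0$. The map $\Psi:(BV_{LR}[0,T],|||\cdot|||)\to (C([0,T],\overline{\mathbb H}),\|\cdot\|_\infty)$ defined by $\Psi(U)=\gamma$, where $\gamma$ is the trace of the Loewner chain driven by $U$, is continuous. Here $BV_{LR}[0,T]$ is equipped with the metric $d(U,V)=|||U-V|||_T$ and $C([0,T],\overline{\mathbb H})$ with the supremum norm.
   Context: $\mathbb H=\{z\in\mathbb C:\Im z>0\}$. $C_0[0,T]$ is the set of continuous functions $U:[0,T]\to\mathbb R$ with $U_0=0$. For a function $U$ and a closed interval $I$, $|||U|||_I$ denotes the total variation of $U$ on $I$, and $|||U|||_t:=|||U|||_{[0,t]}$. $C([0,T],\overline{\mathbb H})$ is the set of continuous $\overline{\mathbb H}$-valued curves on $[0,T]$. $BV_{LR}[0,T]$ is the set of all $U\in C_0[0,T]$ with $|||U|||_T<\infty$ and such that for all $t\in(0,T]$, $\limsup_{s\to0+}\frac{|||U|||_{[t-s,t]}}{\sqrt s}<2$. Loewner chain: for $U\in C_0[0,T]$ and $z\in\overline{\mathbb H}\setminus\{0\}$, let $g_t(z)$ be the solution of $\partial_t g_t(z)=\frac{2}{g_t(z)-U_t}$, $g_0(z)=z$, on its maximal interval of existence $[0,T_z)$ ($T_z\in(0,\infty]$, with $T_z=\infty$ if the solution exists on all of $[0,T]$), and put $T_0=0$. Let $K_t=\{z\in\overline{\mathbb H}:T_z\le t\}$. The family $(K_t)_{t\in[0,T]}$ is the Loewner chain driven by $U$; $H_t:=\mathbb H\setminus K_t$ is simply connected and $g_t$ is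 a conformal map from $H_t$ onto $\mathbb H$. The chain admits a trace if there is a continuous curve $\gamma:[0,T]\to\overline{\mathbb H}$ with $\gamma_0=0$ such that for all $t\in[0,T]$, $H_t$ is the unbounded component of $\mathbb H\setminus\gamma[0,t]$; $\gamma$ is then called the trace of the chain. For every $U\in BV_{LR}[0,T]$ the Loewner chain driven by $U$ admits a simple trace $\gamma$, given by $\gamma_t=\lim_{y\to0+}g_t^{-1}(iy+U_t)$, so $\Psi$ is well defined. *)

(* Defs.v *)
From HB Require Import structures.
From mathcomp Require Import all_boot all_order all_algebra.
From mathcomp Require Import all_classical all_reals all_analysis.
From mathcomp Require Import complex.

Set Implicit Arguments.
Unset Strict Implicit.
Unset Printing Implicit Defensive.

Import Order.TTheory GRing.Theory Num.Theory.
Import numFieldNormedType.Exports.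
Import Normc.

Local Open Scope classical_set_scope.
Local Open Scope ring_scope.
Local Open Scope complex_scope.

(* The complex plane over R; the regular-algebra alias [^o] is what carries
   the norm topology on R[i]. *)
Notation Cplx R := (R[i]^o) (only parsing).

Section loewner.
Context {R : realType}.
Local Notation C := (Cplx R).

Definition upper_half_plane : set C := [set z | 0 < complex.Im z].
Local Notation HH := upper_half_plane.

Definition C0 (T : R) (U : R -> R) : Prop :=
  {within `[0, T], continuous U} /\ U 0 = 0.

Definition BV_LR (T : R) (U : R -> R) : Prop :=
  [/\ C0 T U,
      (total_variation 0 T U < +oo)%E &
      forall t, 0 < t <= T ->
        (limf_esup
           (fun s => total_variation (t - s) t U * ((Num.sqrt s)^-1)%:E) 0^'+
         < 2%:E)%E].

(* [g] solves the Loewner equation started at [z] on the closed interval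
   [0, t].  The time derivative is the limit of difference quotients inside
   [0, t], hence one-sided at the two endpoints. *)
Definition loewner_solution (U : R -> R) (z : C) (t : R) (g : R -> C) : Prop :=
  g 0 = z /\
  forall s, s \in `[0, t] ->
    g s != (U s)%:C /\
    (fun r => (g r - g s) / (r - s)%:C) @ within `[0, t] s^' -->
      (2 / (g s - (U s)%:C) : C).

Definition loewner_solvable (U : R -> R) (z : C) (t : R) : Prop :=
  exists g, loewner_solution U z t g.

(* The lifetime T_z: the maximal interval of existence is [0, T_z). *)
Definition lifetime (T : R) (U : R -> R) (z : C) : \bar R :=
  if z == 0 then 0%E
  else if `[< loewner_solvable U z T >] then +oo%E
  else ereal_sup
    [set t%:E | t in [set t | t \in `[0, T] /\ loewner_solvable U z t]].

Definition hull (T : R) (U : R -> R) (t : R) : set C :=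
  [set z | closure HH z /\ (lifetime T U z <= t%:E)%E].

Definition unbounded_component (A B : set C) : Prop :=
  (exists2 z, A z & B = connected_component A z) /\ ~ bounded_set B.

Definition is_trace (T : R) (U : R -> R) (gamma : R -> C) : Prop :=
  [/\ {within `[0, T], continuous gamma},
      forall t, t \in `[0, T] -> closure HH (gamma t),
      gamma 0 = 0 &
      forall t, t \in `[0, T] ->
        unbounded_component (HH `\` gamma @` `[0, t]) (HH `\` hull T U t)].

End loewner.

(* A function on [0, T] is encoded as a function on the whole line vanishing
   off [0, T], so that Leibniz equality is equality on [0, T]. *)
Record bvLR (R : realType) (T : {posnum R}) := BvLR {
  bvLR_fun :> R -> R ;
  bvLR_out : forall t, t \notin `[0, T%:num] -> bvLR_fun t = 0 ;
  bvLR_bv : BV_LR T%:num bvLR_fun }.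

Record hcurve (R : realType) (T : {posnum R}) := HCurve {
  hcurve_fun :> R -> Cplx R ;
  hcurve_out : forall t, t \notin `[0, T%:num] -> hcurve_fun t = 0 ;
  hcurve_cont : {within `[0, T%:num], continuous hcurve_fun} ;
  hcurve_half : forall t, t \in `[0, T%:num] ->
    closure upper_half_plane (hcurve_fun t) }.

Section bv_metric.
Context {R : realType} {T : {posnum R}}.
Implicit Types U V W : bvLR T.

HB.instance Definition _ := gen_eqMixin (bvLR T).
HB.instance Definition _ := gen_choiceMixin (bvLR T).

Definition bv_dist U V : R := fine (total_variation 0 T%:num (U \- V)).

Lemma bvLR_eq U V : U =1 V -> U = V.
Proof.
case: U => U oU bU; case: V => V oV bV /= /funext UV; subst V.
by congr BvLR; exact: Prop_irrelevance.
Qed.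

Lemma bv_dist_fin U V : total_variation 0 T%:num (U \- V) \is a fin_num.
Proof.
rewrite ge0_fin_numE ?total_variation_ge0//.
apply: (le_lt_trans (total_variation_le _ _ _)) => //.
by rewrite total_variationN; apply: lte_add_pinfty; [case: (bvLR_bv U)|case: (bvLR_bv V)].
Qed.

Lemma bv_distxx U : bv_dist U U = 0.
Proof.
rewrite /bv_dist (_ : _ \- _ = cst 0); last by apply/funext => x /=; rewrite subrr.
by rewrite nondecreasing_total_variation ?subrr//=.
Qed.

Lemma bv_dist_sym U V : bv_dist U V = bv_dist V U.
Proof.
rewrite /bv_dist -total_variationN; congr (fine (total_variation _ _ _)).
by apply/funext => x /=; rewrite opprB.
Qed.

Lemma bv_dist_triangle V U W : bv_dist U W <= bv_dist U V + bv_dist V W.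
Proof.
rewrite /bv_dist -fineD ?bv_dist_fin// fine_le ?fin_numD ?bv_dist_fin//.
rewrite (_ : U \- W = (U \- V) \+ (V \- W)); last first.
  by apply/funext => x /=; rewrite addrA subrK.
exact: total_variation_le.
Qed.

Lemma bv_dist_positivity U V : bv_dist U V = 0 -> U = V.
Proof.
move=> UV0; apply: bvLR_eq => t.
have [tT|tT] := boolP (t \in `[0, T%:num]); last by rewrite !bvLR_out.
have [[[_ U0] _ _] [[_ V0] _ _]] := (bvLR_bv U, bvLR_bv V).
have TV0 : total_variation 0 T%:num (U \- V) = 0%E.
  by rewrite -(fineK (bv_dist_fin U V)) -/(bv_dist U V) UV0.
move: tT; rewrite in_itv/= => /andP[t0 tT].
have := total_variation_ge (U \- V) t0.
rewrite /= U0 V0 !subr0 => le1.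
have le2 : (total_variation 0 t (U \- V)%R <= 0)%E.
  by rewrite -TV0 (total_variationD _ t0 tT) leeDl// total_variation_ge0.
apply/eqP; rewrite -subr_eq0 -normr_le0 -lee_fin.
exact: le_trans le1 le2.
Qed.

HB.instance Definition _ := @isMetric.Build R (bvLR T) bv_dist bv_distxx
  bv_dist_positivity bv_dist_sym bv_dist_triangle.

End bv_metric.

Section sup_metric.
Context {R : realType} {T : {posnum R}}.
Implicit Types c d e : hcurve T.

HB.instance Definition _ := gen_eqMixin (hcurve T).
HB.instance Definition _ := gen_choiceMixin (hcurve T).

Definition sup_dist c d : R :=
  sup [set normc (c t - d t) | t in `[0, T%:num]].

Lemma hcurve_eq c d : c =1 d -> c = d.
Proof.
case: c => c oc kc hc; case: d => d od kd hd /= /funext cd; subst d.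
by congr HCurve; exact: Prop_irrelevance.
Qed.


Lemma normcB (z w : Cplx R) : normc (z - w) = normc (w - z).
Proof. by rewrite -normcN opprB. Qed.

Lemma normc_ge0 (z : Cplx R) : 0 <= normc z.
Proof. by case: z => a b; rewrite sqrtr_ge0. Qed.

Lemma dist_normc (z w : Cplx R) : `|normc z - normc w| <= normc (z - w).
Proof.
have H (u v : Cplx R) : normc u - normc v <= normc (u - v).
  by rewrite lerBlDr -[leLHS](congr1 (@normc R) (subrK v u)) le_normcD.
by rewrite ler_norml H andbT lerNl opprB normcB H.
Qed.

Lemma continuous_normc : continuous (@normc R : Cplx R -> R).
Proof.
move=> z.
have F : Filter (nbhs (z : Cplx R)) by exact: nbhs_filter.
apply/(@cvgrPdist_lt R R^o _ _ F (@normc R) (normc z : R^o)) => e e0.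
have e0C : 0 < e%:C by rewrite ltcR.
have := @nbhsx_ballx _ (Cplx R) z _ e0C; apply: filterS => w.
rewrite -ball_normE/= => zw; apply: le_lt_trans (dist_normc z w) _.
by rewrite -ltcR.
Qed.

Lemma hcurve_bounded c :
  exists M, forall t, t \in `[0, T%:num] -> normc (c t) <= M.
Proof.
have kN : {within `[0, T%:num], continuous (@normc R \o c)}.
  move=> t; apply: (@continuous_comp (subspace `[0, T%:num]) (Cplx R) R).
    exact: hcurve_cont.
  exact: continuous_normc.
have /compact_bounded[M [_ bM]] :=
  continuous_compact kN (@segment_compact R 0 T%:num).
exists (M + 1) => t tT.
apply: le_trans (ler_norm _) _; apply: (bM (M + 1)); first by rewrite ltrDl.
by exists t.
Qed.

Lemma sup_dist_has_sup c d :
  has_sup [set normc (c t - d t) | t in `[0, T%:num]].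
Proof.
have [[M cM] [N dN]] := (hcurve_bounded c, hcurve_bounded d).
split; first by exists (normc (c 0 - d 0)), 0 => //=; rewrite in_itv/= lexx/=.
exists (M + N) => _ [t tT <-].
by rewrite (le_trans (le_normcD _ _))// normcN lerD ?cM ?dN.
Qed.

Lemma sup_dist_ub c d t : t \in `[0, T%:num] -> normc (c t - d t) <= sup_dist c d.
Proof.
by move=> tT; apply: ub_le_sup; [case: (sup_dist_has_sup c d)|exists t].
Qed.

Lemma sup_dist_le c d M :
  (forall t, t \in `[0, T%:num] -> normc (c t - d t) <= M) -> sup_dist c d <= M.
Proof.
move=> cdM; apply: ge_sup; first by case: (sup_dist_has_sup c d).
by move=> _ [t tT <-]; exact: cdM.
Qed.

Lemma sup_dist_sym c d : sup_dist c d = sup_dist d c.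
Proof. by congr sup; apply: eq_imagel => t _; exact: normcB. Qed.

Lemma sup_distxx c : sup_dist c c = 0.
Proof.
have t0 : 0 \in `[0, T%:num] by rewrite in_itv/= lexx/=.
apply/eqP; rewrite eq_le; apply/andP; split.
  by apply: sup_dist_le => t _; rewrite subrr normc0.
exact: le_trans (normc_ge0 _) (sup_dist_ub c c t0).
Qed.

Lemma sup_dist_triangle d c e : sup_dist c e <= sup_dist c d + sup_dist d e.
Proof.
apply: sup_dist_le => t tT.
rewrite -[c t](subrK (d t)) -addrA (le_trans (le_normcD _ _))//.
by rewrite lerD ?sup_dist_ub.
Qed.

Lemma sup_dist_positivity c d : sup_dist c d = 0 -> c = d.
Proof.
move=> cd0; apply: hcurve_eq => t.
have [tT|tT] := boolP (t \in `[0, T%:num]); last by rewrite !hcurve_out.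
apply/eqP; rewrite -subr_eq0; apply/eqP/eq0_normc/eqP.
by rewrite eq_le normc_ge0 andbT -cd0 sup_dist_ub.
Qed.

HB.instance Definition _ := @isMetric.Build R (hcurve T) sup_dist sup_distxx
  sup_dist_positivity sup_dist_sym sup_dist_triangle.

Lemma closure_half_plane0 : closure upper_half_plane (0 : Cplx R).
Proof.
move=> B /nbhs_ballP[[a b] /= /[!ltcE]/= /andP[/eqP/esym b0 a0]] aB; subst b.
exists (0 +i* (a / 2)) => //; split; first by rewrite /upper_half_plane/= divr_gt0.
apply: aB; rewrite /ball/= sub0r normrN ltcR /= expr0n/= add0r sqrtr_sqr.
by rewrite gtr0_norm ?divr_gt0// ltr_pdivrMr// ltr_pMr// ltr1n.
Qed.

Definition hcurve0 : hcurve T :=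
  @HCurve R T (fun=> 0) (fun _ _ => erefl) (fun _ => cvg_cst _)
    (fun _ _ => closure_half_plane0).

End sup_metric.

(* The trace of the chain driven by U; the null curve is a dummy value, never
   taken since every U in BV_LR admits a trace. *)
Definition Psi (R : realType) (T : {posnum R}) (U : bvLR T) : hcurve T :=
  xget hcurve0 [set gamma : hcurve T | is_trace T%:num U gamma].

(* Main.v *)
Require Import Defs.
From mathcomp Require Import all_boot all_order all_algebra.
From mathcomp Require Import all_classical all_reals all_analysis.
From mathcomp Require Import complex ring lra.

Set Implicit Arguments.
Unset Strict Implicit.
Unset Printing Implicit Defensive.

Import Order.TTheory GRing.Theory Num.Theory.
Import numFieldNormedType.Exports.

Local Open Scope classical_set_scope.
Local Open Scope ring_scope.

(** Continuity of the map from drivers to traces.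

    Fix a time t.  Running the Loewner equation backwards from t turns it into
    the upward flow u' = -2 / (u - W), with W(s) = U(t - s), and the tip of the
    trace at time t is the limit of u(t) when u starts at U(t) + w and w tends
    to 0 in the half-plane.  Write u - W = X + iY, and let v(s) be the variation
    of U on [t - s, t].  Three facts carry the proof.

    - Height ([height_lower]).  The flow pulls |X| towards 0 at speed
      2|X|/|u - W|^2 and lifts Y at speed 2Y/|u - W|^2, so that
      v + Y - |X| grows at speed at least 2/(|X| + Y).  If v(s) <= c sqrt s
      with c < 2 and Y stayed below eta sqrt s, integrating this bound would
      give more than v + Y can be.  Hence Y(s) >= eta sqrt s, however
      small the starting height.  The argument tolerates an additive error in the bound
      on v that is small with respect to sqrt s.

    - Contraction ([flow_contraction]).  For two solutions with nearby drivers,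
      the gap |u_1 - u_2|^2 / (Y_1 Y_2) satisfies
      Q' <= -2 Q (Y_1/|Z_1|^2 + Y_2/|Z_2|^2)^2 + error, with Z_i = u_i - W_i.
      By the height bound the rate is of order 1/s, so Q decays like the
      inverse of a logarithm on [r, e], and the contribution of the starting
      points disappears as r tends to 0.

    - Stability ([near_endpoint]).  The local variation condition is assumed at
      each t separately and is not uniform in t.  But variation functions of
      nearby drivers at nearby times are uniformly close, and the first two
      facts only need the condition up to a small error.  So all endpoints
      whose driver, time and starting point are near (U, t, U(t)) are close to
      each other.  This gives at once the existence of the tip, its continuity
      in time and its continuity in the driver; compactness of [0, T] then
      makes the latter uniform in time ([trace_near_uniform]).

    It remains to identify the curve of tips with the trace.  A point of the
    half-plane outlives time t exactly when it is not a tip at a time s <= t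
    ([tip_survives], [tip_dies], [dies_tip]), so the complement of the curve is
    the complement of the hull, which is connected and unbounded as the image
    of the half-plane under the upward flow; no planar topology is needed.  Any
    other trace must pass through each tip, which is a boundary point of the
    complement of the hull, neither later nor earlier than the curve of tips
    does ([is_trace_unique]).  Solutions of the differential equation come from
    Picard's theorem ([picard]) applied to a truncated vector field. *)


(** * Calculus on an interval *)

(** Compactness of the segment, as an induction principle: a relation between
    endpoints that is additive and holds on all small intervals around each
    point holds between the ends of the segment. *)
Lemma interval_induction (R : realType) (P : R -> R -> Prop) (a b : R) :
  a <= b ->
  (forall x y z, a <= x <= y -> y <= z <= b -> P x y -> P y z -> P x z) ->
  (forall t, a <= t <= b -> exists2 d, 0 < d & forall x y,
     a <= x <= t -> t <= y <= b -> t - d < x -> y < t + d -> P x y) ->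
  P a b.
Proof.
move=> ab Padd Ploc.
pose S := [set x | a <= x <= b /\ P a x].
have Sa : S a.
  split; first by rewrite lexx.
  have [|d d0 H] := Ploc a; first by rewrite lexx.
  by apply: H; rewrite ?lexx//; lra.
have Sub : ubound S b by move=> x [/andP[]].
have supS : has_sup S by split; [exists a | exists b].
have supb : sup S <= b by apply: ge_sup => //; exists a.
have asup : a <= sup S by apply: ub_le_sup Sa; exists b.
have [|d d0 H] := Ploc (sup S); first by rewrite asup.
have [x [/andP[ax xb] Pax] xs] := sup_adherent d0 supS.
have xsup : x <= sup S.
  by apply: ub_le_sup; [exists b | split => //; rewrite ax].
have Pa y : sup S <= y -> y <= b -> y < sup S + d -> P a y.
  move=> y1 y2 y3; apply: (Padd _ x) => //; rewrite ?lexx ?ax//.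
    by rewrite y2 andbT; lra.
  by apply: H; rewrite ?ax ?xsup ?y1.
have [bs|sb] := leP b (sup S + d / 2).
  by apply: Pa => //; lra.
have : S (sup S + d / 2).
  by split; [apply/andP; split; lra | apply: Pa; lra].
move=> /(ub_le_sup (ex_intro _ b Sub)); lra.
Qed.

(** The mean value inequality for a function that is only continuous at the
    two endpoints. *)
Lemma nincr_within (R : realType) (f f' : R -> R) (a b : R) : a <= b ->
  {within `[a, b], continuous f} ->
  (forall x, a < x < b -> is_derive x 1 f (f' x)) ->
  (forall x, a < x < b -> f' x <= 0) -> f b <= f a.
Proof.
move=> ab cf df f'0; have [ab'|ba] := ltP a b; last first.
  by have -> : a = b by lra.
have df' x : x \in `]a, b[ -> is_derive x 1 f (f' x).
  by rewrite in_itv/=; exact: df.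
have [c] := MVT ab' df' cf.
rewrite in_itv/= => cab; have := f'0 _ cab.
nra.
Qed.

Lemma is_derive_continuous (R : realType) (f : R -> R) (x l : R) :
  is_derive x 1 f l -> {for x, continuous f}.
Proof. by move=> [df _]; apply/differentiable_continuous/derivable1_diffP. Qed.

Lemma nincr_derive (R : realType) (f f' : R -> R) (a b : R) : a <= b ->
  (forall x, a <= x <= b -> is_derive x 1 f (f' x)) ->
  (forall x, a <= x <= b -> f' x <= 0) -> f b <= f a.
Proof.
move=> ab df f'0; apply: (@nincr_within _ f f') => //.
- apply/continuous_in_subspaceT => x; rewrite inE/= in_itv/= => xab.
  exact: (is_derive_continuous (df x xab)).
- by move=> x /andP[? ?]; apply: df; rewrite !ltW.
- by move=> x /andP[? ?]; apply: f'0; rewrite !ltW.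
Qed.

(** The definition of the derivative, with explicit error. *)
Lemma is_derive_eps (R : realType) (f : R -> R) (x l : R) :
  is_derive x 1 f l -> forall e, 0 < e -> exists2 d, 0 < d &
  forall u, `|u - x| < d -> `|f u - f x - (u - x) * l| <= e * `|u - x|.
Proof.
move=> [dfx <-] e e0.
have := dfx; rewrite /derivable => /cvg_ex[/= k kl].
have -> : 'D_1 f x = k by apply: cvg_lim.
move/cvgrPdist_lt : kl => /(_ _ e0) /nbhs_ballP[d /= d0 H].
exists d => // u ux; have [->|uneqx] := eqVneq u x.
  by rewrite !subrr mul0r subr0 normr0 mulr0.
have ux0 : u - x != 0 by rewrite subr_eq0.
have := H (u - x); rewrite /ball/= sub0r normrN => /(_ ux ux0) /ltW.
rewrite /GRing.scale/= mulr1 subrK -(ler_pM2r (_ : 0 < `|u - x|)) ?normr_gt0//.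
rewrite -normrM; apply: le_trans.
rewrite le_eqVlt; apply/orP; left; apply/eqP; rewrite -[LHS]normrN.
by congr (`| _ |); field.
Qed.

Lemma continuous_eps (R : realType) (f : R -> R) (x : R) :
  {for x, continuous f} -> forall e, 0 < e -> exists2 d, 0 < d &
  forall u, `|u - x| < d -> `|f u - f x| < e.
Proof.
move=> /cvgrPdist_lt H e e0; have /nbhs_ballP[d /= d0 {}H] := H _ e0.
by exists d => // u; rewrite !(distrC u) !(distrC (f u)); exact: H.
Qed.

Lemma eps_continuous (R : realType) (f : R -> R) (x : R) :
  (forall e, 0 < e -> exists2 d, 0 < d &
  forall u, `|u - x| < d -> `|f u - f x| < e) -> {for x, continuous f}.
Proof.
move=> H; apply/cvgrPdist_lt => e e0; have [d d0 {}H] := H _ e0.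
apply/nbhs_ballP; exists d => //= u; rewrite /ball/= distrC (distrC (f x)).
exact: H.
Qed.

Lemma primitive_exists (R : realType) (f : R -> R) (S : R) : continuous f ->
  exists F : R -> R, F 0 = 0 /\
    forall s, 0 <= s <= S -> is_derive s 1 F (f s).
Proof.
move=> cf; pose G x := (\int[lebesgue_measure]_(t in [set` `[-1, x]]) (f t))%R.
exists (fun x => G x - G 0); split; first by rewrite subrr.
move=> s /andP[s0 sS].
have s1 : s < s + 1 by rewrite ltrDl.
have fi : lebesgue_measure.-integrable `[-1, s + 1] (EFin \o f).
  apply: continuous_compact_integrable; first exact: segment_compact.
  by apply/continuous_subspaceT => x; exact: cf.
have [|] := continuous_FTC1_closed s1 fi _ (cf s); first by lra.
rewrite -/G => dG <-; rewrite -[X in is_derive _ _ _ X]subr0.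
apply: is_deriveB; rewrite derive1E; exact: DeriveDef.
Qed.

(** Derivative rules stated on lambda-abstractions. *)
Section derivative_rules.
Context {R : realType}.
Implicit Types (f g : R -> R) (x a b k : R).

Lemma isd_eq f x a b : is_derive x 1 f a -> a = b -> is_derive x 1 f b.
Proof. by move=> ? <-. Qed.

Lemma isd_cst k x : is_derive x 1 (fun=> k) 0.
Proof. exact: is_derive_cst. Qed.

Lemma isd_id x : is_derive x 1 (fun s : R => s) 1.
Proof. exact: is_derive_id. Qed.

Lemma isd_add f g x a b : is_derive x 1 f a -> is_derive x 1 g b ->
  is_derive x 1 (fun s => f s + g s) (a + b).
Proof. by move=> fa gb; exact: is_deriveD. Qed.

Lemma isd_sub f g x a b : is_derive x 1 f a -> is_derive x 1 g b ->
  is_derive x 1 (fun s => f s - g s) (a - b).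
Proof. by move=> fa gb; exact: is_deriveB. Qed.

Lemma isd_opp f x a : is_derive x 1 f a -> is_derive x 1 (fun s => - f s) (- a).
Proof. by move=> fa; exact: is_deriveN. Qed.

Lemma isd_mul f g x a b : is_derive x 1 f a -> is_derive x 1 g b ->
  is_derive x 1 (fun s => f s * g s) (f x * b + a * g x).
Proof.
move=> fa gb; have H := is_deriveM fa gb.
have -> : f x * b + a * g x = f x *: b + g x *: a by rewrite (mulrC a).
exact: H.
Qed.

Lemma isd_scale k f x a : is_derive x 1 f a ->
  is_derive x 1 (fun s => k * f s) (k * a).
Proof. by move=> fa; exact: is_deriveZ. Qed.

Lemma isd_sqr f x a : is_derive x 1 f a ->
  is_derive x 1 (fun s => f s ^+ 2) (2 * f x * a).
Proof.
move=> fa; have H := isd_mul fa fa.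
by have -> : 2 * f x * a = f x * a + a * f x by ring.
Qed.

Lemma isd_inv f x a : f x != 0 -> is_derive x 1 f a ->
  is_derive x 1 (fun s => (f s)^-1) (- (f x ^- 2 * a)).
Proof.
move=> f0 fa; have H : is_derive x 1 (fun s => (f s)^-1) (- f x ^- 2 *: a) by exact: is_deriveV.
by have -> : - (f x ^- 2 * a) = - f x ^- 2 *: a by rewrite /GRing.scale/= mulNr.
Qed.

Lemma isd_comp f g x a b : is_derive x 1 f a -> is_derive (f x) 1 g b ->
  is_derive x 1 (fun s => g (f s)) (b * a).
Proof. by move=> fa gb; exact: is_derive1_comp. Qed.

Lemma isd_expM k x : is_derive x 1 (fun s => expR (k * s)) (expR (k * x) * k).
Proof.
have H := @isd_comp (fun s => k * s) expR x _ _ (isd_scale k (isd_id x))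
  (is_derive_expR (k * x)).
by rewrite mulr1 in H.
Qed.

End derivative_rules.

(** A bound on the derivative by that of another function bounds the
    increments. *)
Lemma mean_value_le (R : realType) (f f' g g' : R -> R) (a b : R) : a <= b ->
  (forall s, a <= s <= b -> is_derive s 1 f (f' s)) ->
  (forall s, a <= s <= b -> is_derive s 1 g (g' s)) ->
  (forall s, a <= s <= b -> `|f' s| <= g' s) ->
  `|f b - f a| <= g b - g a.
Proof.
move=> ab df dg fg.
have H1 : f b - g b <= f a - g a.
  apply: (@nincr_derive _ (fun s => f s - g s) (fun s => f' s - g' s)) => //.
    by move=> s sab; apply: isd_sub; [exact: df | exact: dg].
  by move=> s /fg; rewrite ler_norml => /andP[_]; rewrite subr_le0.
have H2 : - f b - g b <= - f a - g a.
  apply: (@nincr_derive _ (fun s => - f s - g s) (fun s => - f' s - g' s)) => //.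
    by move=> s sab; apply: isd_sub; [apply: isd_opp; exact: df | exact: dg].
  by move=> s /fg; rewrite ler_norml => /andP[]; lra.
by rewrite ler_norml; apply/andP; split; lra.
Qed.

Lemma mean_value_lin (R : realType) (f f' : R -> R) (K a b : R) : a <= b ->
  (forall s, a <= s <= b -> is_derive s 1 f (f' s)) ->
  (forall s, a <= s <= b -> `|f' s| <= K) -> `|f b - f a| <= K * (b - a).
Proof.
move=> ab df fK; rewrite mulrBr.
apply: (@mean_value_le _ f f' (fun s => K * s) (fun=> K * 1)) => //.
by move=> s sab; rewrite mulr1 fK.
Qed.

(** * Existence and uniqueness for Lipschitz equations in the plane *)

(** Gronwall's inequality in the plane, in the form used for the difference of
    two solutions. *)
Lemma gronwall (R : realType) (x y x' y' : R -> R) (L S : R) : 0 <= L ->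
  0 <= S -> {within `[0, S], continuous x} -> {within `[0, S], continuous y} ->
  (forall s, 0 < s < S -> is_derive s 1 x (x' s)) ->
  (forall s, 0 < s < S -> is_derive s 1 y (y' s)) ->
  (forall s, 0 < s < S -> `|x' s| <= L * (`|x s| + `|y s|)) ->
  (forall s, 0 < s < S -> `|y' s| <= L * (`|x s| + `|y s|)) ->
  x S ^+ 2 + y S ^+ 2 <= (x 0 ^+ 2 + y 0 ^+ 2) * expR (4 * L * S).
Proof.
move=> L0 S0 cx cy dx dy xL yL.
pose f s := (x s ^+ 2 + y s ^+ 2) * expR (- (4 * L) * s).
pose f' s := (x s ^+ 2 + y s ^+ 2) * (expR (- (4 * L) * s) * (- (4 * L))) +
  (2 * x s * x' s + 2 * y s * y' s) * expR (- (4 * L) * s).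
have : f S <= f 0.
  apply: (@nincr_within _ f f') => //.
  - move=> s; rewrite /f; apply: cvgM; first by apply: cvgD; apply: cvgM;
      [exact: cx | exact: cx | exact: cy | exact: cy].
    have ce : continuous (fun s : R => expR (- (4 * L) * s)).
      by move=> r; exact: (is_derive_continuous (isd_expM _ _)).
    exact: (continuous_subspaceT ce).
  - move=> s sS; apply: isd_mul.
      by apply: isd_add; apply: isd_sqr; [exact: dx | exact: dy].
    exact: isd_expM.
  - move=> s sS; rewrite /f'.
    have -> : forall X E, X * (E * (- (4 * L))) +
       (2 * x s * x' s + 2 * y s * y' s) * E =
       E * (2 * x s * x' s + 2 * y s * y' s - 4 * L * X).
      by move=> X E; ring.
    rewrite mulr_ge0_le0 ?expR_ge0//.
    have {}xL := xL _ sS; have {}yL := yL _ sS.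
    have H1 : x s * x' s <= `|x s| * (L * (`|x s| + `|y s|)).
      by rewrite (le_trans (ler_norm _))// normrM ler_wpM2l.
    have H2 : y s * y' s <= `|y s| * (L * (`|x s| + `|y s|)).
      by rewrite (le_trans (ler_norm _))// normrM ler_wpM2l.
    rewrite -(real_normK (num_real (x s))) -(real_normK (num_real (y s))).
    have : 0 <= L * (`|x s| - `|y s|) ^+ 2 by rewrite mulr_ge0 ?sqr_ge0.
    nra.
rewrite /f mulr0 expR0 mulr1 => H.
by rewrite -ler_pdivrMr ?expR_gt0// -expRN -mulNr.
Qed.

Lemma geometric_limit (R : realType) (u : nat -> R) (B : R) :
  (forall n, `|u n.+1 - u n| <= B / 2 ^+ n) ->
  exists l, forall n, `|u n - l| <= 2 * B / 2 ^+ n.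
Proof.
move=> uB; pose e n := 2 * B / 2 ^+ n.
have eS n : e n = B / 2 ^+ n + e n.+1.
  rewrite /e exprS; field.
  by rewrite expf_neq0// pnatr_eq0.
have B0 : 0 <= B by have := uB 0; rewrite expr0 divr1; apply: le_trans.
have e0 n : 0 <= e n by rewrite /e divr_ge0 ?exprn_ge0 ?mulr_ge0.
have dn m n : u n - e n <= u (n + m)%N - e (n + m)%N.
  elim: m => [|m IH]; first by rewrite addn0.
  rewrite addnS; apply: le_trans IH _; have := uB (n + m)%N.
  by rewrite ler_norml => /andP[] + _; have := eS (n + m)%N; lra.
have up m n : u (n + m)%N + e (n + m)%N <= u n + e n.
  elim: m => [|m IH]; first by rewrite addn0.
  rewrite addnS; apply: le_trans IH; have := uB (n + m)%N.
  by rewrite ler_norml => /andP[_]; have := eS (n + m)%N; lra.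
have le m n : u m - e m <= u n + e n.
  have := dn n m; have := up m n; rewrite (addnC n).
  by have := e0 (m + n)%N; lra.
exists (sup [set u n - e n | n in setT]) => n; rewrite -/(e n) ler_distl.
apply/andP; split.
  by rewrite lerBlDr; apply: ge_sup;
    [exists (u 0%N - e 0%N), 0%N | move=> _ [m _ <-]].
have : u n - e n <= sup [set u n - e n | n in setT].
  apply: ub_le_sup; last by exists n.
  by exists (u 0%N + e 0%N) => _ [m _ <-].
by lra.
Qed.

(** The retraction of the line onto [0, S], for [0 <= S]. *)
Definition clamp (R : realType) (S s : R) : R := Num.min (Num.max s 0) S.

Lemma clamp_itv (R : realType) (S s : R) : 0 <= S -> 0 <= clamp S s <= S.
Proof.
by move=> S0; rewrite /clamp le_min le_max lexx orbT S0/= ge_min lexx orbT.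
Qed.

Lemma clamp_id (R : realType) (S s : R) : 0 <= s <= S -> clamp S s = s.
Proof. by move=> /andP[s0 sS]; rewrite /clamp max_l// min_l. Qed.

Lemma clamp_lip (R : realType) (S s t : R) : `|clamp S s - clamp S t| <= `|s - t|.
Proof.
have H a b c d : `|Num.max a b - Num.max c b| <= d ->
    `|Num.min (Num.max a b) S - Num.min (Num.max c b) S| <= d.
  set u := Num.max a b; set v := Num.max c b => uv.
  apply: le_trans uv; rewrite /Num.min.
  by case: ltP => ?; case: ltP => ?; rewrite ler_norml; apply/andP; split;
    have := ler_norm (u - v); have := ler_norm (v - u); rewrite (distrC v); lra.
rewrite /clamp; apply: H; rewrite /Num.max.
by case: ltP => ?; case: ltP => ?; rewrite ler_norml; apply/andP; split;
  have := ler_norm (s - t); have := ler_norm (t - s); rewrite (distrC t); lra.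
Qed.

Lemma continuous_clamp (R : realType) (S : R) (f : R -> R) : 0 <= S ->
  (forall s, 0 <= s <= S -> {for s, continuous f}) ->
  continuous (fun s => f (clamp S s)).
Proof.
move=> S0 cf s.
apply: eps_continuous => e epos.
have [d d0 H] := continuous_eps (cf _ (clamp_itv s S0)) epos.
by exists d => // u us; apply: H; apply: le_lt_trans us; exact: clamp_lip.
Qed.

Lemma le_geometric0 (R : realType) (x B : R) : 0 <= B ->
  (forall n : nat, x <= B / 2 ^+ n) -> x <= 0.
Proof.
move=> B0 H; rewrite leNgt; apply/negP => x0.
have [n Hn] : exists n : nat, B / x < n%:R.
  by exists (Num.bound (B / x)); rewrite archi_boundP// divr_ge0// ltW.
have := H n; rewrite ler_pdivlMr ?exprn_gt0//.
have : (n%:R : R) <= 2 ^+ n by rewrite -natrX ler_nat ltnW// ltn_expl.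
move: Hn; rewrite ltr_pdivrMr//; nra.
Qed.

(** Picard's theorem for a planar system x' = F(s, x, y), y' = G(s, x, y) with
    bounded right-hand side, globally Lipschitz in (x, y).  The solution is
    differentiable, in the two-sided sense, at every point of [0, S]. *)
Theorem picard (R : realType) (F G : R -> R -> R -> R) (L M S x0 y0 : R) :
  0 < L -> 0 <= S ->
  (forall s x y, `|F s x y| <= M) -> (forall s x y, `|G s x y| <= M) ->
  (forall s x y x' y',
    `|F s x y - F s x' y'| <= L * (`|x - x'| + `|y - y'|)) ->
  (forall s x y x' y',
    `|G s x y - G s x' y'| <= L * (`|x - x'| + `|y - y'|)) ->
  (forall x y, continuous x -> continuous y ->
    continuous (fun s => F s (x s) (y s))) ->
  (forall x y, continuous x -> continuous y ->
    continuous (fun s => G s (x s) (y s))) ->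
  exists x y : R -> R, [/\ x 0 = x0, y 0 = y0 &
    forall s, 0 <= s <= S -> is_derive s 1 x (F s (x s) (y s)) /\
                             is_derive s 1 y (G s (x s) (y s))].
Proof.
move=> L0 S0 FM GM FL GL cF cG.
have M0 : 0 <= M by apply: le_trans (FM 0 0 0).
pose good (p : (R -> R) * (R -> R)) := forall s, 0 <= s <= S ->
  {for s, continuous p.1} /\ {for s, continuous p.2}.
pose next (p q : (R -> R) * (R -> R)) := [/\ q.1 0 = x0, q.2 0 = y0 &
  forall s, 0 <= s <= S -> is_derive s 1 q.1 (F s (p.1 s) (p.2 s)) /\
                           is_derive s 1 q.2 (G s (p.1 s) (p.2 s))].
have nextP p : exists q, good p -> next p q.
  have [gp|] := pselect (good p); last by exists p.
  have c1 : continuous (fun s => p.1 (clamp S s)).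
    by apply: continuous_clamp => // s /gp[].
  have c2 : continuous (fun s => p.2 (clamp S s)).
    by apply: continuous_clamp => // s /gp[].
  have [X [X0 dX]] := primitive_exists S (cF _ _ c1 c2).
  have [Y [Y0 dY]] := primitive_exists S (cG _ _ c1 c2).
  exists (fun s => x0 + X s, fun s => y0 + Y s) => _; split => /=.
  - by rewrite X0 addr0.
  - by rewrite Y0 addr0.
  - move=> s sS; have := dX _ sS; have := dY _ sS; rewrite clamp_id// => dYs dXs.
    by split; [have := isd_add (isd_cst x0 s) dXs |
               have := isd_add (isd_cst y0 s) dYs]; rewrite add0r.
have [Phi PhiP] := choice nextP.
pose u n := iter n Phi (cst x0, cst y0).
have next_good p q : next p q -> good q.
  move=> [_ _ H] s sS; have [Hx Hy] := H s sS.
  by split; [exact: is_derive_continuous Hx | exact: is_derive_continuous Hy].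
have gu n : good (u n).
  elim: n => [|n IH]; first by move=> s _; split; exact: cst_continuous.
  exact: (next_good (u n)) (PhiP _ IH).
have nu n : next (u n) (u n.+1) by exact: PhiP (gu n).
have u10 n : (u n).1 0 = x0 by case: n => // n; have [] := nu n.
have u20 n : (u n).2 0 = y0 by case: n => // n; have [] := nu n.
pose A := M * S.
have A0 : 0 <= A by rewrite mulr_ge0.
(* With the weight exp(4Ls), each Picard step halves the distance. *)
have E n : forall s, 0 <= s <= S ->
   `|(u n.+1).1 s - (u n).1 s| <= A / 2 ^+ n * expR (4 * L * s) /\
   `|(u n.+1).2 s - (u n).2 s| <= A / 2 ^+ n * expR (4 * L * s).
  elim: n => [|n IH] s /andP[s0 sS].
    have sub r : 0 <= r <= s -> 0 <= r <= S.
      by move=> /andP[-> rs]; rewrite (le_trans rs).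
    have [_ _ H] := nu 0%N.
    have H0 : M * (s - 0) <= A / 2 ^+ 0 * expR (4 * L * s).
      rewrite subr0 expr0 divr1 (@le_trans _ _ A)// ?ler_wpM2l//.
      by rewrite ler_peMr// -expR0 ler_expR mulr_ge0// mulr_ge0// ltW.
    split; apply: le_trans H0.
    - rewrite -[(u 0%N).1 s](u10 1%N).
      apply: (mean_value_lin s0 (f' := fun r => F r x0 y0)).
      + by move=> r /sub /H [].
      + by move=> r _.
    - rewrite -[(u 0%N).2 s](u20 1%N).
      apply: (mean_value_lin s0 (f' := fun r => G r x0 y0)).
      + by move=> r /sub /H [].
      + by move=> r _.
  have sub r : 0 <= r <= s -> 0 <= r <= S.
    by move=> /andP[-> rs]; rewrite (le_trans rs).
  have [_ _ H1] := nu n.+1; have [_ _ H0] := nu n.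
  pose k := A / 2 ^+ n.+1.
  have kE : A / 2 ^+ n = 2 * k by rewrite /k exprS; field; rewrite expf_neq0.
  have k0 : 0 <= k by rewrite /k divr_ge0// exprn_ge0.
  pose g' r := k * (expR (4 * L * r) * (4 * L)).
  have dg r : 0 <= r <= s -> is_derive r 1 (fun r => k * expR (4 * L * r)) (g' r).
    by move=> _; apply: isd_scale; exact: isd_expM.
  have B r : 0 <= r <= s ->
      L * (`|(u n.+1).1 r - (u n).1 r| + `|(u n.+1).2 r - (u n).2 r|) <= g' r.
    move=> /sub /IH [IH1 IH2]; move: IH1 IH2; rewrite kE /g' => IH1 IH2.
    have -> : k * (expR (4 * L * r) * (4 * L)) =
      L * (2 * k * expR (4 * L * r) + 2 * k * expR (4 * L * r)) by ring.
    by rewrite ler_pM2l// lerD.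
  rewrite -/k.
  have kk : k * expR (4 * L * s) - k * expR (4 * L * 0) <= k * expR (4 * L * s).
    by rewrite gerBl mulr_ge0// expR_ge0.
  split; apply: le_trans kk.
  - have H := @mean_value_le _ (fun r => (u n.+2).1 r - (u n.+1).1 r)
      (fun r => F r ((u n.+1).1 r) ((u n.+1).2 r) - F r ((u n).1 r) ((u n).2 r))
      (fun r => k * expR (4 * L * r)) g' 0 s s0.
    move: H; rewrite !u10 subrr subr0; apply => //.
    + by move=> r /sub rS; apply: isd_sub; [have [] := H1 r rS|have [] := H0 r rS].
    + by move=> r rs; apply: le_trans (B r rs).
  - have H := @mean_value_le _ (fun r => (u n.+2).2 r - (u n.+1).2 r)
      (fun r => G r ((u n.+1).1 r) ((u n.+1).2 r) - G r ((u n).1 r) ((u n).2 r))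
      (fun r => k * expR (4 * L * r)) g' 0 s s0.
    move: H; rewrite !u20 subrr subr0; apply => //.
    + by move=> r /sub rS; apply: isd_sub; [have [] := H1 r rS|have [] := H0 r rS].
    + by move=> r rs; apply: le_trans (B r rs).
pose B := A * expR (4 * L * S).
have B0 : 0 <= B by rewrite mulr_ge0// expR_ge0.
have EB n s : 0 <= s <= S -> `|(u n.+1).1 s - (u n).1 s| <= B / 2 ^+ n /\
                             `|(u n.+1).2 s - (u n).2 s| <= B / 2 ^+ n.
  move=> sS; have [E1 E2] := E n s sS.
  have : A / 2 ^+ n * expR (4 * L * s) <= B / 2 ^+ n.
    rewrite mulrAC ler_wpM2r ?invr_ge0 ?exprn_ge0// ler_wpM2l// ler_expR.
    by case/andP: sS => _; rewrite ler_pM2l// mulr_gt0.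
  by move=> AB; split; exact: le_trans AB.
have lx s : exists l, 0 <= s <= S -> forall n, `|(u n).1 s - l| <= 2 * B / 2 ^+ n.
  have [sS|] := boolP (0 <= s <= S); last by exists 0.
  have [|l ?] := @geometric_limit _ (fun n => (u n).1 s) B; last by exists l.
  by move=> n; have [] := EB n s sS.
have ly s : exists l, 0 <= s <= S -> forall n, `|(u n).2 s - l| <= 2 * B / 2 ^+ n.
  have [sS|] := boolP (0 <= s <= S); last by exists 0.
  have [|l ?] := @geometric_limit _ (fun n => (u n).2 s) B; last by exists l.
  by move=> n; have [] := EB n s sS.
have [x xP] := choice lx; have [y yP] := choice ly.
have lip n r s : 0 <= r <= S -> 0 <= s <= S -> r <= s ->
    `|(u n.+1).1 s - (u n.+1).1 r| <= M * (s - r) /\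
    `|(u n.+1).2 s - (u n.+1).2 r| <= M * (s - r).
  move=> /andP[r0 rS] /andP[s0 sS] rs.
  have sub t : r <= t <= s -> 0 <= t <= S.
    by move=> /andP[rt ts]; rewrite (le_trans r0 rt) (le_trans ts).
  have [_ _ H] := nu n.
  split.
  - apply: (mean_value_lin rs (f' := fun t => F t ((u n).1 t) ((u n).2 t))).
    + by move=> t /sub /H [].
      + by move=> t _.
  - apply: (mean_value_lin rs (f' := fun t => G t ((u n).1 t) ((u n).2 t))).
    + by move=> t /sub /H [].
      + by move=> t _.
have limlip (z : R -> R) (v : nat -> R -> R) :
   (forall s, 0 <= s <= S -> forall n, `|v n s - z s| <= 2 * B / 2 ^+ n) ->
   (forall n r s, 0 <= r <= S -> 0 <= s <= S -> r <= s ->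
    `|v n.+1 s - v n.+1 r| <= M * (s - r)) ->
   continuous (fun s => z (clamp S s)).
  move=> vz vlip.
  have H r s : 0 <= r <= S -> 0 <= s <= S -> r <= s -> `|z s - z r| <= M * (s - r).
    move=> rS sS rs; rewrite -subr_le0.
    apply: (@le_geometric0 _ _ (4 * B)) => [|n]; first by rewrite mulr_ge0.
    have h1 := vz _ rS n.+1; have h2 := vz _ sS n.+1.
    have h3 := vlip n _ _ rS sS rs.
    have h4 : `|z s - z r| <= `|v n.+1 s - z s| + `|v n.+1 r - z r|
       + `|v n.+1 s - v n.+1 r|.
      have -> : z s - z r = - (v n.+1 s - z s) + (v n.+1 r - z r)
        + (v n.+1 s - v n.+1 r) by ring.
      apply: (le_trans (ler_normD _ _)); rewrite lerD2r.
      by apply: (le_trans (ler_normD _ _)); rewrite normrN.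
    have h5 : 4 * B / 2 ^+ n = 2 * B / 2 ^+ n.+1 + (2 * B / 2 ^+ n.+1) * 3.
      by rewrite exprS; field; rewrite expf_neq0.
    have h6 : 0 <= 2 * B / 2 ^+ n.+1 by rewrite divr_ge0 ?exprn_ge0 ?mulr_ge0.
    lra.
  move=> s; apply: eps_continuous => e e0.
  exists (e / (M + 1)); first by rewrite divr_gt0// ltr_wpDl.
  move=> t ts; have cc := clamp_lip S t s.
  have [c1 c2] := (clamp_itv t S0, clamp_itv s S0).
  have : `|z (clamp S t) - z (clamp S s)| <= M * `|clamp S t - clamp S s|.
    have [tsS|stS] := leP (clamp S t) (clamp S s).
      rewrite distrC (distrC (clamp S t)).
      by rewrite (@ger0_norm _ (_ - clamp S t)) ?subr_ge0//; exact: H.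
    by rewrite (@ger0_norm _ (_ - clamp S s)) ?subr_ge0 ?(ltW stS)//; apply: H => //; exact: ltW.
  move/le_lt_trans; apply; apply: (@le_lt_trans _ _ (M * `|t - s|)).
    by rewrite ler_wpM2l.
  move: ts; rewrite ltr_pdivlMr ?ltr_wpDl// => ts.
  have := normr_ge0 (t - s); have [->|tsn] := eqVneq (`|t - s|) 0; first by lra.
  by move=> ?; nra.
have cx : continuous (fun s => x (clamp S s)).
  apply: (limlip x (fun n => (u n).1)); first by move=> s sS n; apply: xP.
  by move=> n r s rS sS rs; have [] := lip n r s rS sS rs.
have cy : continuous (fun s => y (clamp S s)).
  apply: (limlip y (fun n => (u n).2)); first by move=> s sS n; apply: yP.
  by move=> n r s rS sS rs; have [] := lip n r s rS sS rs.
have [X [X0 dX]] := primitive_exists S (cF _ _ cx cy).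
have [Y [Y0 dY]] := primitive_exists S (cG _ _ cx cy).
(* The primitive of the limiting right-hand side is the limit itself. *)
have XE (z Z : R -> R) (z0 : R) (f : R -> R -> R -> R) (v : nat -> R -> R) :
    (forall s x y x' y',
      `|f s x y - f s x' y'| <= L * (`|x - x'| + `|y - y'|)) ->
    (forall s, 0 <= s <= S -> forall n, `|v n s - z s| <= 2 * B / 2 ^+ n) ->
    (forall n s, 0 <= s <= S ->
      is_derive s 1 (v n.+1) (f s ((u n).1 s) ((u n).2 s))) ->
    (forall n, v n 0 = z0) -> Z 0 = 0 ->
    (forall s, 0 <= s <= S ->
       is_derive s 1 Z (f s (x (clamp S s)) (y (clamp S s)))) ->
    forall s, 0 <= s <= S -> z0 + Z s = z s.
  move=> fL vz dv v0 Z0 dZ s /andP[s0 sS].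
  have sub t : 0 <= t <= s -> 0 <= t <= S.
    by move=> /andP[-> ts]; rewrite (le_trans ts).
  apply/eqP; rewrite -subr_eq0 -normr_le0.
  apply: (@le_geometric0 _ _ (B + S * L * (4 * B))) => [|n].
    by rewrite addr_ge0// !mulr_ge0// ltW.
  have h1 : `|(v n.+1 s - Z s) - (v n.+1 0 - Z 0)| <=
      (L * (4 * B / 2 ^+ n)) * (s - 0).
    apply: (mean_value_lin s0 (f := fun t => v n.+1 t - Z t)
      (f' := fun t => f t ((u n).1 t) ((u n).2 t) -
        f t (x (clamp S t)) (y (clamp S t)))).
    - by move=> t /sub tS; apply: isd_sub; [exact: dv | exact: dZ].
    - move=> t /sub tS; apply: (le_trans (fL _ _ _ _ _)).
      rewrite ler_pM2l// clamp_id//.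
      have := xP _ tS n; have := yP _ tS n.
      have -> : 4 * B / 2 ^+ n = 2 * B / 2 ^+ n + 2 * B / 2 ^+ n.
        by field; rewrite expf_neq0.
      lra.
  move: h1; rewrite v0 Z0 !subr0 => h1.
  have h2 : `|v n.+1 s - z s| <= B / 2 ^+ n.
    have -> : B / 2 ^+ n = 2 * B / 2 ^+ n.+1.
      by rewrite exprS; field; rewrite expf_neq0.
    by apply: vz; rewrite s0.
  have h3 : L * (4 * B / 2 ^+ n) * s <= S * L * (4 * B) / 2 ^+ n.
    have -> : S * L * (4 * B) / 2 ^+ n = L * (4 * B / 2 ^+ n) * S by ring.
    by rewrite ler_wpM2l// mulr_ge0 ?divr_ge0 ?exprn_ge0 ?mulr_ge0// ltW.
  have -> : z0 + Z s - z s = (v n.+1 s - z s) - (v n.+1 s - Z s - z0) by ring.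
  apply: (le_trans (ler_normB _ _)); rewrite mulrDl; apply: lerD => //.
  exact: le_trans h3.
have Xx s : 0 <= s <= S -> x0 + X s = x s.
  apply: (XE x X x0 F (fun n => (u n).1)) => //.
  by move=> n r rS; have [_ _ /(_ r rS)[]] := nu n.
have Yy s : 0 <= s <= S -> y0 + Y s = y s.
  apply: (XE y Y y0 G (fun n => (u n).2)) => //.
  by move=> n r rS; have [_ _ /(_ r rS)[]] := nu n.
exists (fun s => x0 + X s), (fun s => y0 + Y s); split.
- by rewrite X0 addr0.
- by rewrite Y0 addr0.
- move=> s sS; rewrite Xx// Yy//.
  have := dX s sS; have := dY s sS; rewrite clamp_id// => dYs dXs.
  by split; [have := isd_add (isd_cst x0 s) dXs |
             have := isd_add (isd_cst y0 s) dYs]; rewrite add0r.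
Qed.

(** * The Loewner vector field *)

(** [inv_re X Y] and [- inv_im X Y] are the real and imaginary parts of
    1 / (X + iY). *)
Definition inv_re (R : realType) (X Y : R) : R := X / (X ^+ 2 + Y ^+ 2).
Definition inv_im (R : realType) (X Y : R) : R := Y / (X ^+ 2 + Y ^+ 2).

Lemma sqrD_gt0 (R : realType) (X Y : R) : 0 < Y -> 0 < X ^+ 2 + Y ^+ 2.
Proof. by move=> Y0; rewrite ltr_wpDl ?sqr_ge0// exprn_gt0. Qed.

Lemma inv_bound (R : realType) (X Y m : R) : 0 < m -> m <= Y ->
  `|inv_re X Y| <= m^-1 /\ `|inv_im X Y| <= m^-1.
Proof.
move=> m0 mY; have Y0 : 0 < Y by exact: lt_le_trans mY.
have N0 := sqrD_gt0 X Y0.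
have H a : a ^+ 2 <= X ^+ 2 + Y ^+ 2 -> `|a / (X ^+ 2 + Y ^+ 2)| <= m^-1.
  move=> aN; rewrite normrM normfV (gtr0_norm N0) ler_pdivrMr// mulrC.
  rewrite ler_pdivlMr// -ler_sqr ?nnegrE ?mulr_ge0 ?(ltW m0) ?(ltW N0)//.
  rewrite exprMn real_normK ?num_real// [leRHS]expr2.
  apply: ler_pM; rewrite ?sqr_ge0//.
  have : m ^+ 2 <= Y ^+ 2 by rewrite ler_sqr// nnegrE ltW.
  by have := sqr_ge0 X; lra.
by split; apply: H; have := sqr_ge0 X; have := sqr_ge0 Y; lra.
Qed.

(** 1 / Z is Lipschitz on the half-plane Im Z >= m. *)
Lemma inv_lip (R : realType) (X Y X' Y' m : R) : 0 < m -> m <= Y -> m <= Y' ->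
  `|inv_re X Y - inv_re X' Y'| <= (m ^+ 2)^-1 * (`|X - X'| + `|Y - Y'|) /\
  `|inv_im X Y - inv_im X' Y'| <= (m ^+ 2)^-1 * (`|X - X'| + `|Y - Y'|).
Proof.
move=> m0 mY mY'; have Y0 : 0 < Y by exact: lt_le_trans mY.
have Y'0 : 0 < Y' by exact: lt_le_trans mY'.
have N0 := sqrD_gt0 X Y0; have N'0 := sqrD_gt0 X' Y'0.
set N := X ^+ 2 + Y ^+ 2 in N0; set N' := X' ^+ 2 + Y' ^+ 2 in N'0.
have m20 : 0 < m ^+ 2 by rewrite exprn_gt0.
have Nm : m ^+ 2 <= N.
  have : m ^+ 2 <= Y ^+ 2 by rewrite ler_sqr// nnegrE ltW.
  by have := sqr_ge0 X; rewrite /N; lra.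
have N'm : m ^+ 2 <= N'.
  have : m ^+ 2 <= Y' ^+ 2 by rewrite ler_sqr// nnegrE ltW.
  by have := sqr_ge0 X'; rewrite /N'; lra.
have B a : a ^+ 2 <= N * N' -> `|a / (N * N')| <= (m ^+ 2)^-1.
  move=> aN; have NN0 : 0 < N * N' by rewrite mulr_gt0.
  rewrite normrM normfV (gtr0_norm NN0) ler_pdivrMr// mulrC.
  rewrite ler_pdivlMr// -ler_sqr ?nnegrE ?mulr_ge0 ?(ltW m0) ?(ltW N0) ?(ltW N'0)//.
  rewrite exprMn real_normK ?num_real// [leRHS]expr2.
  have mN : m ^+ 2 ^+ 2 <= N * N' by rewrite (expr2 (m ^+ 2)); nra.
  by apply: ler_pM => //; rewrite ?sqr_ge0// ltW.
have B1 : `|(X * X' - Y * Y') / (N * N')| <= (m ^+ 2)^-1.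
  by apply: B; have := sqr_ge0 (X * Y' + Y * X'); rewrite /N /N'; nra.
have B2 : `|(X * Y' + Y * X') / (N * N')| <= (m ^+ 2)^-1.
  by apply: B; have := sqr_ge0 (X * X' - Y * Y'); rewrite /N /N'; nra.
have Nn : N != 0 by rewrite gt_eqF.
have N'n : N' != 0 by rewrite gt_eqF.
have T (a b c d : R) : `|a| <= (m ^+ 2)^-1 -> `|b| <= (m ^+ 2)^-1 ->
    `|a * c + b * d| <= (m ^+ 2)^-1 * (`|c| + `|d|).
  move=> ha hb; apply: (le_trans (ler_normD _ _)); rewrite !normrM mulrDr.
  by apply: lerD; exact: ler_wpM2r.
rewrite /inv_re /inv_im -/N -/N'; split.
- have -> : X / N - X' / N' = - ((X * X' - Y * Y') / (N * N')) * (X - X') +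
      - ((X * Y' + Y * X') / (N * N')) * (Y - Y').
    by rewrite /N /N'; field; rewrite Nn N'n.
  by apply: T; rewrite normrN.
- have -> : Y / N - Y' / N' = - ((X * Y' + Y * X') / (N * N')) * (X - X') +
      ((X * X' - Y * Y') / (N * N')) * (Y - Y').
    by rewrite /N /N'; field; rewrite Nn N'n.
  by apply: T; rewrite ?normrN.
Qed.

Lemma max_lip (R : realType) (y y' m : R) :
  `|Num.max y m - Num.max y' m| <= `|y - y'|.
Proof.
rewrite /Num.max; case: ltP => ?; case: ltP => ?; rewrite ler_norml;
by apply/andP; split; have := ler_norm (y - y'); have := ler_norm (y' - y);
  rewrite (distrC y'); lra.
Qed.

Lemma continuous_max_cst (R : realType) (y : R -> R) (m : R) :
  continuous y -> continuous (fun s => Num.max (y s) m).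
Proof.
move=> cy s; apply: eps_continuous => e e0.
have [d d0 H] := continuous_eps (cy s) e0.
by exists d => // u us; apply: le_lt_trans (H u us); exact: max_lip.
Qed.

(** The planar system u' = k / (u - W) at time [s], with the imaginary part
    truncated below at [m] so that the vector field is bounded and Lipschitz. *)
Definition trunc_eq (R : realType) (k : R) (W : R -> R) (m : R) (x y : R -> R)
    (s : R) : Prop :=
  is_derive s 1 x (k * inv_re (x s - W s) (Num.max (y s) m)) /\
  is_derive s 1 y (- k * inv_im (x s - W s) (Num.max (y s) m)).

Lemma trunc_exists (R : realType) (k : R) (W : R -> R) (m S x0 y0 : R) :
  continuous W -> 0 < m -> 0 <= S ->
  exists x y : R -> R, [/\ x 0 = x0, y 0 = y0 &
    forall s, 0 <= s <= S -> trunc_eq k W m x y s].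
Proof.
move=> cW m0 S0.
have mx y : m <= Num.max y m by rewrite le_max lexx orbT.
have mx0 y : 0 < Num.max y m by exact: lt_le_trans (mx y).
have L0 : 0 < `|k| * (m ^+ 2)^-1 + 1.
  by rewrite ltr_wpDl// mulr_ge0// invr_ge0 exprn_ge0// ltW.
have cN x y : continuous x -> continuous y -> forall s,
    (x r - W r) ^+ 2 + Num.max (y r) m ^+ 2 @[r --> s] -->
    (x s - W s) ^+ 2 + Num.max (y s) m ^+ 2.
  move=> cx cy s; have cX : x r - W r @[r --> s] --> x s - W s.
    by apply: cvgB; [exact: cx | exact: cW].
  have cP : Num.max (y r) m @[r --> s] --> Num.max (y s) m.
    exact: continuous_max_cst.
  by apply: cvgD; apply: cvgM.
have cNV x y : continuous x -> continuous y -> forall s,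
    ((x r - W r) ^+ 2 + Num.max (y r) m ^+ 2)^-1 @[r --> s] -->
    ((x s - W s) ^+ 2 + Num.max (y s) m ^+ 2)^-1.
  by move=> cx cy s; apply: cvgV; [rewrite gt_eqF// sqrD_gt0|exact: cN].
have T s x x' y y' a :
    a <= (m ^+ 2)^-1 * (`|x - W s - (x' - W s)| +
                        `|Num.max y m - Num.max y' m|) ->
    `|k| * a <= (`|k| * (m ^+ 2)^-1 + 1) * (`|x - x'| + `|y - y'|).
  have -> : x - W s - (x' - W s) = x - x' by ring.
  have := max_lip y y' m; have := normr_ge0 (x - x').
  have := normr_ge0 (y - y'); have := normr_ge0 k.
  have : 0 <= (m ^+ 2)^-1 by rewrite invr_ge0 exprn_ge0// ltW.
  set q := (m ^+ 2)^-1; set u := `|x - x'|; set v := `|y - y'|; set w := `|_ - _|.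
  move=> q0 k0 v0 u0 wv aq.
  have : `|k| * a <= `|k| * (q * (u + v)).
    by rewrite ler_wpM2l// (le_trans aq)// ler_wpM2l// lerD2l.
  by rewrite mulrA mulrDl mul1r; lra.
apply: (@picard _ (fun s x y => k * inv_re (x - W s) (Num.max y m))
  (fun s x y => - k * inv_im (x - W s) (Num.max y m))
  (`|k| * (m ^+ 2)^-1 + 1) (`|k| / m) S x0 y0) => //.
- move=> s x y; rewrite normrM ler_wpM2l//.
  by have [] := inv_bound (x - W s) m0 (mx y).
- move=> s x y; rewrite normrM normrN ler_wpM2l//.
  by have [] := inv_bound (x - W s) m0 (mx y).
- move=> s x y x' y'; rewrite -mulrBr normrM; apply: (T s).
  by have [] := inv_lip (x - W s) (x' - W s) m0 (mx y) (mx y').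
- move=> s x y x' y'; rewrite -mulrBr normrM normrN; apply: (T s).
  by have [] := inv_lip (x - W s) (x' - W s) m0 (mx y) (mx y').
- move=> x y cx cy s; rewrite /inv_re; apply: cvgM; first exact: cvg_cst.
  apply: cvgM; first by apply: cvgB; [exact: cx | exact: cW].
  exact: cNV.
- move=> x y cx cy s; rewrite /inv_im; apply: cvgM; first exact: cvg_cst.
  apply: cvgM; last exact: cNV.
  exact: continuous_max_cst.
Qed.

(** Two solutions of the truncated system stay as close as their initial values
    allow. *)
Lemma trunc_gronwall (R : realType) (k : R) (W : R -> R) (m S : R)
    (x y x' y' : R -> R) : 0 < m -> 0 <= S ->
  {within `[0, S], continuous x} -> {within `[0, S], continuous y} ->
  {within `[0, S], continuous x'} -> {within `[0, S], continuous y'} ->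
  (forall s, 0 < s < S -> trunc_eq k W m x y s) ->
  (forall s, 0 < s < S -> trunc_eq k W m x' y' s) ->
  (x S - x' S) ^+ 2 + (y S - y' S) ^+ 2 <=
  ((x 0 - x' 0) ^+ 2 + (y 0 - y' 0) ^+ 2) *
  expR (4 * (`|k| * (m ^+ 2)^-1) * S).
Proof.
move=> m0 S0 cx cy cx' cy' H H'.
have mx z : m <= Num.max z m by rewrite le_max lexx orbT.
have T s a : a <= (m ^+ 2)^-1 * (`|x s - W s - (x' s - W s)| +
                        `|Num.max (y s) m - Num.max (y' s) m|) ->
    `|k| * a <= `|k| * (m ^+ 2)^-1 * (`|x s - x' s| + `|y s - y' s|).
  have -> : x s - W s - (x' s - W s) = x s - x' s by ring.
  move=> aq; rewrite -mulrA ler_wpM2l// (le_trans aq)// ler_wpM2l//.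
    by rewrite invr_ge0 exprn_ge0// ltW.
  by rewrite lerD2l max_lip.
apply: (@gronwall _ (fun s => x s - x' s) (fun s => y s - y' s)
  (fun s => k * inv_re (x s - W s) (Num.max (y s) m) -
            k * inv_re (x' s - W s) (Num.max (y' s) m))
  (fun s => - k * inv_im (x s - W s) (Num.max (y s) m) -
            - k * inv_im (x' s - W s) (Num.max (y' s) m))) => //.
- by rewrite mulr_ge0// invr_ge0 exprn_ge0// ltW.
- by move=> s; apply: cvgB; [exact: cx | exact: cx'].
- by move=> s; apply: cvgB; [exact: cy | exact: cy'].
- by move=> s sS; apply: isd_sub; [have [] := H s sS | have [] := H' s sS].
- by move=> s sS; apply: isd_sub; [have [] := H s sS | have [] := H' s sS].
- move=> s sS; rewrite -mulrBr normrM; apply: T.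
  by have [] := inv_lip (x s - W s) (x' s - W s) m0 (mx (y s)) (mx (y' s)).
- move=> s sS; rewrite -mulrBr normrM normrN; apply: T.
  by have [] := inv_lip (x s - W s) (x' s - W s) m0 (mx (y s)) (mx (y' s)).
Qed.

(** The upward flow u' = -2 / (u - W) in the half-plane, that is the Loewner
    equation run backwards in time. *)
Definition up_flow (R : realType) (W : R -> R) (S : R) (x y : R -> R) : Prop :=
  forall s, 0 <= s <= S -> [/\ 0 < y s,
    is_derive s 1 x (- 2 * inv_re (x s - W s) (y s)) &
    is_derive s 1 y (2 * inv_im (x s - W s) (y s))].

Lemma inv_im_ge0 (R : realType) (X Y : R) : 0 <= Y -> 0 <= inv_im X Y.
Proof. by move=> Y0; rewrite divr_ge0// addr_ge0 ?sqr_ge0. Qed.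

Lemma up_flow_exists (R : realType) (W : R -> R) (S x0 y0 : R) :
  continuous W -> 0 < y0 -> 0 <= S ->
  exists x y : R -> R, [/\ x 0 = x0, y 0 = y0 & up_flow W S x y].
Proof.
move=> cW y00 S0.
have [x [y [xE yE H]]] := trunc_exists (-2) x0 y0 cW y00 S0.
exists x, y; split=> // s /andP[s0 sS].
have yy : y 0 <= y s.
  rewrite -lerN2; apply: (@nincr_derive _ (fun s => - y s)
    (fun s => - (- - 2 * inv_im (x s - W s) (Num.max (y s) y0)))) => //.
    move=> r /andP[r0 rs]; apply: isd_opp.
    by have [] := H r _; rewrite ?r0 ?(le_trans rs).
  move=> r _; rewrite oppr_le0 opprK mulr_ge0// inv_im_ge0//.
  by rewrite le_max (ltW y00) orbT.
have [] := H s; rewrite ?s0// yE in yy *.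
rewrite (max_l yy) opprK => dx dy; split => //.
exact: lt_le_trans yy.
Qed.

Lemma up_flow_sub (R : realType) (W : R -> R) (S S' : R) (x y : R -> R) :
  S' <= S -> up_flow W S x y -> up_flow W S' x y.
Proof. by move=> SS H s /andP[s0 sS]; apply: H; rewrite s0 (le_trans sS). Qed.

Lemma up_flow_mono (R : realType) (W : R -> R) (S : R) (x y : R -> R) :
  up_flow W S x y -> forall r s, 0 <= r -> r <= s -> s <= S -> y r <= y s.
Proof.
move=> H r s r0 rs sS; rewrite -lerN2.
have sub t : r <= t <= s -> 0 <= t <= S.
  by move=> /andP[rt ts]; rewrite (le_trans r0 rt) (le_trans ts).
apply: (@nincr_derive _ (fun s => - y s)
    (fun s => - (2 * inv_im (x s - W s) (y s)))) => //.
  by move=> t /sub /H [_ _ dy]; apply: isd_opp.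
by move=> t /sub /H [yt _ _]; rewrite oppr_le0 mulr_ge0// inv_im_ge0// ltW.
Qed.

Lemma up_flow_sqr_le (R : realType) (W : R -> R) (S : R) (x y : R -> R) :
  0 <= S -> up_flow W S x y -> y S ^+ 2 <= y 0 ^+ 2 + 4 * S.
Proof.
move=> S0 H.
suff : y S ^+ 2 - 4 * S <= y 0 ^+ 2 - 4 * 0 by lra.
apply: (@nincr_derive _ (fun s => y s ^+ 2 - 4 * s)
  (fun s => 2 * y s * (2 * inv_im (x s - W s) (y s)) - 4 * 1)) => //.
  move=> t /H [_ _ dy]; apply: isd_sub; exact: isd_sqr.
move=> t /H [yt _ _]; rewrite mulr1 /inv_im.
have N0 := sqrD_gt0 (x t - W t) yt.
have -> : 2 * y t * (2 * (y t / ((x t - W t) ^+ 2 + y t ^+ 2))) =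
   4 * (y t ^+ 2 / ((x t - W t) ^+ 2 + y t ^+ 2)) by ring.
have : y t ^+ 2 / ((x t - W t) ^+ 2 + y t ^+ 2) <= 1.
  by rewrite ler_pdivrMr// mul1r; have := sqr_ge0 (x t - W t); lra.
lra.
Qed.

(** The Loewner flow u' = 2 / (u - U) in the half-plane. *)
Definition down_flow (R : realType) (U : R -> R) (t : R) (x y : R -> R) : Prop :=
  forall s, 0 <= s <= t -> [/\ 0 < y s,
    is_derive s 1 x (2 * inv_re (x s - U s) (y s)) &
    is_derive s 1 y (- 2 * inv_im (x s - U s) (y s))].

Lemma isd_rev (R : realType) (f : R -> R) (t s l : R) :
  is_derive (t - s) 1 f l -> is_derive s 1 (fun r => f (t - r)) (- l).
Proof.
move=> df; have H := isd_comp (isd_sub (isd_cst t s) (isd_id s)) df.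
by rewrite sub0r mulrN1 in H.
Qed.

Lemma down_flow_rev (R : realType) (U : R -> R) (t : R) (x y : R -> R) :
  down_flow U t x y ->
  up_flow (fun s => U (t - s)) t (fun s => x (t - s)) (fun s => y (t - s)).
Proof.
move=> H s /andP[s0 st]; have [|yt dx dy] := H (t - s).
  by rewrite subr_ge0 st gerBl.
split=> //.
- by have := isd_rev dx; rewrite mulNr.
- by have := isd_rev dy; rewrite mulNr opprK.
Qed.

Lemma up_flow_rev (R : realType) (U : R -> R) (t : R) (x y : R -> R) :
  up_flow (fun s => U (t - s)) t x y ->
  down_flow U t (fun s => x (t - s)) (fun s => y (t - s)).
Proof.
move=> H s /andP[s0 st]; have [|yt dx dy] := H (t - s).
  by rewrite subr_ge0 st gerBl.
have E : t - (t - s) = s by ring.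
rewrite E in dx dy; split=> //.
- by have := isd_rev dx; rewrite mulNr opprK.
- by have := isd_rev dy; rewrite mulNr.
Qed.

Lemma down_flow_sub (R : realType) (U : R -> R) (S S' : R) (x y : R -> R) :
  S' <= S -> down_flow U S x y -> down_flow U S' x y.
Proof. by move=> SS H s /andP[s0 sS]; apply: H; rewrite s0 (le_trans sS). Qed.

Lemma down_flow_mono (R : realType) (U : R -> R) (S : R) (x y : R -> R) :
  down_flow U S x y -> forall r s, 0 <= r -> r <= s -> s <= S -> y s <= y r.
Proof.
move=> H r s r0 rs sS; have := up_flow_mono (down_flow_rev H).
move=> /(_ (S - s) (S - r)); have E a : S - (S - a) = a by ring.
by rewrite !E; apply; lra.
Qed.

Lemma down_flow_trunc (R : realType) (U : R -> R) (t m s : R) (x y : R -> R) :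
  down_flow U t x y -> 0 <= s <= t -> m <= y s -> trunc_eq 2 U m x y s.
Proof. by move=> H /H [_ dx dy] mys; rewrite /trunc_eq max_l. Qed.

(** * A priori bounds for the upward flow *)

(** [v] dominates the increments of [W] on [0, S]; the total variation of [W]
    on [0, s] is the function that is used for [v s]. *)
Definition dominates (R : realType) (W : R -> R) (S : R) (v : R -> R) : Prop :=
  forall a b, 0 <= a -> a <= b -> b <= S -> `|W b - W a| <= v b - v a.

Lemma dist_lt_left (R : realType) (p t d : R) : p <= t -> t - d < p -> `|p - t| < d.
Proof. by move=> pt dp; rewrite distrC ger0_norm ?subr_ge0// ltrBlDr -ltrBlDl. Qed.

Lemma dist_lt_right (R : realType) (q t d : R) : t <= q -> q < t + d -> `|q - t| < d.
Proof. by move=> tq qd; rewrite ger0_norm ?subr_ge0// ltrBlDl. Qed.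

(** The error in the definition of the derivative at t, for an interval around
    t. *)
Lemma is_derive_straddle (R : realType) (f : R -> R) (t k : R) :
  is_derive t 1 f k -> forall e, 0 < e -> exists2 d, 0 < d &
  forall p q, p <= t -> t <= q -> t - d < p -> q < t + d ->
    `|f q - f p - (q - p) * k| <= e * (q - p).
Proof.
move=> df e e0; have [d d0 H] := is_derive_eps df e0.
exists d => // p q pt tq dp qd.
have := H _ (dist_lt_left pt dp); have := H _ (dist_lt_right tq qd).
have -> : `|p - t| = t - p by rewrite distrC ger0_norm ?subr_ge0.
have -> : `|q - t| = q - t by rewrite ger0_norm ?subr_ge0.
clear; rewrite !ler_norml => /andP[A1 A2] /andP[A3 A4].
by apply/andP; split; lra.
Qed.

(** The flow pulls the real part X of u - W towards 0 at speed 2|X|/|u - W|^2,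
    so only the variation of W can make |X| grow.  Comparing with a
    differentiable psi avoids integrating the speed. *)
Lemma abs_re_growth (R : realType) (W : R -> R) (S : R) (x y v : R -> R)
    (psi psi' : R -> R) (a b : R) :
  continuous W -> up_flow W S x y -> dominates W S v ->
  0 <= a -> a <= b -> b <= S ->
  (forall s, a <= s <= b -> is_derive s 1 psi (psi' s)) ->
  (forall s, a <= s <= b -> - 2 * inv_re `|x s - W s| (y s) <= psi' s) ->
  `|x b - W b| - `|x a - W a| <= v b - v a + (psi b - psi a).
Proof.
move=> cW H vW a0 ab bS dpsi lpsi.
apply/ler_addgt0Pr => e0 e00.
have [e epos ee0] : exists2 e, 0 < e & e * (b - a) <= e0.
  exists (e0 / (b - a + 1)); first by rewrite divr_gt0// ltr_wpDl// subr_ge0.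
  rewrite mulrAC ler_pdivrMr ?ltr_wpDl ?subr_ge0// ler_pM2l// lerDl//.
pose P p q : Prop := `|x q - W q| - `|x p - W p| <=
  v q - v p + (psi q - psi p) + e * (q - p).
suff : P a b by rewrite /P => /le_trans; apply; rewrite lerD2l.
apply: interval_induction => //.
  by move=> p q r _ _; rewrite /P; clear; lra.
move=> t /andP[at_ tb]; have e20 : 0 < e / 2 by rewrite divr_gt0.
have [|yt dx _] := H t; first by rewrite (le_trans a0)//= (le_trans tb).
have [d2 d20 H2] := is_derive_straddle dx e20.
have dpt : is_derive t 1 psi (psi' t) by apply: dpsi; rewrite at_.
have [d1 d10 H1] := is_derive_straddle dpt e20.
have lt_ : - 2 * inv_re `|x t - W t| (y t) <= psi' t by apply: lpsi; rewrite at_.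
have cX : {for t, continuous (fun s => x s - W s)}.
  by apply: cvgB; [exact: is_derive_continuous dx | exact: cW].
have vWpq p q : p <= t -> t <= q -> a <= p -> q <= b -> `|W q - W p| <= v q - v p.
  move=> pt tq ap qb; apply: vW; [exact: le_trans ap | exact: le_trans tq |].
  exact: le_trans bS.
have [X0|X0] := eqVneq (x t - W t) 0.
  exists (Num.min d1 d2); first by rewrite !lt_min d10 d20.
  move=> p q /andP[ap pt] /andP[tq qb] dp qd.
  have {dp} [dp1 dp2] : t - d1 < p /\ t - d2 < p.
    by apply/andP; rewrite !ltrBlDr -!ltrBlDl -lt_min ltrBlDl -ltrBlDr.
  have {qd} [qd1 qd2] : q < t + d1 /\ q < t + d2.
    by apply/andP; rewrite -!ltrBlDl -lt_min ltrBlDl.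
  have A1 := H2 _ _ pt tq dp2 qd2; have A2 := H1 _ _ pt tq dp1 qd1.
  have A3 := vWpq _ _ pt tq ap qb.
  have psi0 : 0 <= psi' t.
    by apply: le_trans lt_; rewrite X0 normr0 /inv_re mul0r mulr0.
  have B : `|x q - W q| - `|x p - W p| <=
      `|x q - x p - (q - p) * (- 2 * inv_re (x t - W t) (y t))| + `|W q - W p|.
    apply: (le_trans (lerB_dist _ _)).
    have -> : x q - W q - (x p - W p) =
        x q - x p - (q - p) * (- 2 * inv_re (x t - W t) (y t)) - (W q - W p).
      by rewrite X0 /inv_re; ring.
    exact: ler_normB.
  have : (q - p) * psi' t >= 0.
    by rewrite mulr_ge0// subr_ge0 (le_trans pt).
  rewrite /P; move: A2 B A1 A3; rewrite ler_norml => /andP[A2 _].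
  by move: A2; clear; lra.
(* Near t the sign of X is constant. *)
have [sg [sgE sgX [d3 d30 H3]]] : exists sg : R, [/\ sg * (- 2 * inv_re (x t - W t) (y t)) =
      - 2 * inv_re `|x t - W t| (y t), `|sg| = 1 & exists2 d3, 0 < d3 & forall u,
      `|u - t| < d3 -> `|x u - W u| = sg * (x u - W u)].
  have /orP[Xlt|Xgt] : (x t - W t < 0) || (0 < x t - W t) by rewrite -neq_lt.
    have X0N : 0 < - (x t - W t) by rewrite oppr_gt0.
    have [d3 d30 H3] := continuous_eps cX X0N.
    exists (-1); split; first by rewrite (ltr0_norm Xlt) /inv_re sqrrN; ring.
      by rewrite normrN1.
    exists d3 => // u /H3; rewrite ltr_distl => /andP[_ Xu].
    by rewrite mulN1r ltr0_norm//; move: Xu; clear; lra.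
  have [d3 d30 H3] := continuous_eps cX Xgt.
  exists 1; split; first by rewrite (gtr0_norm Xgt) mul1r.
    by rewrite normr1.
  exists d3 => // u /H3; rewrite ltr_distl => /andP[Xu _].
  by rewrite mul1r gtr0_norm//; move: Xu; clear; lra.
exists (Num.min d1 (Num.min d2 d3)); first by rewrite !lt_min d10 d20 d30.
move=> p q /andP[ap pt] /andP[tq qb] dp qd.
have {dp} [dp1 dp2 dp3] : [/\ t - d1 < p, t - d2 < p & t - d3 < p].
  by apply/and3P; rewrite !ltrBlDr -!ltrBlDl -!lt_min ltrBlDl -ltrBlDr.
have {qd} [qd1 qd2 qd3] : [/\ q < t + d1, q < t + d2 & q < t + d3].
  by apply/and3P; rewrite -!ltrBlDl -!lt_min ltrBlDl.
have A1 := H2 _ _ pt tq dp2 qd2; have A2 := H1 _ _ pt tq dp1 qd1.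
have A3 := vWpq _ _ pt tq ap qb.
rewrite /P (H3 _ (dist_lt_left pt dp3)) (H3 _ (dist_lt_right tq qd3)).
have A4 : (q - p) * (sg * (- 2 * inv_re (x t - W t) (y t))) <= (q - p) * psi' t.
  by rewrite ler_wpM2l// ?sgE// subr_ge0 (le_trans pt).
have sgle z : sg * z <= `|z|.
  by apply: (le_trans (ler_norm _)); rewrite normrM sgX mul1r.
have A5 := sgle (x q - x p - (q - p) * (- 2 * inv_re (x t - W t) (y t))).
have A6 : - (sg * (W q - W p)) <= `|W q - W p|.
  by rewrite -mulrN (le_trans (sgle _))// normrN.
move: A2; rewrite ler_norml => /andP[A2 _].
by move: A1 A2 A3 A4 A5 A6; clear; lra.
Qed.

Lemma abs_re_le (R : realType) (W : R -> R) (S : R) (x y v : R -> R) (s : R) :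
  continuous W -> up_flow W S x y -> dominates W S v -> v 0 = 0 ->
  0 <= s <= S -> `|x s - W s| <= `|x 0 - W 0| + v s.
Proof.
move=> cW H vW v0 /andP[s0 sS].
have := @abs_re_growth R W S x y v (fun=> 0) (fun=> 0) 0 s cW H vW (lexx _) s0 sS.
rewrite v0 !subr0 addr0 lerBlDl; apply.
move=> r /andP[r0 rs]; rewrite mulNr oppr_le0 mulr_ge0//.
by rewrite divr_ge0// addr_ge0// sqr_ge0.
Qed.

(** Constants for the height bound: [c1] lies strictly between [c] and 2. *)
Lemma height_constants (R : realType) (c : R) : 0 < c < 2 ->
  exists c1 l eta : R, [/\ c < c1, 0 < l < 1, 0 < eta,
    eta + eta = (c1 - c) * l & c1 ^+ 2 < 4 * (1 - l)].
Proof.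
move=> /andP[c0 c2].
exists ((c + 2) / 2), ((1 - ((c + 2) / 2) ^+ 2 / 4) / 2).
exists (((c + 2) / 2 - c) * ((1 - ((c + 2) / 2) ^+ 2 / 4) / 2) / 2).
have c1s : ((c + 2) / 2) ^+ 2 < 4 by nra.
have c1p := sqr_ge0 ((c + 2) / 2).
set q := ((c + 2) / 2) ^+ 2 in c1s c1p *.
split; first by clear -c2; lra.
- by apply/andP; split; move: c1s c1p; clear; lra.
- by rewrite divr_gt0// mulr_gt0//; [move: c2|move: c1s]; clear; lra.
- by field.
- by move: c1s; clear; lra.
Qed.

(** The role of the constant 2.  If the variation of W up to time s is at most
    c sqrt s, with c < 2, then a point started below the driving point rises to
    height at least eta sqrt s: were it to stay low, |X| + Y <= c1 sqrt s with
    c1 < 2 would make the total pull towards 0 exceed (4/c1) sqrt s > c sqrt s,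
    more than the variation can compensate.  The error allowed is a small
    multiple of sqrt s, which makes the bound stable under perturbations. *)
Lemma height_lower (R : realType) (c : R) : 0 < c < 2 ->
  exists2 eta, 0 < eta & forall (W : R -> R) (s d : R) (x y v : R -> R),
  continuous W -> 0 < s -> up_flow W s x y -> dominates W s v -> v 0 = 0 ->
  (forall r, 0 <= r <= s -> `|x 0 - W 0| + v r <= c * Num.sqrt r + d) ->
  d <= eta * Num.sqrt s -> eta * Num.sqrt s <= y s.
Proof.
move=> c02; have [c1 [l [eta [cc1 /andP[l0 l1] eta0 etaE c1l]]]] := height_constants c02.
have c10 : 0 < c1 by case/andP: c02 => c0 _; exact: lt_trans cc1.
exists eta => // W s d x y v cW s0 H vW v0 vc de.
rewrite leNgt; apply/negP => ylow.
have S0 : 0 < Num.sqrt s by rewrite sqrtr_gt0.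
(* On [l^2 s, s] the error terms are at most (c1 - c) sqrt r. *)
pose t := l ^+ 2 * s.
have t0 : 0 < t by rewrite mulr_gt0// exprn_gt0.
have ts : t <= s by rewrite /t ler_piMl ?(ltW s0)// exprn_ile1 ?(ltW l0) ?(ltW l1).
have st : Num.sqrt t = l * Num.sqrt s.
  by rewrite sqrtrM ?sqr_ge0// sqrtr_sqr gtr0_norm.
have sub r : t <= r <= s -> 0 <= r <= s.
  by move=> /andP[tr ->]; rewrite (le_trans (ltW t0)).
have Xv r : 0 <= r <= s -> `|x r - W r| <= `|x 0 - W 0| + v r.
  by move=> rs; apply: (abs_re_le cW H vW v0).
have Lr r : t <= r <= s -> `|x r - W r| + y r <= c1 * Num.sqrt r.
  move=> /[dup] /sub rs /andP[tr rs'].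
  have y1 : y r <= y s by apply: (up_flow_mono H) => //; case/andP: rs.
  have lr : l * Num.sqrt s <= Num.sqrt r by rewrite -st ler_sqrt// (le_trans (ltW t0)).
  have h1 := Xv _ rs; have h2 := vc _ rs.
  have h3 : (c1 - c) * (l * Num.sqrt s) <= (c1 - c) * Num.sqrt r.
    by rewrite ler_wpM2l// subr_ge0 ltW.
  have h4 : eta * Num.sqrt s + eta * Num.sqrt s = (c1 - c) * (l * Num.sqrt s).
    by rewrite -mulrDl etaE mulrA.
  by move: y1 ylow h1 h2 h3 h4 de; clear; lra.
pose psi' r := 2 * inv_im (x r - W r) (y r) - 4 / c1 * (2 * Num.sqrt r)^-1.
have G : `|x s - W s| - `|x t - W t| <= v s - v t +
    ((y s - 4 / c1 * Num.sqrt s) - (y t - 4 / c1 * Num.sqrt t)).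
  apply: (@abs_re_growth _ W s x y v (fun r => y r - 4 / c1 * Num.sqrt r) psi') => //.
  - exact: ltW.
  - move=> r /[dup] tr /sub /H [_ _ dy]; apply: isd_sub => //.
    apply: isd_scale; apply: is_derive1_sqrt.
    by case/andP: tr => tr _; exact: lt_le_trans tr.
  - move=> r rs; have yr : 0 < y r by have [] := H _ (sub _ rs).
    have r0 : 0 < r by case/andP: rs => tr _; exact: lt_le_trans tr.
    have sr0 : 0 < Num.sqrt r by rewrite sqrtr_gt0.
    have XN : (x r - W r) ^+ 2 = `|x r - W r| ^+ 2 by rewrite real_normK ?num_real.
    have := Lr _ rs; rewrite /psi' /inv_re /inv_im XN; have := normr_ge0 (x r - W r).
    move: yr; move: `|x r - W r| (y r) => X Y yr X0 XY.
    have N0 : 0 < X ^+ 2 + Y ^+ 2 by exact: sqrD_gt0.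
    have Q0 : 0 < X + Y by rewrite ltr_wpDl.
    have c1r : 0 < c1 * Num.sqrt r by rewrite mulr_gt0.
    have h1 : (c1 * Num.sqrt r)^-1 <= (X + Y)^-1 by rewrite lef_pV2.
    have h2 : (X + Y)^-1 <= (X + Y) / (X ^+ 2 + Y ^+ 2).
      rewrite ler_pdivlMr// mulrC ler_pdivrMr//; move: X0 yr; clear; nra.
    have -> : 4 / c1 * (2 * Num.sqrt r)^-1 = 2 * (c1 * Num.sqrt r)^-1.
      by field; rewrite !gt_eqF.
    by rewrite mulrDl in h2; move: h1 h2; clear; lra.
have h1 : `|x t - W t| <= `|x 0 - W 0| + v t by apply: Xv; rewrite ts ltW.
have h2 : `|x 0 - W 0| + v s <= c * Num.sqrt s + d.
  by apply: vc; rewrite lexx ltW.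
have yt : 0 < y t by have [] := H t; rewrite ?ts ?ltW.
have h3 := normr_ge0 (x s - W s).
rewrite st in G.
have h4 : 4 / c1 * (1 - l) * Num.sqrt s < (c + eta + eta) * Num.sqrt s.
  by move: G h1 h2 h3 yt ylow de; clear; lra.
have h5 : c + eta + eta <= c1.
  rewrite -addrA etaE; have : (c1 - c) * l <= (c1 - c) * 1.
    by rewrite ler_wpM2l ?subr_ge0 ?(ltW cc1) ?(ltW l1).
  by clear; lra.
have h6 : 4 / c1 * (1 - l) < c1.
  by move: h4; rewrite ltr_pM2r// => /lt_le_trans; apply.
by move: h6 c1l; rewrite mulrAC ltr_pdivrMr// -expr2; clear; lra.
Qed.

(** * Contraction of the upward flow *)

(** The squared distance of two points of the half-plane relative to their
    heights; it is a function of the hyperbolic distance. *)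
Definition gap (R : realType) (x1 y1 x2 y2 : R -> R) (s : R) : R :=
  ((x1 s - x2 s) ^+ 2 + (y1 s - y2 s) ^+ 2) / (y1 s * y2 s).

(** The algebra behind the contraction: [a_i - i b_i] stands for 1 / Z_i, so
    that 2 Re(1/(Z_1 Z_2)) - 1/|Z_1|^2 - 1/|Z_2|^2 is the opposite of
    |1/Z_1 - conj(1/Z_2)|^2 >= (b_1 + b_2)^2. *)
Lemma gap_algebra (R : realType) (X1 Y1 X2 Y2 b e1 e2 m d E k : R) :
  e1 = X1 - X2 + b -> e2 = Y1 - Y2 -> 0 < m -> m <= Y1 -> m <= Y2 -> `|b| <= d ->
  `|e1| + `|e2| <= E ->
  k <= 2 * (inv_im X1 Y1 + inv_im X2 Y2) ^+ 2 ->
  (2 * e1 * (- 2 * inv_re X1 Y1 - - 2 * inv_re X2 Y2) +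
     2 * e2 * (2 * inv_im X1 Y1 - 2 * inv_im X2 Y2)) / (Y1 * Y2) -
  (e1 ^+ 2 + e2 ^+ 2) / (Y1 * Y2) *
    (2 / (X1 ^+ 2 + Y1 ^+ 2) + 2 / (X2 ^+ 2 + Y2 ^+ 2))
  <= - k * ((e1 ^+ 2 + e2 ^+ 2) / (Y1 * Y2)) + 4 * d * E / m ^+ 4.
Proof.
move=> e1E e2E m0 mY1 mY2 bd bE kB.
have Y10 : 0 < Y1 by exact: lt_le_trans mY1.
have Y20 : 0 < Y2 by exact: lt_le_trans mY2.
have N10 := sqrD_gt0 X1 Y10; have N20 := sqrD_gt0 X2 Y20.
set a1 := inv_re X1 Y1; set a2 := inv_re X2 Y2.
set b1 := inv_im X1 Y1 in kB *; set b2 := inv_im X2 Y2 in kB *.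
pose P := a1 * a2 - b1 * b2; pose Q := a1 * b2 + a2 * b1.
have E1 : a1 - a2 = - (P * (e1 - b) + Q * e2).
  by rewrite /P /Q /a1 /a2 /b1 /b2 /inv_re /inv_im e1E e2E; field; rewrite !gt_eqF.
have E2 : b1 - b2 = - Q * (e1 - b) + P * e2.
  by rewrite /P /Q /a1 /a2 /b1 /b2 /inv_re /inv_im e1E e2E; field; rewrite !gt_eqF.
have E3 : (X1 ^+ 2 + Y1 ^+ 2)^-1 = a1 ^+ 2 + b1 ^+ 2.
  by rewrite /a1 /b1 /inv_re /inv_im; field; rewrite gt_eqF.
have E4 : (X2 ^+ 2 + Y2 ^+ 2)^-1 = a2 ^+ 2 + b2 ^+ 2.
  by rewrite /a2 /b2 /inv_re /inv_im; field; rewrite gt_eqF.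
have mm : 0 < m ^+ 2 by rewrite exprn_gt0.
have PQ2 : P ^+ 2 + Q ^+ 2 = (a1 ^+ 2 + b1 ^+ 2) * (a2 ^+ 2 + b2 ^+ 2).
  by rewrite /P /Q; ring.
have Nm X Y : m <= Y -> (X ^+ 2 + Y ^+ 2)^-1 <= (m ^+ 2)^-1.
  move=> mY; have Y0 : 0 < Y by exact: lt_le_trans mY.
  rewrite lef_pV2 ?posrE ?sqrD_gt0// (@le_trans _ _ (Y ^+ 2))//.
    by rewrite ler_sqr// nnegrE ltW.
  by rewrite lerDr sqr_ge0.
have N1m : a1 ^+ 2 + b1 ^+ 2 <= (m ^+ 2)^-1 by rewrite -E3; exact: Nm.
have N2m : a2 ^+ 2 + b2 ^+ 2 <= (m ^+ 2)^-1 by rewrite -E4; exact: Nm.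
have PQm : P ^+ 2 + Q ^+ 2 <= ((m ^+ 2)^-1) ^+ 2.
  rewrite PQ2 (expr2 (_^-1)); apply: ler_pM => //;
  by rewrite addr_ge0 ?sqr_ge0.
have absm u : u ^+ 2 <= ((m ^+ 2)^-1) ^+ 2 -> `|u| <= (m ^+ 2)^-1.
  move=> hu; rewrite -ler_sqr ?nnegrE ?invr_ge0 ?(ltW mm)//.
  by rewrite real_normK ?num_real.
have Pm : `|P| <= (m ^+ 2)^-1.
  by apply: absm; apply: le_trans PQm; rewrite lerDl sqr_ge0.
have Qm : `|Q| <= (m ^+ 2)^-1.
  by apply: absm; apply: le_trans PQm; rewrite lerDr sqr_ge0.
have H1 : - 4 * b * (P * e1 - Q * e2) <= 4 * d * ((m ^+ 2)^-1 * E).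
  have h : `|P * e1 - Q * e2| <= (m ^+ 2)^-1 * E.
    apply: (le_trans (ler_normB _ _)); rewrite !normrM.
    apply: (@le_trans _ _ ((m ^+ 2)^-1 * (`|e1| + `|e2|))).
      by rewrite mulrDr; apply: lerD; exact: ler_wpM2r.
    by rewrite ler_wpM2l// invr_ge0 ltW.
  apply: (le_trans (ler_norm _)); rewrite !normrM normrN (@ger0_norm _ 4)//.
  by rewrite -!mulrA ler_wpM2l//; apply: ler_pM.
have YY0 : 0 < Y1 * Y2 by exact: mulr_gt0.
have YYm : (Y1 * Y2)^-1 <= (m ^+ 2)^-1.
  by rewrite lef_pV2// expr2; apply: ler_pM => //; exact: ltW.
have E0 : 0 <= E by apply: le_trans bE; rewrite addr_ge0.
have d0 : 0 <= d by apply: le_trans bd.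
have H2 : 4 * d * ((m ^+ 2)^-1 * E) / (Y1 * Y2) <= 4 * d * E / m ^+ 4.
  have -> : 4 * d * E / m ^+ 4 = 4 * d * ((m ^+ 2)^-1 * E) * (m ^+ 2)^-1.
    by field; rewrite gt_eqF.
  by rewrite ler_wpM2l// !mulr_ge0// invr_ge0 ltW.
have G0 : 0 <= (e1 ^+ 2 + e2 ^+ 2) / (Y1 * Y2).
  by rewrite divr_ge0 ?addr_ge0 ?sqr_ge0// ltW.
rewrite -mulrBr -mulrBr !E3 !E4.
have -> : 2 * e1 * (- 2 * (a1 - a2)) + 2 * e2 * (2 * (b1 - b2)) =
    4 * P * (e1 ^+ 2 + e2 ^+ 2) + - 4 * b * (P * e1 - Q * e2).
  by rewrite E1 E2; ring.
rewrite mulrDl.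
have -> : 4 * P * (e1 ^+ 2 + e2 ^+ 2) / (Y1 * Y2) =
   4 * P * ((e1 ^+ 2 + e2 ^+ 2) / (Y1 * Y2)) by ring.
have H3 : - 4 * b * (P * e1 - Q * e2) / (Y1 * Y2) <= 4 * d * E / m ^+ 4.
  by apply: le_trans H2; rewrite ler_pM2r// invr_gt0.
move: H3 G0; set G := _ / (Y1 * Y2); set D := 4 * d * E / _; set F := _ / _.
move=> H3 G0.
suff : (4 * P - 2 * (a1 ^+ 2 + b1 ^+ 2) - 2 * (a2 ^+ 2 + b2 ^+ 2) + k) * F <= 0.
  by move: H3; clear; lra.
rewrite mulr_le0_ge0// /P.
by have := sqr_ge0 (a1 - a2); move: kB; clear; nra.
Qed.

Lemma gap_derive (R : realType) (W1 W2 : R -> R) (S s : R)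
    (x1 y1 x2 y2 : R -> R) :
  up_flow W1 S x1 y1 -> up_flow W2 S x2 y2 -> 0 <= s <= S ->
  let X1 := x1 s - W1 s in let X2 := x2 s - W2 s in
  let e1 := x1 s - x2 s in let e2 := y1 s - y2 s in
  is_derive s 1 (gap x1 y1 x2 y2)
  ((2 * e1 * (- 2 * inv_re X1 (y1 s) - - 2 * inv_re X2 (y2 s)) +
     2 * e2 * (2 * inv_im X1 (y1 s) - 2 * inv_im X2 (y2 s))) / (y1 s * y2 s) -
  (e1 ^+ 2 + e2 ^+ 2) / (y1 s * y2 s) *
    (2 / (X1 ^+ 2 + y1 s ^+ 2) + 2 / (X2 ^+ 2 + y2 s ^+ 2))).
Proof.
move=> H1 H2 sS X1 X2 e1 e2.
have [y1s dx1 dy1] := H1 _ sS; have [y2s dx2 dy2] := H2 _ sS.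
have yn : y1 s * y2 s != 0 by rewrite gt_eqF// mulr_gt0.
have H := isd_mul (isd_add (isd_sqr (isd_sub dx1 dx2)) (isd_sqr (isd_sub dy1 dy2)))
  (@isd_inv _ (fun s => y1 s * y2 s) s _ yn (isd_mul dy1 dy2)).
apply: (isd_eq H).
rewrite -/X1 -/X2 -/e1 -/e2.
have N1 := sqrD_gt0 X1 y1s; have N2 := sqrD_gt0 X2 y2s.
move: dx1 dx2 dy1 dy2 H yn N1 N2 y1s y2s => _ _ _ _ _ _.
rewrite /inv_im; move: (inv_re X1 _) (inv_re X2 _) => l1 l2.
move: X1 X2 e1 e2 (y1 s) (y2 s) => X1 X2 e1 e2 Y1 Y2 N1 N2 Y10 Y20.
by field; rewrite !gt_eqF.
Qed.

(** The differential inequality Q' <= - (K/s) Q + D forces a logarithmic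
    decay of Q. *)
Lemma log_decay (R : realType) (Q Q' : R -> R) (r e S K D : R) :
  0 < r -> r <= e -> e <= S -> 0 <= K -> 0 <= D ->
  (forall s, r <= s <= S -> is_derive s 1 Q (Q' s)) ->
  (forall s, r <= s <= S -> 0 <= Q s) ->
  (forall s, r <= s <= e -> Q' s <= - (K / s) * Q s + D) ->
  (forall s, e <= s <= S -> Q' s <= D) ->
  Q S <= Q r / (1 + K * (ln e - ln r)) + D * S.
Proof.
move=> r0 re eS K0 D0 dQ Q0 Qre QeS.
have e0 : 0 < e by exact: lt_le_trans re.
set L := 1 + K * (ln e - ln r).
have lnr s : r <= s -> 0 <= ln s - ln r.
  move=> rs; rewrite subr_ge0 ler_ln ?posrE//; exact: lt_le_trans rs.
have L1 : 1 <= L by rewrite /L lerDl mulr_ge0// lnr.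
have L0 : 0 < L by exact: lt_le_trans L1.
pose G s := Q s * (1 + K * (ln s - ln r)) - D * L * s.
have HG : G e <= G r.
  pose G' s := Q s * (0 + K * (s^-1 - 0)) + Q' s * (1 + K * (ln s - ln r)) - D * L * 1.
  apply: (@nincr_derive _ G G') => //.
    move=> s /andP[rs se]; have s0 : 0 < s by exact: lt_le_trans rs.
    have dQs : is_derive s 1 Q (Q' s) by apply: dQ; rewrite rs (le_trans se).
    have dl : is_derive s 1 (@ln R) s^-1 by exact: is_derive1_ln.
    exact: (isd_sub (isd_mul dQs (isd_add (isd_cst 1 s)
      (isd_scale K (isd_sub dl (isd_cst (ln r) s))))) (isd_scale (D * L) (isd_id s))).
  move=> s /andP[rs se]; have s0 : 0 < s by exact: lt_le_trans rs.
  have l0 := lnr _ rs.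
  have lL : 1 + K * (ln s - ln r) <= L.
    by rewrite /L lerD2l ler_wpM2l// lerD2r ler_ln ?posrE.
  have Qs : 0 <= Q s by apply: Q0; rewrite rs (le_trans se).
  have Q's : Q' s <= - (K / s) * Q s + D by apply: Qre; rewrite rs.
  rewrite /G' add0r subr0 mulr1.
  have k0 : 0 <= K / s by rewrite divr_ge0// ltW.
  have p1 : 1 <= 1 + K * (ln s - ln r) by rewrite lerDl mulr_ge0.
  move: (1 + K * (ln s - ln r)) lL p1 => p pL p1.
  have h1 : Q' s * p <= (- (K / s) * Q s + D) * p.
    by rewrite ler_wpM2r// (le_trans _ p1).
  have h2 : D * p <= D * L by rewrite ler_wpM2l.
  have h3 : (K / s) * Q s * 1 <= (K / s) * Q s * p by rewrite ler_wpM2l// mulr_ge0.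
  by move: h1 h2 h3; clear; lra.
have He : Q e <= Q r / L + D * e.
  move: HG; rewrite /G subrr mulr0 addr0 mulr1 -/L => HG.
  rewrite -(ler_pM2r L0) mulrDl mulfVK ?gt_eqF//.
  have : 0 <= D * L * r by rewrite !mulr_ge0// ltW.
  by move: HG; clear; lra.
have HS : Q S - D * S <= Q e - D * e.
  apply: (@nincr_derive _ (fun s => Q s - D * s) (fun s => Q' s - D * 1)) => //.
    move=> s /andP[es sS]; have dQs : is_derive s 1 Q (Q' s).
      by apply: dQ; rewrite sS (le_trans re).
    exact: (isd_sub dQs (isd_scale D (isd_id s))).
  by move=> s sS; rewrite mulr1 subr_le0 QeS.
by move: He HS; clear; lra.
Qed.

(** A driver on [0, S] whose variation is at most c sqrt s, up to an error d,
    on the initial interval [0, e], and at most M in total. *)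
Definition controlled (R : realType) (c e M d S : R) (W v : R -> R) : Prop :=
  [/\ continuous W, dominates W S v, v 0 = 0,
      (forall s, 0 <= s <= e -> v s <= c * Num.sqrt s + d) & v S <= M].

Lemma dominates_sub (R : realType) (W v : R -> R) (S S' : R) :
  S' <= S -> dominates W S v -> dominates W S' v.
Proof.
by move=> SS H a b a0 ab bS; apply: H => //; exact: le_trans SS.
Qed.

Lemma dominates_mono (R : realType) (W v : R -> R) (S a b : R) :
  dominates W S v -> 0 <= a -> a <= b -> b <= S -> v a <= v b.
Proof.
by move=> H a0 ab bS; rewrite -subr_ge0 (le_trans _ (H _ _ a0 ab bS)).
Qed.

Lemma flow_height (R : realType) (c : R) : 0 < c < 2 ->
  exists2 eta, 0 < eta & forall (e M d S s : R) (W v x y : R -> R),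
  controlled c e M d S W v -> up_flow W S x y -> `|x 0 - W 0| <= d ->
  0 < s -> s <= e -> s <= S -> 2 * d <= eta * Num.sqrt s ->
  eta * Num.sqrt s <= y s.
Proof.
move=> c02; have [eta eta0 H] := height_lower c02.
exists eta => // e M d S s W v x y [cW vW v0 vc _] fl X0 s0 se sS ds.
apply: (H W s (2 * d) x y v) => //.
- exact: up_flow_sub fl.
- exact: dominates_sub vW.
move=> r /andP[r0 rs].
have := vc r; rewrite r0 (le_trans rs se) => /(_ isT).
by move: X0; clear; lra.
Qed.

Lemma flow_re_bound (R : realType) (c e M d S s : R) (W v x y : R -> R) :
  controlled c e M d S W v -> up_flow W S x y -> `|x 0 - W 0| <= d ->
  0 <= s -> s <= S -> `|x s - W s| <= d + v s.
Proof.
move=> [cW vW v0 _ _] fl X0 s0 sS.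
have := abs_re_le cW fl vW v0 (s := s); rewrite s0 sS => /(_ isT).
by move=> /le_trans; apply; rewrite lerD2r.
Qed.

(** Two flows with nearby controlled drivers, both started close to their
    driving points, end close to each other.  On [r, e] both heights are of
    order sqrt s, so the gap decays like 1 / log(e / r); the error made by
    the difference of the drivers is of order d for fixed r. *)
Lemma flow_contraction (R : realType) (c e M q : R) : 0 < c < 2 ->
  0 < e -> e <= M -> 0 < q -> exists2 d, 0 < d &
  forall (S : R) (W1 W2 v1 v2 x1 y1 x2 y2 : R -> R), e <= S -> S <= M ->
  controlled c e M d S W1 v1 -> controlled c e M d S W2 v2 ->
  up_flow W1 S x1 y1 -> up_flow W2 S x2 y2 ->
  `|x1 0 - W1 0| <= d -> `|x2 0 - W2 0| <= d -> y1 0 <= d -> y2 0 <= d ->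
  (forall s, 0 <= s <= S -> `|W1 s - W2 s| <= d) ->
  (x1 S - x2 S) ^+ 2 + (y1 S - y2 S) ^+ 2 <= q.
Proof.
move=> c02 e0 eM q0; have [eta eta0 Heta] := flow_height c02.
have M0 : 0 < M by exact: lt_le_trans eM.
(* K is the rate of decay; r is taken so small that K log(e / r) = L brings
   the main term down to q/2; then d is small with respect to r. *)
pose K := 2 * (eta / 7) ^+ 2.
have K0 : 0 < K by rewrite mulr_gt0// exprn_gt0// divr_gt0.
pose H := 1 + 4 * M; pose E := 10 * M + 5.
have H0 : 0 < H by rewrite /H; move: M0; clear; lra.
have E0 : 0 < E by rewrite /E; move: M0; clear; lra.
pose L := 108 * H / (eta ^+ 2 * q).
have L0 : 0 < L by rewrite divr_gt0 ?mulr_gt0// exprn_gt0.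
pose r := e * expR (- (L / K)).
have r0 : 0 < r by rewrite mulr_gt0// expR_gt0.
have re : r <= e.
  by rewrite ler_piMr ?(ltW e0)// -expR0 ler_expR oppr_le0 divr_ge0 ?ltW.
have lnr : 1 + K * (ln e - ln r) = 1 + L.
  rewrite /r lnM ?posrE ?expR_gt0// expRK; congr (1 + _).
  by field; rewrite gt_eqF.
have sr0 : 0 < Num.sqrt r by rewrite sqrtr_gt0.
pose m := eta * Num.sqrt r.
have m0 : 0 < m by rewrite mulr_gt0.
pose d4 := q * m ^+ 4 / (8 * E * M * H).
have d40 : 0 < d4 by rewrite divr_gt0 ?mulr_gt0// exprn_gt0.
pose d := Num.min 1 (Num.min (Num.sqrt r / 2) (Num.min (m / 2) d4)).
have d0 : 0 < d by rewrite !lt_min ltr01 d40 !divr_gt0.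
have [d1 dr dm dd4] : [/\ d <= 1, d <= Num.sqrt r / 2, d <= m / 2 & d <= d4].
  by rewrite /d !ge_min !lexx !orbT.
exists d => // S W1 W2 v1 v2 x1 y1 x2 y2 eS SM C1 C2 F1 F2 X1 X2 Y1 Y2 dW.
have rS : r <= S by exact: le_trans eS.
have low W v x y s : controlled c e M d S W v -> up_flow W S x y ->
    `|x 0 - W 0| <= d -> r <= s -> s <= e -> eta * Num.sqrt s <= y s.
  move=> C F X rs se; apply: (Heta _ _ _ _ _ _ _ _ _ C F X) => //.
  - exact: lt_le_trans rs.
  - exact: le_trans eS.
  - apply: (@le_trans _ _ m); first by move: dm; clear; lra.
    by rewrite /m ler_pM2l// ler_wsqrtr.
have lowm W v x y s : controlled c e M d S W v -> up_flow W S x y ->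
    `|x 0 - W 0| <= d -> r <= s -> s <= S -> m <= y s.
  move=> C F X rs sS; apply: (@le_trans _ _ (y r)).
    exact: (low W v x).
  by apply: (up_flow_mono F) => //; exact: ltW.
have high W x y s : up_flow W S x y -> y 0 <= d -> 0 <= s -> s <= S ->
    y s ^+ 2 <= d ^+ 2 + 4 * s.
  move=> F y0d s0 sS; apply: (le_trans (up_flow_sqr_le s0 (up_flow_sub sS F))).
  rewrite lerD2r ler_sqr ?nnegrE ?(ltW d0)//.
  by have [|yy _ _] := F 0; [rewrite lexx (le_trans s0) | exact: ltW].
have highS W x y s : up_flow W S x y -> y 0 <= d -> 0 <= s -> s <= S ->
    y s ^+ 2 <= H.
  move=> F y0d s0 sS; apply: (le_trans (high _ _ _ _ F y0d s0 sS)).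
  have : d ^+ 2 <= 1 by rewrite expr_le1// ltW.
  by rewrite /H; move: sS SM; clear; lra.
have xM W v x y s : controlled c e M d S W v -> up_flow W S x y ->
    `|x 0 - W 0| <= d -> 0 <= s -> s <= S -> `|x s - W s| <= 1 + M.
  move=> C F X s0 sS; apply: (le_trans (flow_re_bound C F X s0 sS)).
  case: C => _ vW _ _ vM; apply: lerD => //; apply: le_trans vM.
  exact: dominates_mono vW _ _ _.
have xs W v x y s : controlled c e M d S W v -> up_flow W S x y ->
    `|x 0 - W 0| <= d -> r <= s -> s <= e -> `|x s - W s| <= 3 * Num.sqrt s.
  move=> C F X rs se; have s0 : 0 <= s by rewrite (le_trans (ltW r0)).
  apply: (le_trans (flow_re_bound C F X s0 (le_trans se eS))).
  case: C => _ _ _ /(_ s); rewrite s0 se => /(_ isT) vs _.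
  have h1 : Num.sqrt r <= Num.sqrt s by rewrite ler_wsqrtr.
  have h2 : c * Num.sqrt s <= 2 * Num.sqrt s.
    by rewrite ler_wpM2r ?sqrtr_ge0//; case/andP: c02 => _ /ltW.
  by move: h1 h2 vs dr; clear; lra.
have ys W x y s : up_flow W S x y -> y 0 <= d -> r <= s -> s <= e ->
    y s ^+ 2 <= 5 * s.
  move=> F y0d rs se; have s0 : 0 <= s by rewrite (le_trans (ltW r0)).
  apply: (le_trans (high _ _ _ _ F y0d s0 (le_trans se eS))).
  have : d ^+ 2 <= r.
    rewrite -(sqr_sqrtr (ltW r0)) ler_sqr ?nnegrE ?sqrtr_ge0 ?(ltW d0)//.
    by move: dr sr0; clear; lra.
  by move: rs; clear; lra.
(* The rate of decay on [r, e]. *)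
have rate W v x y s : controlled c e M d S W v -> up_flow W S x y ->
    `|x 0 - W 0| <= d -> y 0 <= d -> r <= s -> s <= e ->
    eta / 14 / Num.sqrt s <= inv_im (x s - W s) (y s).
  move=> C F X Y rs se; have s0 : 0 < s by exact: lt_le_trans rs.
  have h1 := low _ _ _ _ _ C F X rs se.
  have h2 := xs _ _ _ _ _ C F X rs se.
  have h3 := ys _ _ _ _ F Y rs se.
  have [|ys0 _ _] := F s; first by rewrite (ltW s0) (le_trans se).
  have N0 := sqrD_gt0 (x s - W s) ys0.
  have ss0 : 0 < Num.sqrt s by rewrite sqrtr_gt0.
  have h4 : (x s - W s) ^+ 2 + y s ^+ 2 <= 14 * s.
    have : (x s - W s) ^+ 2 <= 9 * s.
      rewrite -(real_normK (num_real (x s - W s))).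
      have -> : 9 * s = (3 * Num.sqrt s) ^+ 2.
        by rewrite exprMn sqr_sqrtr ?(ltW s0)//; ring.
      by rewrite ler_sqr ?nnegrE// mulr_ge0// ltW.
    by move: h3; clear; lra.
  rewrite /inv_im ler_pdivlMr//.
  apply: (@le_trans _ _ (eta / 14 / Num.sqrt s * (14 * s))).
    by rewrite ler_wpM2l// !divr_ge0// ltW.
  apply: le_trans h1.
  rewrite -[X in _ * (14 * X)](sqr_sqrtr (ltW s0)).
  rewrite le_eqVlt; apply/orP; left; apply/eqP; field.
  by rewrite gt_eqF.
have sub s : r <= s -> s <= S -> 0 <= s <= S.
  by move=> rs ->; rewrite (le_trans (ltW r0)).
have EB s : r <= s -> s <= S -> `|x1 s - x2 s| + `|y1 s - y2 s| <= E.
  move=> rs sS; have /andP[s0 _] := sub _ rs sS.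
  have h1 := xM _ _ _ _ _ C1 F1 X1 s0 sS; have h2 := xM _ _ _ _ _ C2 F2 X2 s0 sS.
  have h3 := dW s; rewrite s0 sS in h3; have {}h3 := h3 isT.
  have h4 : `|x1 s - x2 s| <= `|x1 s - W1 s| + `|x2 s - W2 s| + `|W1 s - W2 s|.
    have -> : x1 s - x2 s = (x1 s - W1 s) - (x2 s - W2 s) + (W1 s - W2 s) by ring.
    apply: (le_trans (ler_normD _ _)); rewrite lerD2r; exact: ler_normB.
  have yle W x y : up_flow W S x y -> y 0 <= d -> `|y s| <= H.
    move=> F Y; have h := highS _ _ _ _ F Y s0 sS.
    have H1 : 1 <= H by rewrite /H; move: M0; clear; lra.
    rewrite -ler_sqr ?nnegrE ?(ltW H0)// real_normK ?num_real//.
    by apply: le_trans h _; rewrite expr2 ler_peMl// ltW.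
  have h5 := yle _ _ _ F1 Y1; have h6 := yle _ _ _ F2 Y2.
  have h7 := ler_normB (y1 s) (y2 s).
  by move: h1 h2 h3 h4 h5 h6 h7 d1; rewrite /E /H; clear; lra.
pose D := 4 * d * E / m ^+ 4.
have D0 : 0 <= D by rewrite divr_ge0 ?mulr_ge0 ?exprn_ge0// ltW.
have growth s k : r <= s -> s <= S ->
    k <= 2 * (inv_im (x1 s - W1 s) (y1 s) + inv_im (x2 s - W2 s) (y2 s)) ^+ 2 ->
  (2 * (x1 s - x2 s) * (- 2 * inv_re (x1 s - W1 s) (y1 s) - - 2 * inv_re (x2 s - W2 s) (y2 s)) +
     2 * (y1 s - y2 s) * (2 * inv_im (x1 s - W1 s) (y1 s) - 2 * inv_im (x2 s - W2 s) (y2 s)))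
  / (y1 s * y2 s) -
  ((x1 s - x2 s) ^+ 2 + (y1 s - y2 s) ^+ 2) / (y1 s * y2 s) *
    (2 / ((x1 s - W1 s) ^+ 2 + y1 s ^+ 2) + 2 / ((x2 s - W2 s) ^+ 2 + y2 s ^+ 2))
  <= - k * gap x1 y1 x2 y2 s + D.
  move=> rs sS kB; apply: (gap_algebra (b := W1 s - W2 s)) => //.
  - by ring.
  - exact: (lowm _ _ _ _ _ C1 F1 X1).
  - exact: (lowm _ _ _ _ _ C2 F2 X2).
  - exact/dW/sub.
  - exact: EB.
have gap0 s : r <= s -> s <= S -> 0 <= gap x1 y1 x2 y2 s.
  move=> rs sS; have [a1 _ _] := F1 _ (sub _ rs sS); have [a2 _ _] := F2 _ (sub _ rs sS).
  by rewrite /gap divr_ge0 ?addr_ge0 ?sqr_ge0// mulr_ge0// ltW.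
have decay := log_decay r0 re eS (ltW K0) D0
  (fun s rsS => gap_derive F1 F2 (sub s (proj1 (andP rsS)) (proj2 (andP rsS)))).
have {decay} gS : gap x1 y1 x2 y2 S <= gap x1 y1 x2 y2 r / (1 + L) + D * S.
  rewrite -lnr; apply: decay.
  - by move=> s /andP[rs sS]; exact: gap0.
  - move=> s /andP[rs se]; apply: growth => //; first exact: le_trans eS.
    have s0 : 0 < s by exact: lt_le_trans rs.
    have h1 := rate _ _ _ _ _ C1 F1 X1 Y1 rs se.
    have h2 := rate _ _ _ _ _ C2 F2 X2 Y2 rs se.
    have -> : K / s = 2 * (eta / 14 / Num.sqrt s + eta / 14 / Num.sqrt s) ^+ 2.
      rewrite -[X in _ / X](sqr_sqrtr (ltW s0)) /K; field.
      by rewrite gt_eqF// sqrtr_gt0.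
    have h0 : 0 <= eta / 14 / Num.sqrt s by rewrite !divr_ge0 ?sqrtr_ge0// ltW.
    rewrite ler_wpM2l// ler_sqr ?nnegrE ?addr_ge0 ?(le_trans h0)//.
    exact: lerD.
  - move=> s /andP[es sS].
    have := growth s 0 (le_trans re es) sS.
    by rewrite oppr0 mul0r add0r; apply; rewrite mulr_ge0// sqr_ge0.
have gr : gap x1 y1 x2 y2 r <= 54 / eta ^+ 2.
  have a1 := low _ _ _ _ _ C1 F1 X1 (lexx _) re.
  have a2 := low _ _ _ _ _ C2 F2 X2 (lexx _) re.
  have b1 := xs _ _ _ _ _ C1 F1 X1 (lexx _) re.
  have b2 := xs _ _ _ _ _ C2 F2 X2 (lexx _) re.
  have c1 := ys _ _ _ _ F1 Y1 (lexx _) re.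
  have c2 := ys _ _ _ _ F2 Y2 (lexx _) re.
  have h3 := dW _ (sub _ (lexx _) rS).
  have h4 : `|x1 r - x2 r| <= 7 * Num.sqrt r.
    have -> : x1 r - x2 r = (x1 r - W1 r) - (x2 r - W2 r) + (W1 r - W2 r) by ring.
    have := ler_normD (x1 r - W1 r - (x2 r - W2 r)) (W1 r - W2 r).
    have := ler_normB (x1 r - W1 r) (x2 r - W2 r).
    by move: b1 b2 h3 dr sr0; clear; lra.
  have h5 : (x1 r - x2 r) ^+ 2 <= 49 * r.
    rewrite -(real_normK (num_real (x1 r - x2 r))).
    have -> : 49 * r = (7 * Num.sqrt r) ^+ 2.
      by rewrite exprMn sqr_sqrtr ?(ltW r0)//; ring.
    by rewrite ler_sqr ?nnegrE// mulr_ge0// ltW.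
  have y1r : 0 < y1 r by apply: lt_le_trans a1; exact: m0.
  have y2r : 0 < y2 r by apply: lt_le_trans a2; exact: m0.
  have h6 : (y1 r - y2 r) ^+ 2 <= 5 * r.
    by move: c1 c2 y1r y2r; clear; case: (lerP (y1 r) (y2 r)); nra.
  have h7 : eta ^+ 2 * r <= y1 r * y2 r.
    have -> : eta ^+ 2 * r = (eta * Num.sqrt r) * (eta * Num.sqrt r).
      by rewrite -[X in _ * X = _](sqr_sqrtr (ltW r0)); ring.
    by apply: ler_pM => //; exact: ltW.
  have er0 : 0 < eta ^+ 2 * r by rewrite mulr_gt0// exprn_gt0.
  rewrite /gap ler_pdivrMr ?mulr_gt0//.
  apply: (@le_trans _ _ (54 / eta ^+ 2 * (eta ^+ 2 * r))).
    have -> : 54 / eta ^+ 2 * (eta ^+ 2 * r) = 54 * r by field; rewrite gt_eqF.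
    by move: h5 h6; clear; lra.
  by rewrite ler_wpM2l// divr_ge0// exprn_ge0// ltW.
have S0 : 0 <= S by exact: le_trans (ltW r0) rS.
have SS : 0 <= S <= S by rewrite S0 lexx.
have [y1S _ _] := F1 _ SS; have [y2S _ _] := F2 _ SS.
have YY : y1 S * y2 S <= H.
  have h1 := highS _ _ _ _ F1 Y1 S0 (lexx _); have h2 := highS _ _ _ _ F2 Y2 S0 (lexx _).
  by have := sqr_ge0 (y1 S - y2 S); move: h1 h2; clear; nra.
have -> : (x1 S - x2 S) ^+ 2 + (y1 S - y2 S) ^+ 2 = gap x1 y1 x2 y2 S * (y1 S * y2 S).
  by rewrite /gap mulfVK// gt_eqF// mulr_gt0.
apply: (@le_trans _ _ (gap x1 y1 x2 y2 S * H)).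
  by rewrite ler_wpM2l// gap0.
apply: (@le_trans _ _ ((54 / eta ^+ 2 / L + D * M) * H)).
  rewrite ler_pM2r//; apply: (le_trans gS); apply: lerD; last by rewrite ler_wpM2l.
  apply: ler_pM => //; first exact: gap0.
    by rewrite invr_ge0 addr_ge0// ltW.
  by rewrite lef_pV2 ?posrE ?addr_gt0// lerDr.
have -> : (54 / eta ^+ 2 / L + D * M) * H = q / 2 + d * (4 * E * M * H / m ^+ 4).
  rewrite /L /D; field.
  by rewrite !gt_eqF// exprn_gt0.
have : d * (4 * E * M * H / m ^+ 4) <= d4 * (4 * E * M * H / m ^+ 4).
  by rewrite ler_wpM2r// divr_ge0 ?mulr_ge0 ?exprn_ge0// ltW.
have -> : d4 * (4 * E * M * H / m ^+ 4) = q / 2.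
  by rewrite /d4; field; rewrite !gt_eqF.
by clear; lra.
Qed.

(** * Drivers of bounded variation *)

Lemma within_eps (R : realType) (f : R -> R) (a b x : R) :
  {within `[a, b], continuous f} -> a <= x <= b ->
  forall e, 0 < e -> exists2 d, 0 < d &
  forall u, a <= u <= b -> `|u - x| < d -> `|f u - f x| < e.
Proof.
move=> /subspace_continuousP cf xab e e0.
have /cf /cvgrPdist_lt /(_ e e0) : [set` `[a, b]] x by rewrite /= in_itv.
move=> /nbhs_ballP[d /= d0 H]; exists d => // u uab ux.
by rewrite distrC; apply: H => //=; rewrite ?in_itv// /ball/= distrC.
Qed.

Lemma continuous_within_clamp (R : realType) (f : R -> R) (S : R) : 0 <= S ->
  {within `[0, S], continuous f} -> continuous (fun s => f (clamp S s)).
Proof.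
move=> S0 cf s; apply: eps_continuous => e e0.
have [d d0 H] := within_eps cf (clamp_itv s S0) e0.
exists d => // u us; apply: H; first exact: clamp_itv.
by apply: le_lt_trans us; exact: clamp_lip.
Qed.

Lemma unif_continuous (R : realType) (f : R -> R) (T e : R) : 0 <= T -> 0 < e ->
  continuous f -> exists2 d, 0 < d &
  forall r s, 0 <= r <= T -> `|r - s| < d -> `|f r - f s| < e.
Proof.
move=> T0 e0 cf.
pose P p q : Prop := exists2 d, 0 < d &
  forall r s, p <= r <= q -> `|r - s| < d -> `|f r - f s| < e.
apply: (@interval_induction _ P 0 T) => //.
  move=> p q r _ _ [d1 d10 H1] [d2 d20 H2].
  exists (Num.min d1 d2); first by rewrite lt_min d10.
  move=> u s /andP[pu ur]; rewrite lt_min => /andP[us1 us2].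
  have [uq|qu] := leP u q; first by apply: H1; rewrite ?pu.
  by apply: H2; rewrite ?ur ?(ltW qu).
move=> t _; have e20 : 0 < e / 2 by rewrite divr_gt0.
have [d d0 H] := continuous_eps (cf t) e20.
exists (d / 2); first by rewrite divr_gt0.
move=> p q /andP[_ pt] /andP[tq _] dp dq.
exists (d / 2); first by rewrite divr_gt0.
move=> r s /andP[pr rq] rs.
have rt : `|r - t| < d / 2.
  by rewrite ltr_distl; apply/andP; split; move: dp dq pr rq; clear; lra.
have st : `|s - t| < d.
  have -> : s - t = (r - t) - (r - s) by ring.
  have := ler_normB (r - t) (r - s); move: rt rs; clear; lra.
have h1 := H _ st; have h2 : `|f r - f t| < e / 2.
  by apply: H; move: rt d0; clear; lra.
have -> : f r - f s = (f r - f t) - (f s - f t) by ring.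
by have := ler_normB (f r - f t) (f s - f t); move: h1 h2; clear; lra.
Qed.

(** The continuous functions of bounded variation on [0, T] vanishing at 0. *)
Definition BV0 (R : realType) (T : R) (U : R -> R) : Prop :=
  C0 T U /\ (total_variation 0 T U < +oo)%E.

(** The total variation of [U] on [0, r]. *)
Definition tvar (R : realType) (U : R -> R) (r : R) : R :=
  fine (total_variation 0 r U).

Section tvar.
Context {R : realType} {T : R}.
Implicit Types (U : R -> R) (a b r s : R).

Lemma tv_fin U a b : BV0 T U -> 0 <= a -> a <= b -> b <= T ->
  total_variation a b U \is a fin_num.
Proof.
move=> [_ tvU] a0 ab bT; rewrite ge0_fin_numE ?total_variation_ge0//.
apply: le_lt_trans tvU; rewrite (total_variationD _ (le_trans a0 ab) bT).
rewrite (total_variationD _ a0 ab) -addeA addeCA leeDl// adde_ge0//.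
  exact: total_variation_ge0.
exact: total_variation_ge0.
Qed.

Lemma tvarB U a b : BV0 T U -> 0 <= a -> a <= b -> b <= T ->
  tvar U b - tvar U a = fine (total_variation a b U).
Proof.
move=> BU a0 ab bT; rewrite /tvar (total_variationD _ a0 ab) fineD.
- by rewrite addrC addKr.
- by apply: tv_fin => //; exact: le_trans bT.
- exact: tv_fin.
Qed.

Lemma tvar_ge U a b : BV0 T U -> 0 <= a -> a <= b -> b <= T ->
  `|U b - U a| <= tvar U b - tvar U a.
Proof.
move=> BU a0 ab bT; rewrite tvarB// -lee_fin fineK ?tv_fin//.
exact: total_variation_ge.
Qed.

Lemma tvar_dist U a b : BV0 T U -> 0 <= a <= T -> 0 <= b <= T ->
  `|U b - U a| <= `|tvar U b - tvar U a|.
Proof.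
move=> BU /andP[a0 aT] /andP[b0 bT]; have [ab|/ltW ba] := leP a b.
  by apply: (le_trans (tvar_ge BU a0 ab bT)); exact: ler_norm.
rewrite distrC (distrC (tvar U b)).
by apply: (le_trans (tvar_ge BU b0 ba aT)); exact: ler_norm.
Qed.

Lemma tvar0 U : tvar U 0 = 0.
Proof. by rewrite /tvar total_variationxx. Qed.

Lemma tvar_perturb U U' (rho : R) a b : BV0 T U -> BV0 T U' ->
  (total_variation 0 T (U' \- U)%R <= rho%:E)%E -> 0 <= a -> a <= b -> b <= T ->
  tvar U' b - tvar U' a <= tvar U b - tvar U a + rho.
Proof.
move=> BU BU' UU a0 ab bT; rewrite !tvarB//.
rewrite -lee_fin EFinD !fineK ?tv_fin//.
have -> : U' = U \+ (U' \- U) by apply/funext => x /=; rewrite addrC subrK.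
apply: (le_trans (total_variation_le _ _ ab)); rewrite leeD2l//.
apply: le_trans UU; rewrite (total_variationD _ (le_trans a0 ab) bT).
rewrite (total_variationD _ a0 ab) -addeA addeCA leeDl// adde_ge0//.
  exact: total_variation_ge0.
exact: total_variation_ge0.
Qed.

Lemma sup_perturb U U' (rho : R) r : BV0 T U -> BV0 T U' ->
  (total_variation 0 T (U' \- U)%R <= rho%:E)%E -> 0 <= r <= T ->
  `|U' r - U r| <= rho.
Proof.
move=> [[_ U0] _] [[_ U'0] _] UU /andP[r0 rT]; rewrite -lee_fin.
apply: le_trans UU; rewrite (total_variationD _ r0 rT).
have := total_variation_ge (U' \- U) r0; rewrite /= U0 U'0 !subr0 => h.
by apply: (le_trans h); rewrite leeDl// total_variation_ge0.
Qed.

Lemma tvar_unif U (e : R) : 0 < T -> BV0 T U -> 0 < e -> exists2 d, 0 < d &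
  forall r s, 0 <= r <= T -> 0 <= s <= T -> `|r - s| < d ->
  `|tvar U r - tvar U s| < e.
Proof.
move=> T0 BU e0; have [[cU _] tvU] := BU.
have cV : {within `[0, T], continuous (tvar U)}.
  apply: total_variation_continuous => //.
  by apply/(bounded_variationP _ (ltW T0)); apply: tv_fin => //; exact: ltW.
have [d d0 H] := unif_continuous (ltW T0) e0 (continuous_within_clamp (ltW T0) cV).
by exists d => // r s rT sT rs; have := H r s rT rs; rewrite !clamp_id.
Qed.

(** The driver seen backwards from time [t], extended by constants so as to be
    continuous on the whole line. *)
Definition rev_driver U (t s : R) : R := U (clamp T (t - s)).

Lemma continuous_rev_driver U (t : R) : 0 < T -> BV0 T U ->
  continuous (rev_driver U t).
Proof.
move=> T0 [[cU _] _] s; have cUc := continuous_within_clamp (ltW T0) cU.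
apply: eps_continuous => e e0; have [d d0 H] := continuous_eps (cUc (t - s)) e0.
exists d => // u us; apply: H.
by rewrite opprB addrC addrA subrK distrC.
Qed.

Lemma rev_driver_dominates U (t S : R) : BV0 T U -> t <= T -> S <= t ->
  dominates (rev_driver U t) S (fun s => tvar U t - tvar U (t - s)).
Proof.
move=> BU tT St a b a0 ab bS; rewrite /rev_driver.
have ? : 0 <= t - b by rewrite subr_ge0 (le_trans bS).
have ? : t - b <= t - a by rewrite lerD2l lerN2.
have ? : t - a <= T by rewrite (le_trans _ tT)// gerBl.
rewrite !clamp_id; last 2 first.
- by apply/andP; split=> //; exact: le_trans (_ : t - b <= _).
- by apply/andP; split=> //; exact: le_trans (_ : t - a <= _).
have -> : tvar U t - tvar U (t - b) - (tvar U t - tvar U (t - a)) =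
  tvar U (t - a) - tvar U (t - b) by ring.
by rewrite distrC; exact: tvar_ge.
Qed.

End tvar.

(** The condition on the local variation at [t], in explicit form. *)
Lemma BV_LR_local (R : realType) (T : R) (U : R -> R) (t : R) : 0 < T ->
  BV_LR T U -> 0 < t <= T ->
  exists c e, [/\ 0 < c < 2, 0 < e <= t & forall s, 0 <= s <= e ->
     tvar U t - tvar U (t - s) <= c * Num.sqrt s].
Proof.
move=> T0 [cU tvU LR] /andP[t0 tT].
have BU : BV0 T U by [].
have := LR t; rewrite t0 tT => /(_ isT); rewrite limf_esupE => /ereal_inf_lt.
move=> [_ [V FV <-]]; set sg := ereal_sup _ => sg2.
have [c c02 sgc] : exists2 c : R, 0 < c < 2 & (sg <= c%:E)%E.
  move: sg2; case: sg => [x||] //.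
    rewrite lte_fin => x2; exists (Num.max x 1); last by rewrite lee_fin le_max lexx.
    by rewrite lt_max ltr01 orbT gt_max x2 ltr1n.
  by move=> _; exists 1; rewrite ?leNye// ltr01 ltr1n.
move: FV => /nbhs_ballP[d /= d0 H].
exists c, (Num.min (d / 2) t); split => //.
  by rewrite lt_min t0 divr_gt0//= ge_min lexx orbT.
move=> s /andP[s0]; rewrite le_min => /andP[sd st].
have [->|sn0] := eqVneq s 0; first by rewrite subr0 subrr sqrtr0 mulr0.
have {sn0}s0 : 0 < s by rewrite lt_neqAle eq_sym sn0.
have ss0 : 0 < Num.sqrt s by rewrite sqrtr_gt0.
have Vs : V s.
  apply: H => //; rewrite /ball/= sub0r normrN gtr0_norm//.
  by rewrite (le_lt_trans sd)// ltr_pdivrMr// ltr_pMr// ltr1n.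
have : (total_variation (t - s) t U * ((Num.sqrt s)^-1)%:E <= c%:E)%E.
  by apply: le_trans sgc; apply: ereal_sup_ubound; exists s.
have ts : 0 <= t - s by rewrite subr_ge0.
have tst : t - s <= t by rewrite gerBl ltW.
rewrite (tvarB BU ts tst tT) -[X in (X * _)%E](fineK (tv_fin BU ts tst tT)).
by rewrite -EFinM lee_fin ler_pdivrMr.
Qed.

(** * Stability of the endpoints of the upward flow *)

(** Driver [U'], time [t'] and starting point [U' t' + (a + ih)], all within
    [rho] of [U], [t] and [U t]. *)
Definition near_data (R : realType) (T : R) (U : R -> R) (t rho : R)
    (U' : R -> R) (t' a h : R) : Prop :=
  [/\ BV0 T U', (total_variation 0 T (U' \- U)%R <= rho%:E)%E, 0 < t' <= T,
      `|t' - t| <= rho & `|a| <= rho /\ 0 < h <= rho].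

Lemma near_data_le (R : realType) (T : R) (U : R -> R) (t rho rho' : R)
    (U' : R -> R) (t' a h : R) : rho <= rho' ->
  near_data T U t rho U' t' a h -> near_data T U t rho' U' t' a h.
Proof.
move=> rr [BU' UU' t'T tt' [ar /andP[h0 hr]]]; split => //.
- by apply: (le_trans UU'); rewrite lee_fin.
- exact: le_trans rr.
- by rewrite h0 (le_trans ar rr) (le_trans hr rr).
Qed.

(** The upward flow from [U t + (a + ih)] at time [t], down to time 0. *)
Definition flow_from (R : realType) (T : R) (U : R -> R) (t a h : R)
    (x y : R -> R) : Prop :=
  [/\ up_flow (rev_driver (T := T) U t) t x y, x 0 = U t + a & y 0 = h].

Lemma rev_driver0 (R : realType) (T : R) (U : R -> R) (t : R) :
  0 <= t <= T -> rev_driver (T := T) U t 0 = U t.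
Proof. by move=> tT; rewrite /rev_driver subr0 clamp_id. Qed.

Lemma flow_from_exists (R : realType) (T : R) (U : R -> R) (t a h : R) :
  0 < T -> BV0 T U -> 0 <= t -> 0 < h -> exists x y, flow_from T U t a h x y.
Proof.
move=> T0 BU t0 h0.
have [x [y [x0 y0 F]]] :=
  up_flow_exists (U t + a) (@continuous_rev_driver _ _ U t T0 BU) h0 t0.
by exists x, y; split.
Qed.

Lemma near_controlled (R : realType) (T : R) (U : R -> R) (t c e d : R) :
  0 < T -> BV_LR T U ->
  0 < t <= T ->  0 < e <= t -> 0 < d ->
  (forall s, 0 <= s <= e -> tvar U t - tvar U (t - s) <= c * Num.sqrt s) ->
  exists2 rho, 0 < rho <= t / 2 & forall U' t' a h S,
    near_data T U t rho U' t' a h -> 0 <= S <= t' ->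
    [/\ controlled c (Num.min e (t / 2)) (tvar U T + 1 + T) d S
         (rev_driver (T := T) U' t') (fun s => tvar U' t' - tvar U' (t' - s)),
      `|a| <= d, h <= d & forall s, 0 <= s <= t' -> s <= T ->
        `|rev_driver (T := T) U' t' s - rev_driver (T := T) U t' s| <= d].
Proof.
move=> T0 LU t0T /andP[e0 et] d0 Hc.
have BU : BV0 T U by case: LU.
have /andP[t0 tT] := t0T.
have d40 : 0 < d / 4 by rewrite divr_gt0.
have [d1 d10 H1] := tvar_unif T0 BU d40.
exists (Num.min (t / 2) (Num.min 1 (Num.min (d / 4) (d1 / 2)))).
  by rewrite !lt_min ltr01 d40 !divr_gt0//= ge_min lexx.
move=> U' t' a h S; set rho := Num.min _ _.
have [r1 r2 r3 r4] : [/\ rho <= t / 2, rho <= 1, rho <= d / 4 & rho <= d1 / 2].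
  by rewrite /rho !ge_min !lexx !orbT.
move=> [BU' UU' /andP[t'0 t'T] tt' [ar /andP[h0 hr]]] /andP[S0 St'].
have rd : rho <= d by move: r3 d0; clear; lra.
have tt2 : t / 2 <= t'.
  by move: tt'; rewrite ler_norml => /andP[+ _]; move: r1; clear; lra.
have tt1 : `|t' - t| < d1.
  by apply: (le_lt_trans tt'); move: r4 d10; clear; lra.
split.
- split.
  + exact: continuous_rev_driver.
  + exact: rev_driver_dominates.
  + by rewrite subr0 subrr.
  + move=> s /andP[s0]; rewrite le_min => /andP[se st2].
    have ts0 : 0 <= t - s by rewrite subr_ge0 (le_trans se).
    have t's0 : 0 <= t' - s by rewrite subr_ge0 (le_trans st2).
    have tsT : t - s <= T by rewrite (le_trans _ tT)// gerBl.
    have t'sT : t' - s <= T by rewrite (le_trans _ t'T)// gerBl.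
    have t'st : t' - s <= t' by rewrite gerBl.
    have h1 := tvar_perturb BU BU' UU' t's0 t'st t'T.
    have h2 : `|tvar U t' - tvar U t| < d / 4.
      by apply: H1 => //; rewrite ?(ltW t'0) ?(ltW t0).
    have h3 : `|tvar U (t' - s) - tvar U (t - s)| < d / 4.
      apply: H1; rewrite ?ts0 ?t's0//.
      by have -> : t' - s - (t - s) = t' - t by ring.
    have h4 := Hc s; rewrite s0 se in h4; have {}h4 := h4 isT.
    move: h2 h3; rewrite !ltr_norml => /andP[_ h2] /andP[h3 _].
    by move: h1 h2 h3 h4 r3 d0; clear; lra.
  + have tS0 : 0 <= t' - S by rewrite subr_ge0.
    have tSt : t' - S <= t' by rewrite gerBl.
    have h1 := tvar_perturb BU BU' UU' tS0 tSt t'T.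
    have h2 := le_trans (normr_ge0 _) (tvar_ge BU (ltW t'0) t'T (lexx T)).
    have h3 := le_trans (normr_ge0 _)
      (tvar_ge BU (lexx 0) tS0 (le_trans tSt t'T)).
    rewrite tvar0 in h3.
    by move: h1 h2 h3 r2 T0; clear; lra.
- exact: le_trans rd.
- exact: le_trans rd.
- move=> s /andP[s0 st'] sT; rewrite /rev_driver.
  apply: (@le_trans _ _ rho) => //; apply: (sup_perturb BU BU' UU').
  exact: clamp_itv (ltW T0).
Qed.

(** A lower bound on the height at all times after [r], uniform over the nearby
    data. *)
Lemma near_height (R : realType) (T : R) (U : R -> R) (t r : R) :
  0 < T -> BV_LR T U ->
  0 < t <= T ->  0 < r -> exists2 m, 0 < m &
  exists2 rho, 0 < rho & forall U' t' a h x y s,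
  near_data T U t rho U' t' a h -> flow_from T U' t' a h x y ->
  r <= s -> s <= t' -> m <= y s.
Proof.
move=> T0 LU t0T r0; have /andP[t0 tT] := t0T.
have [c [e [c02 /andP[e0 et] Hc]]] := BV_LR_local T0 LU t0T.
have [eta eta0 Heta] := flow_height c02.
pose s0 := Num.min r (Num.min e (t / 2)).
have s00 : 0 < s0 by rewrite !lt_min r0 e0 divr_gt0.
have [s0r s0e] : s0 <= r /\ s0 <= Num.min e (t / 2).
  by apply/andP; rewrite -le_min.
have m0 : 0 < eta * Num.sqrt s0 by rewrite mulr_gt0// sqrtr_gt0.
exists (eta * Num.sqrt s0) => //.
have d0 : 0 < eta * Num.sqrt s0 / 2 by rewrite divr_gt0.
have eet : 0 < e <= t by rewrite e0.
have [rho /andP[rho0 _] H] := near_controlled T0 LU t0T eet d0 Hc.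
exists rho => // U' t' a h x y s N [F x0 y0] rs st'.
have [_ _ /andP[t'0 t'T] _ _] := N.
have [|C ad hd _] := H U' t' a h t' N; first by rewrite lexx ltW.
have s0t' : s0 <= t' by rewrite (le_trans s0r)// (le_trans rs).
apply: (@le_trans _ _ (y s0)); last first.
  by apply: (up_flow_mono F); [exact: ltW|exact: le_trans rs|].
apply: (Heta _ _ _ _ _ _ _ _ _ C F) => //.
- by rewrite x0 rev_driver0 ?(ltW t'0)//= addrAC subrr add0r.
- by rewrite mulrCA mulfV// mulr1.
Qed.

Lemma near_endpoint_le (R : realType) (T : R) (U : R -> R) (t q : R) :
  0 < T -> BV_LR T U ->
  0 < t <= T ->  0 < q -> exists2 rho, 0 < rho &
  forall U1 t1 a1 h1 x1 y1 U2 t2 a2 h2 x2 y2, t1 <= t2 ->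
  near_data T U t rho U1 t1 a1 h1 -> flow_from T U1 t1 a1 h1 x1 y1 ->
  near_data T U t rho U2 t2 a2 h2 -> flow_from T U2 t2 a2 h2 x2 y2 ->
  (x1 t1 - x2 t2) ^+ 2 + (y1 t1 - y2 t2) ^+ 2 <= q.
Proof.
move=> T0 LU t0T q0.
have BU : BV0 T U by case: LU.
have /andP[t0 tT] := t0T.
have [c [e [c02 /andP[e0 et] Hc]]] := BV_LR_local T0 LU t0T.
pose e1 := Num.min e (t / 2).
have t20 : 0 < t / 2 by rewrite divr_gt0.
have e10 : 0 < e1 by rewrite lt_min e0.
pose M := tvar U T + 1 + T.
have V0 : 0 <= tvar U T.
  have := le_trans (normr_ge0 _) (tvar_ge BU (lexx 0) (ltW T0) (lexx T)).
  by rewrite tvar0 subr0.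
have e1t : e1 <= t by rewrite /e1 ge_min et.
have TM : T <= M by rewrite /M; move: V0; clear; lra.
have e1M : e1 <= M by rewrite (le_trans e1t)// (le_trans tT).
have q40 : 0 < q / 4 by rewrite divr_gt0.
have [d d0 Hd] := flow_contraction c02 e10 e1M q40.
have eet : 0 < e <= t by rewrite e0.
have d20 : 0 < d / 4 by rewrite divr_gt0.
have [rho1 /andP[rho10 rho1t] H1] := near_controlled T0 LU t0T eet d0 Hc.
have [rho2 /andP[rho20 _] H2] := near_controlled T0 LU t0T eet d20 Hc.
have [m m0 [rho3 rho30 H3]] := near_height T0 LU t0T e10.
have [d1 d10 H4] := tvar_unif T0 BU d20.
pose p := Num.min 1 (q / 8).
have p0 : 0 < p by rewrite lt_min ltr01 divr_gt0.
pose rho4 := p * m / 4.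
have rho40 : 0 < rho4 by rewrite divr_gt0// mulr_gt0.
exists (Num.min rho1 (Num.min rho2 (Num.min rho3 (Num.min rho4 (d1 / 4))))).
  by rewrite !lt_min rho10 rho20 rho30 rho40 divr_gt0.
set rho := Num.min _ _.
have [r1 r2 r3 r4 r5] : [/\ rho <= rho1, rho <= rho2, rho <= rho3, rho <= rho4 &
    rho <= d1 / 4].
  by rewrite /rho !ge_min !lexx !orbT.
move=> U1 t1 a1 h1 x1 y1 U2 t2 a2 h2 x2 y2 t12 N1 F1 N2 F2.
have [_ _ /andP[t10 t1T] tt1 _] := N1; have [_ _ /andP[t2_0 t2T] tt2 _] := N2.
have et1 : e1 <= t1.
  apply: (@le_trans _ _ (t / 2)); first by rewrite /e1 ge_min lexx orbT.
  have {}tt1 := le_trans tt1 (le_trans r1 rho1t).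
  by move: tt1; rewrite ler_norml => /andP[+ _]; clear; lra.
have [|C1 A1 B1 _] := H1 U1 t1 a1 h1 t1 (near_data_le r1 N1).
  by rewrite lexx ltW.
have [|C2 A2 B2 _] := H1 U2 t2 a2 h2 t1 (near_data_le r1 N2).
  by rewrite (ltW t10).
have [|_ _ _ D1] := H2 U1 t1 a1 h1 t1 (near_data_le r2 N1).
  by rewrite lexx ltW.
have [|_ _ _ D2] := H2 U2 t2 a2 h2 t1 (near_data_le r2 N2).
  by rewrite (ltW t10).
have [G1 X1 Y1] := F1; have [G2 X2 Y2] := F2.
have dt : t2 - t1 <= 2 * rho.
  move: tt1 tt2; rewrite !ler_norml => /andP[+ _] /andP[_].
  by clear; lra.
have main : (x1 t1 - x2 t1) ^+ 2 + (y1 t1 - y2 t1) ^+ 2 <= q / 4.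
  apply: (Hd t1 _ _ _ _ _ _ _ _ et1 (le_trans t1T TM) C1 C2 G1 (up_flow_sub t12 G2)).
  - by rewrite X1 rev_driver0 ?(ltW t10)//= addrAC subrr add0r.
  - by rewrite X2 rev_driver0 ?(ltW t2_0)//= addrAC subrr add0r.
  - by rewrite Y1.
  - by rewrite Y2.
  - move=> s /andP[s0 st1].
    have k1 := D1 s; rewrite s0 st1 in k1.
    have {}k1 := k1 isT (le_trans st1 t1T).
    have k2 := D2 s; rewrite s0 (le_trans st1 t12) in k2.
    have {}k2 := k2 isT (le_trans st1 t1T).
    have i1 : 0 <= t1 - s <= T.
      by rewrite subr_ge0 st1/= (le_trans _ t1T)// gerBl.
    have i2 : 0 <= t2 - s <= T.
      by rewrite subr_ge0 (le_trans st1)//= (le_trans _ t2T)// gerBl.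
    have k3 : `|rev_driver (T := T) U t1 s - rev_driver (T := T) U t2 s| < d / 4.
      rewrite /rev_driver !clamp_id//.
      apply: (le_lt_trans (tvar_dist BU i2 i1)); apply: H4 => //.
      have -> : t1 - s - (t2 - s) = - (t2 - t1) by ring.
      rewrite normrN ger0_norm ?subr_ge0//.
      by move: dt r5 d10; clear; lra.
    move: k1 k2 k3.
    move: (rev_driver U1 t1 s) (rev_driver U t1 s) => w1 w2.
    move: (rev_driver U2 t2 s) (rev_driver U t2 s) => w3 w4.
    move=> k1 k2 k3.
    have -> : w1 - w3 = (w1 - w2) + (w2 - w4) - (w3 - w4) by ring.
    have k4 := ler_normB ((w1 - w2) + (w2 - w4)) (w3 - w4).
    have k5 := ler_normD (w1 - w2) (w2 - w4).
    by move: k1 k2 k3 k4 k5 d0; clear; lra.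
have pm : 2 / m * (t2 - t1) <= p.
  rewrite mulrAC ler_pdivrMr//.
  by move: dt r4; rewrite /rho4; clear; lra.
have sub s : t1 <= s <= t2 -> 0 <= s <= t2.
  by move=> /andP[ts ->]; rewrite (le_trans (ltW t10)).
have ym s : t1 <= s <= t2 -> m <= y2 s.
  move=> /andP[ts st]; apply: (H3 U2 t2 a2 h2 x2 y2 s) => //.
    exact: near_data_le N2.
  exact: le_trans ts.
have mm : `|2| * m^-1 = 2 / m by rewrite ger0_norm.
have xx : `|x2 t2 - x2 t1| <= p.
  apply: le_trans pm; apply: (mean_value_lin t12) => s st.
    by have [_ + _] := G2 _ (sub _ st); apply.
  rewrite normrM normrN -mm ler_wpM2l//.
  by have [] := inv_bound (x2 s - rev_driver (T := T) U2 t2 s) m0 (ym _ st).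
have yy : `|y2 t2 - y2 t1| <= p.
  apply: le_trans pm; apply: (mean_value_lin t12) => s st.
    by have [_ _ +] := G2 _ (sub _ st); apply.
  rewrite normrM -mm ler_wpM2l//.
  by have [] := inv_bound (x2 s - rev_driver (T := T) U2 t2 s) m0 (ym _ st).
have sqp u : `|u| <= p -> u ^+ 2 <= q / 8.
  move=> up; rewrite -(real_normK (num_real u)).
  apply: (@le_trans _ _ p); last by rewrite /p ge_min lexx orbT.
  have p1 : p <= 1 by rewrite /p ge_min lexx.
  apply: (@le_trans _ _ (1 * p)); last by rewrite mul1r.
  by rewrite expr2; apply: ler_pM => //; exact: le_trans p1.
have {}xx := sqp _ xx; have {}yy := sqp _ yy.
move: main xx yy.
move: (x1 t1) (x2 t1) (x2 t2) (y1 t1) (y2 t1) (y2 t2) => u1 u2 u3 w1 w2 w3.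
clear => h1 h2 h3.
have := sqr_ge0 ((u1 - u2) + (u3 - u2)); have := sqr_ge0 ((w1 - w2) + (w3 - w2)).
by nra.
Qed.

(** All endpoints reached from nearby data are close to each other.  Existence
    of the tip, its continuity in time and its continuity in the driver are
    three instances. *)
Lemma near_endpoint (R : realType) (T : R) (U : R -> R) (t q : R) :
  0 < T -> BV_LR T U ->
  0 < t <= T ->  0 < q -> exists2 rho, 0 < rho &
  forall U1 t1 a1 h1 x1 y1 U2 t2 a2 h2 x2 y2,
  near_data T U t rho U1 t1 a1 h1 -> flow_from T U1 t1 a1 h1 x1 y1 ->
  near_data T U t rho U2 t2 a2 h2 -> flow_from T U2 t2 a2 h2 x2 y2 ->
  (x1 t1 - x2 t2) ^+ 2 + (y1 t1 - y2 t2) ^+ 2 <= q.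
Proof.
move=> T0 LU t0T q0; have [rho rho0 H] := near_endpoint_le T0 LU t0T q0.
exists rho => // U1 t1 a1 h1 x1 y1 U2 t2 a2 h2 x2 y2 N1 F1 N2 F2.
have [t12|/ltW t21] := leP t1 t2.
  exact: (H _ _ _ _ _ _ _ _ _ _ _ _ t12 N1 F1 N2 F2).
have := H _ _ _ _ _ _ _ _ _ _ _ _ t21 N2 F2 N1 F1.
by rewrite -[(x2 t2 - _) ^+ 2]sqrrN opprB -[(y2 t2 - _) ^+ 2]sqrrN opprB.
Qed.

(** * Points surviving the Loewner flow *)

(** The Loewner flow started at [x + iy] exists in the half-plane up to time
    [t].  The driver is extended by constants off [0, T]. *)
Definition survives (R : realType) (T : R) (U : R -> R) (t x y : R) : Prop :=
  exists a b, [/\ down_flow (fun s => U (clamp T s)) t a b, a 0 = x & b 0 = y].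

Lemma survives_le (R : realType) (T : R) (U : R -> R) (t t' x y : R) :
  t' <= t -> survives T U t x y -> survives T U t' x y.
Proof.
by move=> tt [a [b [F a0 b0]]]; exists a, b; split => //; exact: down_flow_sub F.
Qed.

Lemma survives0 (R : realType) (T : R) (U : R -> R) (x y : R) : 0 < T ->
  BV0 T U -> 0 < y -> survives T U 0 x y.
Proof.
move=> T0 BU y0; have [a [b [F a0 b0]]] := flow_from_exists (x - U 0) T0 BU (lexx 0) y0.
exists (fun s => a (0 - s)), (fun s => b (0 - s)); split.
- exact: up_flow_rev F.
- by rewrite subr0 a0 addrC subrK.
- by rewrite subr0.
Qed.

(** The truncated flow agrees with the true one as long as the latter is above
    the truncation level. *)
Lemma trunc_agree (R : realType) (W : R -> R) (t m : R) (a b a' b' : R -> R) :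
  0 < m -> down_flow W t a b -> (forall s, 0 <= s <= t -> m <= b s) ->
  (forall s, 0 <= s <= t -> trunc_eq 2 W m a' b' s) -> a' 0 = a 0 -> b' 0 = b 0 ->
  forall s, 0 <= s <= t -> a' s = a s /\ b' s = b s.
Proof.
move=> m0 F bm F' a0 b0 s /andP[s0 st].
have sub r : r \in [set` `[0, s]] -> 0 <= r <= t.
  by rewrite inE/= in_itv/= => /andP[-> rs]; rewrite (le_trans rs).
have sub' r : 0 < r < s -> 0 <= r <= t.
  by move=> /andP[r0 rs]; rewrite (ltW r0)/= (le_trans (ltW rs)).
have ca : {within `[0, s], continuous a}.
  apply/continuous_in_subspaceT => r /sub /F [_ da _].
  exact: is_derive_continuous da.
have cb : {within `[0, s], continuous b}.
  apply/continuous_in_subspaceT => r /sub /F [_ _ db].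
  exact: is_derive_continuous db.
have ca' : {within `[0, s], continuous a'}.
  apply/continuous_in_subspaceT => r /sub /F' [da _].
  exact: is_derive_continuous da.
have cb' : {within `[0, s], continuous b'}.
  apply/continuous_in_subspaceT => r /sub /F' [_ db].
  exact: is_derive_continuous db.
have := @trunc_gronwall _ 2 W m s a' b' a b m0 s0 ca' cb' ca cb.
rewrite a0 b0 !subrr expr0n/= addr0 mul0r => H.
have {}H : (a' s - a s) ^+ 2 + (b' s - b s) ^+ 2 <= 0.
  apply: H => r /sub' rt; first exact: F'.
  by apply: (down_flow_trunc F) => //; exact: bm.
have p1 := sqr_ge0 (a' s - a s); have p2 := sqr_ge0 (b' s - b s).
have e1 : (a' s - a s) ^+ 2 = 0 by apply/eqP; rewrite eq_le p1 andbT; move: H p2; clear; lra.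
have e2 : (b' s - b s) ^+ 2 = 0 by apply/eqP; rewrite eq_le p2 andbT; move: H p1; clear; lra.
by split; apply/eqP; rewrite -subr_eq0 -sqrf_eq0 ?e1 ?e2.
Qed.

Lemma trunc_down_flow (R : realType) (W : R -> R) (t m : R) (a b : R -> R) :
  0 < m -> (forall s, 0 <= s <= t -> trunc_eq 2 W m a b s) ->
  (forall s, 0 <= s <= t -> m <= b s) -> down_flow W t a b.
Proof.
move=> m0 F bm s st; have := F s st; have mb := bm _ st.
rewrite /trunc_eq max_l// => -[da db]; split => //.
exact: lt_le_trans mb.
Qed.

Lemma down_flow_unique (R : realType) (W : R -> R) (t : R) (a b a' b' : R -> R) :
  continuous W -> 0 <= t -> down_flow W t a b -> down_flow W t a' b' ->
  a' 0 = a 0 -> b' 0 = b 0 ->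
  forall s, 0 <= s <= t -> a' s = a s /\ b' s = b s.
Proof.
move=> cW t0 F F' a0 b0 s st.
have tt : 0 <= t <= t by rewrite t0 lexx.
pose m := Num.min (b t) (b' t).
have m0 : 0 < m by rewrite lt_min; have [-> _ _] := F _ tt; have [-> _ _] := F' _ tt.
have [u [v [u0 v0 G]]] := trunc_exists 2 (a 0) (b 0) cW m0 t0.
have bm r : 0 <= r <= t -> m <= b r.
  move=> /andP[r0 rt]; rewrite /m ge_min; apply/orP; left.
  exact: (down_flow_mono F).
have bm' r : 0 <= r <= t -> m <= b' r.
  move=> /andP[r0 rt]; rewrite /m ge_min; apply/orP; right.
  exact: (down_flow_mono F').
have [<- <-] := trunc_agree m0 F bm G u0 v0 st.
have ua : u 0 = a' 0 by rewrite u0.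
have vb : v 0 = b' 0 by rewrite v0.
by have [-> ->] := trunc_agree m0 F' bm' G ua vb st.
Qed.

(** As long as the flow stays above height 2m it can be continued by m^2/2. *)
Lemma trunc_extend (R : realType) (W : R -> R) (T t m : R) (a b : R -> R) :
  0 < m -> 0 <= t <= T -> (forall s, 0 <= s <= T -> trunc_eq 2 W m a b s) ->
  (forall s, 0 <= s <= t -> 2 * m <= b s) ->
  down_flow W (Num.min T (t + m ^+ 2 / 2)) a b.
Proof.
move=> m0 /andP[t0 tT] F bm.
have sub s : 0 <= s <= Num.min T (t + m ^+ 2 / 2) -> 0 <= s <= T.
  by move=> /andP[->]; rewrite le_min => /andP[->].
apply: (trunc_down_flow m0) => [s /sub|s sI]; first exact: F.
have [st|ts] := leP s t.
  have /bm h : 0 <= s <= t by rewrite st; case/andP: sI => ->.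
  by move: h m0; clear; lra.
have /andP[s0 sT] := sub _ sI.
have h1 : `|b s - b t| <= 2 / m * (s - t).
  apply: (mean_value_lin (ltW ts)
    (f' := fun r => - 2 * inv_im (a r - W r) (Num.max (b r) m))) => r /andP[tr rs].
    by have [|_ db //] := F r; rewrite (le_trans t0 tr) (le_trans rs).
  have mx : m <= Num.max (b r) m by rewrite le_max lexx orbT.
  have [_ h] := inv_bound (a r - W r) m0 mx.
  by rewrite normrM normrN (@ger0_norm _ 2)// ler_wpM2l.
have h2 : 2 * m <= b t by apply: bm; rewrite t0 lexx.
have h3 : s - t <= m ^+ 2 / 2.
  by case/andP: sI => _; rewrite le_min => /andP[_]; clear; lra.
have h4 : 2 / m * (s - t) <= m.
  have -> : m = 2 / m * (m ^+ 2 / 2) by field; rewrite gt_eqF.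
  have -> : 2 / (2 / m * (m ^+ 2 / 2)) = 2 / m.
    by field; rewrite gt_eqF.
  by rewrite ler_wpM2l// divr_ge0// ltW.
move: h1; rewrite ler_norml => /andP[h1 _].
by move: h1 h2 h4; clear; lra.
Qed.

Lemma continuous_clamp_driver (R : realType) (T : R) (U : R -> R) : 0 < T ->
  BV0 T U -> continuous (fun s => U (clamp T s)).
Proof. by move=> T0 [[cU _] _]; exact: continuous_within_clamp (ltW T0) cU. Qed.

Lemma survives_extend (R : realType) (T : R) (U : R -> R) (t x y : R) : 0 < T ->
  BV0 T U -> 0 <= t < T -> survives T U t x y ->
  exists2 t', t < t' <= T & survives T U t' x y.
Proof.
move=> T0 BU /andP[t0 tT] [a [b [F a0 b0]]].
have cW := continuous_clamp_driver T0 BU.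
have [bt _ _] : [/\ 0 < b t, is_derive t 1 a (2 * inv_re (a t - U (clamp T t)) (b t)) &
    is_derive t 1 b (- 2 * inv_im (a t - U (clamp T t)) (b t))].
  by apply: F; rewrite t0 lexx.
pose m := b t / 2; have m0 : 0 < m by rewrite divr_gt0.
have [u [v [u0 v0 G]]] := trunc_exists 2 x y cW m0 (ltW T0).
have bm s : 0 <= s <= t -> 2 * m <= b s.
  move=> /andP[s0 st]; have := down_flow_mono F s0 st (lexx _).
  by rewrite /m; clear; lra.
have vb s : 0 <= s <= t -> 2 * m <= v s.
  have bm1 r : 0 <= r <= t -> m <= b r by move=> /bm; move: m0; clear; lra.
  have G1 r : 0 <= r <= t -> trunc_eq 2 (fun s => U (clamp T s)) m u v r.
    by move=> /andP[r0 rt]; apply: G; rewrite r0 (le_trans rt)// ltW.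
  have ua : u 0 = a 0 by rewrite u0 a0.
  have vb : v 0 = b 0 by rewrite v0 b0.
  by move=> st; have [_ ->] := trunc_agree m0 F bm1 G1 ua vb st; exact: bm.
exists (Num.min T (t + m ^+ 2 / 2)).
  by rewrite lt_min tT ge_min lexx ltrDl divr_gt0// exprn_gt0.
exists u, v; split => //; apply: trunc_extend => //.
by rewrite t0 ltW.
Qed.

(** Points close to one that survives with room to spare survive as well. *)
Lemma survives_stable (R : realType) (T : R) (U : R -> R) (m : R) : 0 < T ->
  BV0 T U -> 0 < m -> exists2 d, 0 < d & forall t x y x' y' a b, 0 <= t <= T ->
  down_flow (fun s => U (clamp T s)) t a b -> a 0 = x -> b 0 = y ->
  (forall s, 0 <= s <= t -> 2 * m <= b s) -> (x' - x) ^+ 2 + (y' - y) ^+ 2 <= d ->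
  exists a' b', [/\ down_flow (fun s => U (clamp T s)) t a' b', a' 0 = x',
    b' 0 = y' & forall s, 0 <= s <= t -> m <= b' s].
Proof.
move=> T0 BU m0; have cW := continuous_clamp_driver T0 BU.
pose C := expR (4 * (`|2| * (m ^+ 2)^-1) * T).
have C0 : 0 < C by exact: expR_gt0.
exists (m ^+ 2 / C) => [|t x y x' y' a b /andP[t0 tT] F a0 b0 bm xy].
  by rewrite divr_gt0// exprn_gt0.
have [u [v [u0 v0 G]]] := trunc_exists 2 x' y' cW m0 t0.
have bm' s : 0 <= s <= t -> m <= b s.
  by move=> /bm; move: m0; clear; lra.
suff vm s : 0 <= s <= t -> m <= v s.
  by exists u, v; split => //; exact: trunc_down_flow G vm.
move=> /[dup] st /andP[s0 st'].
have sub r : r \in [set` `[0, s]] -> 0 <= r <= t.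
  by rewrite inE/= in_itv/= => /andP[-> rs]; rewrite (le_trans rs).
have sub' r : 0 < r < s -> 0 <= r <= t.
  by move=> /andP[r0 rs]; rewrite (ltW r0)/= (le_trans (ltW rs)).
have ca : {within `[0, s], continuous a}.
  apply/continuous_in_subspaceT => r /sub /F [_ da _].
  exact: is_derive_continuous da.
have cb : {within `[0, s], continuous b}.
  apply/continuous_in_subspaceT => r /sub /F [_ _ db].
  exact: is_derive_continuous db.
have cu : {within `[0, s], continuous u}.
  apply/continuous_in_subspaceT => r /sub /G [da _].
  exact: is_derive_continuous da.
have cv : {within `[0, s], continuous v}.
  apply/continuous_in_subspaceT => r /sub /G [_ db].
  exact: is_derive_continuous db.
have := @trunc_gronwall _ 2 _ m s u v a b m0 s0 cu cv ca cb.
move=> /(_ (fun s => U (clamp T s))) H.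
have {}H : (u s - a s) ^+ 2 + (v s - b s) ^+ 2 <= m ^+ 2 / C * C.
  have CC : expR (4 * (`|2| * (m ^+ 2)^-1) * s) <= C.
    rewrite ler_expR ler_wpM2l ?(le_trans st')//.
    by rewrite !mulr_ge0// invr_ge0 exprn_ge0// ltW.
  apply: (@le_trans _ _ (((u 0 - a 0) ^+ 2 + (v 0 - b 0) ^+ 2) *
    expR (4 * (`|2| * (m ^+ 2)^-1) * s))).
    apply: H => r /sub' rt; first exact: G.
    by apply: (down_flow_trunc F) => //; exact: bm'.
  apply: ler_pM => //; first by rewrite addr_ge0 ?sqr_ge0.
  by rewrite u0 v0 a0 b0.
rewrite mulfVK ?gt_eqF// in H.
have h1 := bm _ st.
have h2 := sqr_ge0 (u s - a s).
rewrite leNgt; apply/negP => vm.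
have : m < b s - v s by move: h1 vm; clear; lra.
by move: H h2 m0; clear; nra.
Qed.

(** * The tip of the trace *)

Lemma near_data_self (R : realType) (T : R) (U : R -> R) (t rho a h : R) :
  BV0 T U -> 0 <= T -> 0 < t <= T -> `|a| <= rho -> 0 < h <= rho ->
  near_data T U t rho U t a h.
Proof.
move=> BU T0 tT ar hr; have r0 : 0 <= rho by exact: le_trans ar.
split => //; last by rewrite subrr normr0.
have -> : (U \- U)%R = cst 0 by apply/funext => x /=; rewrite subrr.
by rewrite nondecreasing_total_variation//= subrr lee_fin.
Qed.

(** [p1 + i p2] is the tip at time [t]: the common limit of the endpoints of
    all the upward flows with data tending to ([U], [t], [U t]). *)
Definition is_tip (R : realType) (T : R) (U : R -> R) (t p1 p2 : R) : Prop :=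
  forall q, 0 < q -> exists2 rho, 0 < rho & forall U' t' a h x y,
    near_data T U t rho U' t' a h -> flow_from T U' t' a h x y ->
    (x t' - p1) ^+ 2 + (y t' - p2) ^+ 2 <= q.

Lemma tip_exists (R : realType) (T : R) (U : R -> R) (t : R) : 0 < T ->
  BV_LR T U -> 0 < t <= T -> exists p : R * R, 0 < p.2 /\ is_tip T U t p.1 p.2.
Proof.
move=> T0 LU t0T; have BU : BV0 T U by case: LU.
have /andP[t0 tT] := t0T.
have near_rho n : exists rho, 0 < rho /\
  forall U1 t1 a1 h1 x1 y1 U2 t2 a2 h2 x2 y2,
  near_data T U t rho U1 t1 a1 h1 -> flow_from T U1 t1 a1 h1 x1 y1 ->
  near_data T U t rho U2 t2 a2 h2 -> flow_from T U2 t2 a2 h2 x2 y2 ->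
  (x1 t1 - x2 t2) ^+ 2 + (y1 t1 - y2 t2) ^+ 2 <= ((2 ^+ n)^-1) ^+ 2.
  have [|rho rho0 H] := @near_endpoint _ _ _ _ (((2 ^+ n)^-1) ^+ 2) T0 LU t0T.
    by rewrite exprn_gt0// invr_gt0 exprn_gt0.
  by exists rho.
have [rho rhoP] := choice near_rho.
(* Starting heights for which successive endpoints are at distance 2^-n. *)
pose hh := fix f n := if n is k.+1 then Num.min (f k) (rho k.+1) else rho 0%N.
have hh0 n : 0 < hh n.
  elim: n => [|n IH] /=; first by have [] := rhoP 0%N.
  by rewrite lt_min IH; have [] := rhoP n.+1.
have hrho n : hh n <= rho n by case: n => //= n; rewrite ge_min lexx orbT.
have hrhoS n : hh n.+1 <= rho n by rewrite /= ge_min hrho.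
have flow n : exists xy : (R -> R) * (R -> R), flow_from T U t 0 (hh n) xy.1 xy.2.
  have [x [y F]] := flow_from_exists 0 T0 BU (ltW t0) (hh0 n).
  by exists (x, y).
have [f fP] := choice flow.
have N n k : hh n <= rho k -> near_data T U t (rho k) U t 0 (hh n).
  move=> hk; apply: near_data_self => //; first exact: ltW.
    by rewrite normr0; have [/ltW] := rhoP k.
  by rewrite hh0.
have absle (u v w : R) : 0 <= w -> u ^+ 2 + v ^+ 2 <= w ^+ 2 -> `|u| <= w /\ `|v| <= w.
  move=> w0 H; have p1 := sqr_ge0 u; have p2 := sqr_ge0 v.
  by split; rewrite -ler_sqr ?nnegrE// real_normK ?num_real//; move: H p1 p2;
    clear; lra.
have step n := (proj2 (rhoP n)) _ _ _ _ _ _ _ _ _ _ _ _ (N _ _ (hrhoS n)) (fP _)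
   (N _ _ (hrho n)) (fP _).
have stepa n : `|(f n.+1).1 t - (f n).1 t| <= 1 / 2 ^+ n /\
               `|(f n.+1).2 t - (f n).2 t| <= 1 / 2 ^+ n.
  rewrite div1r; apply: absle (step n); by rewrite invr_ge0 exprn_ge0.
have [p1 H1] := geometric_limit (fun n => proj1 (stepa n)).
have [p2 H2] := geometric_limit (fun n => proj2 (stepa n)).
have [m m0 [rho' rho'0 Hm]] := near_height T0 LU t0T t0.
have tip : is_tip T U t p1 p2.
  move=> q q0.
  have [n Hn] : exists n : nat, 22 / q < n%:R.
    by exists (Num.bound (22 / q)); rewrite archi_boundP// divr_ge0// ltW.
  exists (rho n); first by have [] := rhoP n.
  move=> U' t' a h x y N' F'.
  have [_ /(_ _ _ _ _ _ _ _ _ _ _ _ _ N' F' (N _ _ (hrho n)) (fP n)) HH] := rhoP n.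
  have := H1 n; have := H2 n.
  have w0 : 0 < (2 ^+ n : R)^-1 by rewrite invr_gt0 exprn_gt0.
  have wq : 22 * (2 ^+ n)^-1 <= q.
    have : (n%:R : R) <= 2 ^+ n by rewrite -natrX ler_nat ltnW// ltn_expl.
    rewrite ler_pdivrMr ?exprn_gt0// mulrC -ler_pdivrMr//; apply: le_trans.
    exact: ltW.
  have w1 : (2 ^+ n : R)^-1 <= 1 by rewrite invf_le1 ?exprn_gt0// exprn_ege1// ler1n.
  rewrite mulr1; move: HH w0 wq w1.
  move: (x t') (y t') ((f n).1 t) ((f n).2 t) (2 ^+ n : R)^-1 => X Y A B w.
  clear => HH w0 wq w1 hB hA.
  have sA : (A - p1) ^+ 2 <= (2 * w) ^+ 2.
    by rewrite -(real_normK (num_real (A - p1))) ler_sqr ?nnegrE// mulr_ge0// ltW.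
  have sB : (B - p2) ^+ 2 <= (2 * w) ^+ 2.
    by rewrite -(real_normK (num_real (B - p2))) ler_sqr ?nnegrE// mulr_ge0// ltW.
  have ww : w ^+ 2 <= w by rewrite expr2 ler_piMl// ltW.
  have := sqr_ge0 ((X - A) - (A - p1)); have := sqr_ge0 ((Y - B) - (B - p2)).
  by move: HH sA sB wq ww; clear; nra.
exists (p1, p2) => /=; split => //.
have m20 : 0 < (m / 2) ^+ 2 by rewrite exprn_gt0// divr_gt0.
have [rho1 rho10 H] := tip _ m20.
pose h := Num.min rho1 rho'.
have h0 : 0 < h by rewrite lt_min rho10.
have [h1 h2] : h <= rho1 /\ h <= rho' by apply/andP; rewrite -le_min.
have [x [y F]] := flow_from_exists 0 T0 BU (ltW t0) h0.
have /H /(_ F) h3 : near_data T U t rho1 U t 0 h.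
  by apply: near_data_self; rewrite ?normr0 ?h0 ?(ltW rho10) ?(ltW T0).
have h4 : m <= y t.
  apply: (Hm U t 0 h x y t) => //.
  by apply: near_data_self; rewrite ?normr0 ?h0 ?(ltW rho'0) ?(ltW T0).
have [_ h5] := absle _ _ _ (ltW (divr_gt0 m0 (ltr0Sn _ 1))) h3.
by move: h5; rewrite ler_norml => /andP[_ h5]; move: h4 h5 m0; clear; lra.
Qed.

Lemma sqr_dist_eq (R : realType) (a b c d : R) :
  (forall q, 0 < q -> (a - b) ^+ 2 + (c - d) ^+ 2 <= q) -> a = b /\ c = d.
Proof.
move=> H; have H0 : (a - b) ^+ 2 + (c - d) ^+ 2 <= 0.
  by apply/ler_addgt0Pr => e e0; rewrite add0r; exact: H.
have p1 := sqr_ge0 (a - b); have p2 := sqr_ge0 (c - d).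
have e1 : (a - b) ^+ 2 = 0 by apply/eqP; rewrite eq_le p1 andbT; move: H0 p2; clear; lra.
have e2 : (c - d) ^+ 2 = 0 by apply/eqP; rewrite eq_le p2 andbT; move: H0 p1; clear; lra.
by split; apply/eqP; rewrite -subr_eq0 -sqrf_eq0 ?e1 ?e2.
Qed.

(** For every small h the tip is approximated by the endpoint of the flow
    started at height h above the driving point. *)
Lemma tip_approx (R : realType) (T : R) (U : R -> R) (t p1 p2 q : R) : 0 < T ->
  BV0 T U -> 0 < t <= T -> is_tip T U t p1 p2 -> 0 < q ->
  exists2 rho, 0 < rho & forall h, 0 < h <= rho -> exists x y,
    flow_from T U t 0 h x y /\ (x t - p1) ^+ 2 + (y t - p2) ^+ 2 <= q.
Proof.
move=> T0 BU t0T tip q0; have [rho rho0 H] := tip _ q0; exists rho => // h hr.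
have /andP[t0 tT] := t0T; have /andP[h0 _] := hr.
have [x [y F]] := flow_from_exists 0 T0 BU (ltW t0) h0.
exists x, y; split => //; apply: H F; apply: near_data_self => //; first exact: ltW.
by rewrite normr0 ltW.
Qed.

Lemma tip_near (R : realType) (T : R) (U : R -> R) (t p1 p2 q : R) : 0 < T ->
  is_tip T U t p1 p2 -> 0 < q -> exists2 rho, 0 < rho & forall U' t' p1' p2',
  BV0 T U' -> (total_variation 0 T (U' \- U)%R <= rho%:E)%E -> 0 < t' <= T ->
  `|t' - t| <= rho -> is_tip T U' t' p1' p2' ->
  (p1' - p1) ^+ 2 + (p2' - p2) ^+ 2 <= q.
Proof.
move=> T0 tip q0; have q40 : 0 < q / 4 by rewrite divr_gt0.
have [rho rho0 H] := tip _ q40; exists rho => // U' t' p1' p2' BU' UU' t'T tt' tip'.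
have [rho' rho'0 H'] := tip_approx T0 BU' t'T tip' q40.
pose h := Num.min rho rho'.
have h0 : 0 < h by rewrite lt_min rho0.
have [h1 h2] : h <= rho /\ h <= rho' by apply/andP; rewrite -le_min.
have [|x [y [F G']]] := H' h; first by rewrite h0.
have G : (x t' - p1) ^+ 2 + (y t' - p2) ^+ 2 <= q / 4.
  apply: (H U' t' 0 h x y) => //; split => //.
  by rewrite normr0 h0 h1 ltW.
move: G G'; move: (x t') (y t') => X Y; clear => G G'.
have := sqr_ge0 ((X - p1) + (X - p1')); have := sqr_ge0 ((Y - p2) + (Y - p2')).
by nra.
Qed.

(** The trace starts at 0, locally uniformly in the driver. *)
Lemma tip_near0 (R : realType) (T : R) (U : R -> R) (q : R) : 0 < T ->
  BV0 T U -> 0 < q -> exists2 rho, 0 < rho & forall U' t' p1 p2,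
  BV0 T U' -> (total_variation 0 T (U' \- U)%R <= rho%:E)%E -> 0 < t' <= T ->
  t' <= rho -> is_tip T U' t' p1 p2 -> p1 ^+ 2 + p2 ^+ 2 <= q.
Proof.
move=> T0 BU q0; pose w := Num.min 1 (q / 40).
have w0 : 0 < w by rewrite lt_min ltr01 divr_gt0.
have [w1 wq] : w <= 1 /\ w <= q / 40 by apply/andP; rewrite -le_min.
have [d d0 Hd] := tvar_unif T0 BU w0.
exists (Num.min w (d / 2)); first by rewrite lt_min w0 divr_gt0.
set rho := Num.min _ _; have [r1 r2] : rho <= w /\ rho <= d / 2 by apply/andP; rewrite -le_min.
move=> U' t' p1 p2 BU' UU' /[dup] t'T' /andP[t'0 t'T] t'r tip.
have [rho' rho'0 H'] := tip_approx T0 BU' t'T' tip w0.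
pose h := Num.min w rho'.
have h0 : 0 < h by rewrite lt_min w0.
have [h1 h2] : h <= w /\ h <= rho' by apply/andP; rewrite -le_min.
have [|x [y [[F x0 y0] G]]] := H' h; first by rewrite h0.
have dom := rev_driver_dominates BU' t'T (lexx t').
have := abs_re_le (@continuous_rev_driver _ _ U' t' T0 BU') F dom.
rewrite subr0 subrr => /(_ t' erefl); rewrite (ltW t'0) lexx => /(_ isT).
have -> : rev_driver (T := T) U' t' t' = 0.
  rewrite /rev_driver subrr clamp_id ?lexx ?(ltW T0)//.
  by case: BU' => -[_ ->].
rewrite x0 rev_driver0 ?(ltW t'0)//= addr0 subrr normr0 add0r subr0 subrr tvar0 subr0.
move=> hx.
have hv : tvar U' t' <= 2 * w.
  have k1 := tvar_perturb BU BU' UU' (lexx 0) (ltW t'0) t'T.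
  rewrite !tvar0 !subr0 in k1.
  have k2 : `|tvar U t' - tvar U 0| < w.
    apply: Hd; rewrite ?(ltW t'0) ?lexx ?(ltW T0)// subr0 gtr0_norm//.
    by move: t'r r2 d0; clear; lra.
  rewrite tvar0 subr0 in k2; have k3 := le_lt_trans (ler_norm _) k2.
  by move: k1 k3 r1; clear; lra.
have hy := up_flow_sqr_le (ltW t'0) F.
rewrite y0 in hy.
have hx2 : x t' ^+ 2 <= (2 * w) ^+ 2.
  rewrite -(real_normK (num_real (x t'))) ler_sqr ?nnegrE ?mulr_ge0 ?(ltW w0)//.
  exact: le_trans hv.
have hh2 : h ^+ 2 <= w ^+ 2 by rewrite ler_sqr ?nnegrE ?(ltW h0) ?(ltW w0).
have ww : w ^+ 2 <= w by rewrite expr2 ler_piMl// ltW.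
have t'w : t' <= w by exact: le_trans r1.
move: G hx2 hy hh2 ww t'w wq w0; move: (x t') (y t') => X Y; clear => *.
have := sqr_ge0 (X + (X - p1)); have := sqr_ge0 (Y + (Y - p2)).
by nra.
Qed.

Lemma flow_from_down (R : realType) (T : R) (U : R -> R) (t a h : R)
    (x y : R -> R) : 0 <= t -> flow_from T U t a h x y ->
  exists b c, [/\ down_flow (fun s => U (clamp T s)) t b c, b 0 = x t, c 0 = y t,
    c t = h & forall s, c s = y (t - s)].
Proof.
move=> t0 [F x0 y0]; exists (fun s => x (t - s)), (fun s => y (t - s)).
by rewrite !subr0 !subrr; split => //; exact: up_flow_rev F.
Qed.

(** The tip at time t survives up to every earlier time. *)
Lemma tip_survives (R : realType) (T : R) (U : R -> R) (t s p1 p2 : R) : 0 < T ->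
  BV_LR T U -> 0 < t <= T -> is_tip T U t p1 p2 -> 0 <= s < t ->
  survives T U s p1 p2.
Proof.
move=> T0 LU t0T tip /andP[s0 st]; have BU : BV0 T U by case: LU.
have /andP[t0 tT] := t0T; have ts0 : 0 < t - s by rewrite subr_gt0.
have [m m0 [rho rho0 Hm]] := near_height T0 LU t0T ts0.
have m20 : 0 < m / 2 by rewrite divr_gt0.
have [d d0 Hd] := survives_stable T0 BU m20.
have [rho' rho'0 H'] := tip_approx T0 BU t0T tip d0.
pose h := Num.min rho rho'.
have h0 : 0 < h by rewrite lt_min rho0.
have [h1 h2] : h <= rho /\ h <= rho' by apply/andP; rewrite -le_min.
have [|x [y [F G]]] := H' h; first by rewrite h0.
have [b [c [Fd b0 c0 _ cE]]] := flow_from_down (ltW t0) F.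
have [| | | |u [v [Fu u0 v0 _]]] := Hd s (x t) (y t) p1 p2 b c _ _ b0 c0.
- by rewrite s0 (le_trans (ltW st)).
- by apply: down_flow_sub Fd; exact: ltW.
- move=> r /andP[r0 rs]; rewrite cE mulrCA mulfV// mulr1.
  apply: (Hm U t 0 h x y) => //.
  + by apply: near_data_self; rewrite ?normr0 ?h0 ?(ltW rho0) ?(ltW T0).
  + by rewrite lerD2l lerN2.
  + by rewrite gerBl.
- by rewrite -[(p1 - _) ^+ 2]sqrrN -[(p2 - _) ^+ 2]sqrrN !opprB.
by exists u, v.
Qed.

(** The tip at time t does not survive up to time t: points close to the tip
    have arbitrarily small height at time t. *)
Lemma tip_dies (R : realType) (T : R) (U : R -> R) (t p1 p2 : R) : 0 < T ->
  BV0 T U -> 0 < t <= T -> is_tip T U t p1 p2 -> ~ survives T U t p1 p2.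
Proof.
move=> T0 BU t0T tip [a [b [F a0 b0]]].
have /andP[t0 tT] := t0T; have tt : 0 <= t <= t by rewrite lexx ltW.
have cW := continuous_clamp_driver T0 BU.
have [bt _ _] := F _ tt.
pose m := b t / 2; have m0 : 0 < m by rewrite divr_gt0.
have [d d0 Hd] := survives_stable T0 BU m0.
have [rho' rho'0 H'] := tip_approx T0 BU t0T tip d0.
pose h := Num.min (m / 2) rho'.
have h0 : 0 < h by rewrite lt_min rho'0 divr_gt0.
have [h1 h2] : h <= m / 2 /\ h <= rho' by apply/andP; rewrite -le_min.
have [|x [y [G D]]] := H' h; first by rewrite h0.
have bm s : 0 <= s <= t -> 2 * m <= b s.
  move=> /andP[s0 st]; have := down_flow_mono F s0 st (lexx _).
  by rewrite /m; clear; lra.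
have tT' : 0 <= t <= T by rewrite (ltW t0).
have [a' [b' [F' a'0 b'0 b'm]]] := Hd t p1 p2 _ _ a b tT' F a0 b0 bm D.
have [u [v [Fv u0 v0 vt _]]] := flow_from_down (ltW t0) G.
have [||_ vb] := down_flow_unique cW (ltW t0) F' Fv _ _ tt.
- by rewrite u0 a'0.
- by rewrite v0 b'0.
have := b'm _ tt; rewrite -vb vt.
by move: h1 m0; clear; lra.
Qed.

(** A point that dies by time t is the tip at the time of its death: until then
    the flow comes arbitrarily close to the driving point. *)
Lemma dies_tip (R : realType) (T : R) (U : R -> R) (t x y : R) : 0 < T ->
  BV0 T U -> 0 <= t <= T -> 0 < y -> ~ survives T U t x y ->
  exists2 s, 0 < s <= t &
    forall p1 p2, is_tip T U s p1 p2 -> p1 = x /\ p2 = y.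
Proof.
move=> T0 BU /andP[t0 tT] y0 dead.
have cW := continuous_clamp_driver T0 BU.
pose A := [set r | 0 <= r <= t /\ survives T U r x y].
have A0 : A 0 by split; [rewrite lexx|exact: survives0].
have ubA : ubound A t by move=> r [/andP[]].
have bA : has_sup A by split; [exists 0|exists t].
pose s := sup A.
have st : s <= t by apply: ge_sup => //; exists 0.
have le_s r : A r -> r <= s by move=> Ar; apply: ub_le_sup => //; exists t.
have s0 : 0 <= s by exact: le_s.
have below r : 0 <= r -> r < s -> survives T U r x y.
  move=> r0 rs; have sr : 0 < s - r by rewrite subr_gt0.
  have [u [_ Su] ru] := sup_adherent sr bA.
  by apply: survives_le Su; move: ru; rewrite -/s opprB addrC subrK => /ltW.
(* The lifetime is not extended beyond [s]. *)
have noext r : s < r -> ~ survives T U r x y.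
  move=> sr Sr; have [rt|tr] := ltP r t.
    have : r <= s by apply: le_s; split => //; rewrite (ltW rt) (le_trans s0)// ltW.
    by rewrite leNgt sr.
  by apply: dead; exact: survives_le Sr.
have spos : 0 < s.
  have t00 : 0 < t.
    rewrite lt_neqAle t0 andbT; apply/eqP => t00; apply: dead; rewrite -t00.
    exact: survives0.
  rewrite lt_neqAle s0 andbT; apply/eqP => s00.
  have [||t' /andP[t'0 _] St'] := @survives_extend R T U 0 x y T0 BU.
  - by rewrite lexx.
  - exact: survives0.
  - by apply: (noext t') => //; rewrite -s00.
exists s; first by rewrite spos.
have sT : s <= T by exact: le_trans st tT.
(* The flow comes arbitrarily close to the driving point before time [s]. *)
have close mu r0 : 0 < mu -> 0 <= r0 < s -> exists r a b,
    [/\ r0 <= r < s, down_flow (fun s => U (clamp T s)) r a b, a 0 = x, b 0 = y &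
      (a r - U (clamp T r)) ^+ 2 + b r ^+ 2 < mu].
  move=> mu0 /andP[r00 r0s]; apply: contrapT => far.
  have {}far r a b : r0 <= r -> r < s ->
      down_flow (fun s => U (clamp T s)) r a b -> a 0 = x -> b 0 = y ->
      mu <= (a r - U (clamp T r)) ^+ 2 + b r ^+ 2.
    move=> r0r rs F a0 b0; rewrite leNgt; apply/negP => lt.
    by apply: far; exists r, a, b; split => //; rewrite r0r.
  have [a0 [b0 [F0 a00 b00]]] := below _ r00 r0s.
  have [b0r _ _] : [/\ 0 < b0 r0,
      is_derive r0 1 a0 (2 * inv_re (a0 r0 - U (clamp T r0)) (b0 r0)) &
      is_derive r0 1 b0 (- 2 * inv_im (a0 r0 - U (clamp T r0)) (b0 r0))].
    by apply: F0; rewrite r00 lexx.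
  pose k := 2 / mu; have k0 : 0 < k by rewrite divr_gt0.
  pose m := b0 r0 * expR (- k * T) / 2.
  have m0 : 0 < m by rewrite divr_gt0// mulr_gt0// expR_gt0.
  have low r a b : r < s -> down_flow (fun s => U (clamp T s)) r a b ->
      a 0 = x -> b 0 = y -> r0 <= r -> 2 * m <= b r.
    move=> rs F a0' b0' r0r.
    have rr0 : 0 <= r0 <= r0 by rewrite r00 lexx.
    have [||_ bE] := down_flow_unique cW r00 F0 (down_flow_sub r0r F) _ _ rr0.
    - by rewrite a0'.
    - by rewrite b0'.
    have h : b0 r0 * expR (k * r0) <= b r * expR (k * r).
      rewrite -bE -lerN2.
      apply: (@nincr_derive _ (fun u => - (b u * expR (k * u)))
        (fun u => - (b u * (expR (k * u) * k) +
          (- 2 * inv_im (a u - U (clamp T u)) (b u)) * expR (k * u)))) => //.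
        move=> u /andP[r0u ur]; have [|_ _ db] := F u; first by rewrite (le_trans r00).
        exact: (isd_opp (isd_mul db (isd_expM k u))).
      move=> u /andP[r0u ur]; have [|bu _ _] := F u; first by rewrite (le_trans r00).
      have N0 := sqrD_gt0 (a u - U (clamp T u)) bu.
      have us : u < s by exact: le_lt_trans rs.
      have hmu := far u a b r0u us (down_flow_sub ur F) a0' b0'.
      have hN : ((a u - U (clamp T u)) ^+ 2 + b u ^+ 2)^-1 <= mu^-1 by rewrite lef_pV2.
      rewrite oppr_le0 /inv_im /k.
      have -> : b u * (expR (2 / mu * u) * (2 / mu)) +
        - 2 * (b u / ((a u - U (clamp T u)) ^+ 2 + b u ^+ 2)) * expR (2 / mu * u) =
        expR (2 / mu * u) * (2 * b u) *
        (mu^-1 - ((a u - U (clamp T u)) ^+ 2 + b u ^+ 2)^-1) by ring.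
      by rewrite mulr_ge0 ?subr_ge0// mulr_ge0 ?expR_ge0// mulr_ge0// ltW.
    have h1 : 1 <= expR (k * r0) by rewrite -expR0 ler_expR mulr_ge0// ltW.
    have h2 : expR (k * r) <= expR (k * T).
      by rewrite ler_expR ler_pM2l// (le_trans (ltW rs)).
    have -> : 2 * m = b0 r0 * expR (- k * T) by rewrite /m; field.
    rewrite mulNr expRN ler_pdivrMr ?expR_gt0//.
    apply: (@le_trans _ _ (b0 r0 * expR (k * r0))); first by rewrite ler_peMr// ltW.
    apply: (le_trans h); rewrite ler_wpM2l//.
    have [|br _ _] := F r; last exact: ltW.
    by rewrite lexx andbT (le_trans r00).
  have [u [v [u0 v0 G]]] := trunc_exists 2 x y cW m0 (ltW T0).
  have vm r : 0 <= r < s -> 2 * m <= v r.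
    move=> /andP[rr0 rs]; pose r' := Num.max r r0.
    have rr' : r <= r' by rewrite le_max lexx.
    have r0r' : r0 <= r' by rewrite le_max lexx orbT.
    have r's : r' < s by rewrite gt_max rs.
    have [a [b [F a0' b0']]] := below r' (le_trans rr0 rr') r's.
    have bm := low _ _ _ r's F a0' b0' r0r'.
    have bm' w : 0 <= w <= r' -> 2 * m <= b w.
      move=> /andP[w0 wr]; apply: (le_trans bm).
      exact: (down_flow_mono F).
    have bm1 w : 0 <= w <= r' -> m <= b w.
      by move=> /bm'; move: m0; clear; lra.
    have G1 w : 0 <= w <= r' -> trunc_eq 2 (fun s => U (clamp T s)) m u v w.
      by move=> /andP[w0 wr]; apply: G; rewrite w0 (le_trans wr)// (le_trans (ltW r's)).
    have ua : u 0 = a 0 by rewrite u0 a0'.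
    have vb : v 0 = b 0 by rewrite v0 b0'.
    have rI : 0 <= r <= r' by rewrite rr0.
    by have [_ ->] := trunc_agree m0 F bm1 G1 ua vb rI; exact: bm'.
  have vms : 2 * m <= v s.
    rewrite leNgt; apply/negP => vs.
    have [|_ dv] := G s; first by rewrite s0.
    have vs0 : 0 < 2 * m - v s by rewrite subr_gt0.
    have [dl dl0 Hv] := continuous_eps (is_derive_continuous dv) vs0.
    pose r := Num.max 0 (s - dl / 2).
    have r1 : 0 <= r by rewrite le_max lexx.
    have r2 : r < s by rewrite gt_max spos gtrBl divr_gt0.
    have r3 : s - dl / 2 <= r by rewrite le_max lexx orbT.
    have : `|v r - v s| < 2 * m - v s.
      apply: Hv; rewrite ltr_distl; apply/andP; split; move: r2 r3 dl0; clear; lra.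
    rewrite ltr_distl => /andP[_].
    have := vm r; rewrite r1 r2 => /(_ isT); clear; lra.
  have vmI r : 0 <= r <= s -> 2 * m <= v r.
    move=> /andP[r1]; rewrite le_eqVlt => /orP[/eqP ->//|rs].
    by apply: vm; rewrite r1.
  have sI : 0 <= s <= T by rewrite s0.
  have F := trunc_extend m0 sI G vmI.
  have [sT'|Ts] := ltP s T.
    apply: (noext (Num.min T (s + m ^+ 2 / 2))); last by exists u, v.
    by rewrite lt_min sT' ltrDl divr_gt0// exprn_gt0.
  have ts : t <= Num.min T (s + m ^+ 2 / 2).
    rewrite le_min tT (le_trans tT)// (le_trans Ts)// lerDl divr_ge0//.
    by rewrite exprn_ge0// ltW.
  by apply: dead; exists u, v; split => //; exact: down_flow_sub F.
move=> p1 p2 tip; suff: x = p1 /\ y = p2 by move=> [-> ->].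
apply: sqr_dist_eq => q q0.
have [rho rho0 H] := tip _ q0.
have mu0 : 0 < rho ^+ 2 by rewrite exprn_gt0.
have rI : 0 <= Num.max (s / 2) (s - rho) < s.
  by rewrite le_max divr_ge0//= gt_max gtrBl rho0 andbT ltr_pdivrMr// ltr_pMr// ltr1n.
have [r [a [b [/andP[r1 r2] F a0 b0 ab]]]] := close _ _ mu0 rI.
move: r1; rewrite ge_max => /andP[r1 r3].
have rpos : 0 < r by apply: lt_le_trans r1; rewrite divr_gt0.
have rT : 0 <= r <= T by rewrite (ltW rpos) (le_trans (ltW r2)).
have [br _ _] : [/\ 0 < b r, is_derive r 1 a (2 * inv_re (a r - U (clamp T r)) (b r)) &
    is_derive r 1 b (- 2 * inv_im (a r - U (clamp T r)) (b r))].
  by apply: F; rewrite lexx ltW.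
rewrite clamp_id// in ab.
have absr w : w ^+ 2 <= rho ^+ 2 -> `|w| <= rho.
  by move=> h; rewrite -ler_sqr ?nnegrE ?(ltW rho0)// real_normK ?num_real.
have e1 : `|a r - U r| <= rho.
  by apply: absr; move: ab (sqr_ge0 (b r)); clear; lra.
have e2 : b r <= rho.
  apply: (le_trans (ler_norm _)); apply: absr.
  by move: ab (sqr_ge0 (a r - U r)); clear; lra.
have := H U r (a r - U r) (b r) (fun s => a (r - s)) (fun s => b (r - s)).
rewrite subrr a0 b0; apply; last first.
  split; first exact: down_flow_rev F.
    by rewrite subr0 addrC subrK.
  by rewrite subr0.
split => //.
- have -> : (U \- U)%R = cst 0 by apply/funext => w /=; rewrite subrr.
  by rewrite nondecreasing_total_variation ?(ltW T0)//= subrr lee_fin ltW.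
- by rewrite rpos; case/andP: rT.
- by rewrite distrC ger0_norm ?subr_ge0 ?(ltW r2)//; move: r3; clear; lra.
- by rewrite e1 br e2.
Qed.

Import Normc.
Local Open Scope complex_scope.


(** * Complex notation *)

Lemma normc_sqr (R : realType) (z : Cplx R) :
  normc z ^+ 2 = complex.Re z ^+ 2 + complex.Im z ^+ 2.
Proof. by case: z => a b; rewrite /normc sqr_sqrtr// addr_ge0 ?sqr_ge0. Qed.

Lemma Re_le_normc (R : realType) (z : Cplx R) : `|complex.Re z| <= normc z.
Proof.
rewrite -ler_sqr ?nnegrE ?normc_ge0// real_normK ?num_real// normc_sqr.
by rewrite lerDl sqr_ge0.
Qed.

Lemma Im_le_normc (R : realType) (z : Cplx R) : `|complex.Im z| <= normc z.
Proof.
rewrite -ler_sqr ?nnegrE ?normc_ge0// real_normK ?num_real// normc_sqr.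
by rewrite lerDr sqr_ge0.
Qed.

Lemma normc_le (R : realType) (z : Cplx R) :
  normc z <= `|complex.Re z| + `|complex.Im z|.
Proof.
rewrite -ler_sqr ?nnegrE ?normc_ge0 ?addr_ge0// normc_sqr.
rewrite -(real_normK (num_real (complex.Re z))) -(real_normK (num_real (complex.Im z))).
have := normr_ge0 (complex.Re z); have := normr_ge0 (complex.Im z).
by move: `|complex.Re z| `|complex.Im z|; clear => u v; nra.
Qed.

Lemma normc_real (R : realType) (a : R) : normc (a%:C : Cplx R) = `|a|.
Proof. by rewrite /normc /= expr0n/= addr0 sqrtr_sqr. Qed.

Lemma cvg_normc (R : realType) (S : Type) (F : set_system S) (FF : Filter F)
    (f : S -> Cplx R) (l : Cplx R) :
  f @ F --> l <-> forall e : R, 0 < e -> \forall x \near F, normc (f x - l) < e.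
Proof.
split=> [/(@cvgrPdist_lt _ (Cplx R) _ _ FF f l) H e e0|H].
  have e0C : 0 < e%:C :> R[i] by rewrite ltcR.
  have := H _ e0C; apply: filterS => x; rewrite normcB => h.
  by rewrite -ltcR.
apply/(@cvgrPdist_lt _ (Cplx R) _ _ FF f l) => -[a b] /[!ltcE]/= /andP[/eqP/esym b0 a0].
subst b; have := H _ a0; apply: filterS => x; rewrite normcB => h.
by rewrite -ltcR in h.
Qed.

Lemma nbhs_normc (R : realType) (z : Cplx R) (A : set (Cplx R)) :
  nbhs z A <-> exists2 e : R, 0 < e & forall w, normc (w - z) < e -> A w.
Proof.
split.
  move=> /nbhs_ballP[[a b] /= /[!ltcE]/= /andP[/eqP/esym b0 a0]] aA; subst b.
  exists a => // w wz; apply: aA; rewrite /ball/= -ltcR in wz *.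
  by rewrite distrC.
move=> [e e0 H]; have e0C : 0 < e%:C :> R[i] by rewrite ltcR.
apply/nbhs_ballP; exists e%:C => // w; rewrite /ball/= distrC => wz.
by apply: H; rewrite -ltcR.
Qed.

(** The difference quotients of the Loewner equation, with explicit error. *)
Lemma slope_cvgP (R : realType) (g : R -> Cplx R) (s t : R) (L : Cplx R) :
  (fun r => (g r - g s) / (r - s)%:C) @ within `[0, t] s^' --> L <->
  forall e, 0 < e -> exists2 d, 0 < d & forall r, 0 <= r <= t -> `|r - s| < d ->
    normc (g r - g s - (r - s)%:C * L) <= e * `|r - s|.
Proof.
have E r : r != s -> normc (g r - g s - (r - s)%:C * L) =
    normc ((g r - g s) / (r - s)%:C - L) * `|r - s|.
  move=> rs; rewrite -normc_real -normcM; congr normc.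
  have rs0 : (r - s)%:C != 0 :> R[i].
    by apply/eqP => /(congr1 (@complex.Re R)) /= /eqP; rewrite subr_eq0 (negbTE rs).
  by rewrite mulrBl divfK// (mulrC L).
split=> [/cvg_normc H e e0|H].
  have /nbhs_ballP[d /= d0 {}H] := H _ e0.
  exists d => // r rt rsd; have [->|rs] := eqVneq r s.
    by rewrite !subrr mul0r subr0 normc0 normr0 mulr0.
  have sr : ball s d r by rewrite /ball/= distrC.
  have rI : r \in `[0, t] by rewrite in_itv.
  by rewrite E// ler_wpM2r//; apply: ltW; exact: H sr rs rI.
apply/cvg_normc => e e0; have e20 : 0 < e / 2 by rewrite divr_gt0.
have [d d0 {}H] := H _ e20.
apply/nbhs_ballP; exists d => //= r; rewrite /ball/= distrC => rsd rs.
rewrite in_itv/= => rt; have := H r rt rsd; rewrite E//.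
rewrite ler_pM2r ?normr_gt0 ?subr_eq0// => /le_lt_trans; apply.
by rewrite ltr_pdivrMr// ltr_pMr// ltr1n.
Qed.

Lemma eps_is_derive (R : realType) (f : R -> R) (x l : R) :
  (forall e, 0 < e -> exists2 d, 0 < d &
  forall u, `|u - x| < d -> `|f u - f x - (u - x) * l| <= e * `|u - x|) ->
  is_derive x 1 f l.
Proof.
move=> H.
have cv : h^-1 *: (f (h *: (1 : R) + x) - f x) @[h --> (0:R)^'] --> l.
  apply/cvgrPdist_lt => e e0; have e20 : 0 < e / 2 by rewrite divr_gt0.
  have [d d0 {}H] := H _ e20.
  apply/nbhs_ballP; exists d => //= h; rewrite /ball/= sub0r normrN => hd h0.
  have := H (h + x); rewrite addrK => /(_ hd) Hh.
  rewrite /GRing.scale/= mulr1.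
  have -> : l - h^-1 * (f (h + x) - f x) = - (h^-1 * (f (h + x) - f x - h * l)).
    by field.
  rewrite normrN normrM normfV mulrC ltr_pdivrMr ?normr_gt0//.
  apply: (le_lt_trans Hh); rewrite ltr_pM2r ?normr_gt0//.
  by rewrite ltr_pdivrMr// ltr_pMr// ltr1n.
apply: DeriveDef; first by apply/cvg_ex; exists l.
exact: cvg_lim cv.
Qed.

(** * Solutions of the Loewner equation *)

Lemma inv_re_im (R : realType) (X Y : R) : 0 < Y ->
  (2 / (X +i* Y) : Cplx R) = (2 * inv_re X Y) +i* (- 2 * inv_im X Y).
Proof.
move=> Y0; have N0 := sqrD_gt0 X Y0.
have z0 : (X +i* Y : R[i]) != 0.
  by apply/eqP => /(congr1 (@complex.Im R)) /= Y00; rewrite Y00 ltxx in Y0.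
apply: (mulIf z0); rewrite divfK//.
have -> : (2 : R[i]) = (2 : R)%:C by rewrite rmorph_nat.
simpc; apply/eqP; rewrite eq_complex /= /inv_re /inv_im; apply/andP; split; apply/eqP.
  by field; rewrite gt_eqF.
by field; rewrite gt_eqF.
Qed.

Lemma survives_solvable (R : realType) (T : R) (U : R -> R) (t x y : R) :
  0 <= t <= T -> survives T U t x y -> loewner_solvable U (x +i* y : Cplx R) t.
Proof.
move=> /andP[t0 tT] [a [b [F a0 b0]]].
exists (fun s => a s +i* b s : Cplx R); split; first by rewrite a0 b0.
move=> s; rewrite in_itv/= => sI; have [bs da db] := F s sI.
have sT : 0 <= s <= T by case/andP: sI => -> /le_trans; apply.
rewrite clamp_id// in da db; split.
  by apply/eqP => /(congr1 (@complex.Im R)) /= bs0; rewrite bs0 ltxx in bs.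
apply/slope_cvgP => e e0; have e20 : 0 < e / 2 by rewrite divr_gt0.
have [d1 d10 H1] := is_derive_eps da e20.
have [d2 d20 H2] := is_derive_eps db e20.
exists (Num.min d1 d2); first by rewrite lt_min d10.
move=> r _; rewrite lt_min => /andP[/H1 h1 /H2 h2].
have -> : (a s +i* b s - (U s)%:C : Cplx R) = (a s - U s) +i* b s.
  by simpc.
rewrite inv_re_im//; apply: (le_trans (normc_le _)).
have -> : e * `|r - s| = e / 2 * `|r - s| + e / 2 * `|r - s| by field.
apply: lerD; [apply: le_trans h1|apply: le_trans h2]; simpc => /=.
- rewrite le_eqVlt; apply/orP; left; apply/eqP; congr (`| _ |); ring.
- rewrite le_eqVlt; apply/orP; left; apply/eqP; congr (`| _ |); ring.
Qed.

(** A solution of the Loewner equation started in the half-plane stays there. *)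
Lemma solvable_survives (R : realType) (T : R) (U : R -> R) (t x y : R) :
  0 < T -> BV0 T U -> 0 <= t <= T -> 0 < y ->
  loewner_solvable U (x +i* y : Cplx R) t -> survives T U t x y.
Proof.
move=> T0 BU /andP[t0 tT] y0 [g [g0 Hg]].
have cW := continuous_clamp_driver T0 BU.
pose W s := U (clamp T s).
pose A s := complex.Re (g s); pose B s := complex.Im (g s).
have A0 : A 0 = x by rewrite /A g0.
have B0 : B 0 = y by rewrite /B g0.
pose L s : Cplx R := 2 / (g s - (U s)%:C).
have eps s e : 0 <= s <= t -> 0 < e -> exists2 d, 0 < d & forall r, 0 <= r <= t ->
    `|r - s| < d -> `|A r - A s - (r - s) * complex.Re (L s)| <= e * `|r - s| /\
                    `|B r - B s - (r - s) * complex.Im (L s)| <= e * `|r - s|.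
  move=> sI e0; have [|_ /slope_cvgP /(_ e e0)[d d0 H]] := Hg s; first by rewrite in_itv.
  exists d => // r rI rs; have h := H r rI rs.
  have := le_trans (Re_le_normc _) h; have := le_trans (Im_le_normc _) h.
  rewrite -/(L s) /A /B; move: (g r) (g s) (L s) => [a b] [a' b'] [l l'] /=.
  by simpc.
have cont (f : R -> R) (f' : R -> R) : (forall s e, 0 <= s <= t -> 0 < e ->
    exists2 d, 0 < d & forall r, 0 <= r <= t -> `|r - s| < d ->
      `|f r - f s - (r - s) * f' s| <= e * `|r - s|) ->
    {within `[0, t], continuous f} /\
    forall s, 0 < s < t -> is_derive s 1 f (f' s).
  move=> Hf; split.
    apply/subspace_continuousP => s; rewrite /= in_itv/= => sI.
    apply/cvgrPdist_lt => e e0; have [d d0 H] := Hf s 1 sI ltr01.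
    have k0 : 0 < 1 + `|f' s| by rewrite ltr_pwDl.
    apply/nbhs_ballP; exists (Num.min d (e / (1 + `|f' s|))).
      by rewrite /= lt_min d0 divr_gt0.
    move=> r; rewrite /ball/= distrC lt_min => /andP[rd re].
    rewrite in_itv/= => rI; have := H r rI rd; rewrite mul1r => h.
    suff: `|f r - f s| < e by rewrite distrC.
    have -> : f r - f s = (f r - f s - (r - s) * f' s) + (r - s) * f' s by ring.
    apply: (le_lt_trans (ler_normD _ _)); rewrite normrM.
    move: re; rewrite ltr_pdivlMr//; move: h; clear; lra.
  move=> s /andP[s0 st]; apply: eps_is_derive => e e0.
  have sI : 0 <= s <= t by rewrite !ltW.
  have [d d0 H] := Hf s e sI e0.
  exists (Num.min d (Num.min s (t - s))); first by rewrite !lt_min d0 s0 subr_gt0.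
  move=> u; rewrite !lt_min => /and3P[ud us ut]; apply: H => //.
  move: us ut; rewrite !ltr_norml => /andP[h1 _] /andP[_ h2].
  by apply/andP; split; move: h1 h2; clear; lra.
have [cA dA] : {within `[0, t], continuous A} /\
    forall s, 0 < s < t -> is_derive s 1 A (complex.Re (L s)).
  apply: (cont A (fun s => complex.Re (L s))) => s e sI e0.
  by have [d d0 H] := eps s e sI e0; exists d => // r rI /(H r rI)[].
have [cB dB] : {within `[0, t], continuous B} /\
    forall s, 0 < s < t -> is_derive s 1 B (complex.Im (L s)).
  apply: (cont B (fun s => complex.Im (L s))) => s e sI e0.
  by have [d d0 H] := eps s e sI e0; exists d => // r rI /(H r rI)[].
have WE s : 0 <= s <= t -> W s = U s.
  by move=> /andP[s0 st]; rewrite /W clamp_id// s0 (le_trans st).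
pose N s := (A s - W s) ^+ 2 + B s ^+ 2.
have N0 s : 0 <= s <= t -> 0 < N s.
  move=> sI; have [|gU _] := Hg s; first by rewrite in_itv.
  rewrite lt_neqAle eq_sym addr_ge0 ?sqr_ge0// andbT.
  apply: contra gU; rewrite /N paddr_eq0 ?sqr_ge0// !sqrf_eq0 subr_eq0 WE//.
  by rewrite /A /B; case: (g s) => a b /= /andP[/eqP -> /eqP ->].
have LE s : 0 <= s <= t -> complex.Re (L s) = 2 * inv_re (A s - W s) (B s) /\
    complex.Im (L s) = - 2 * inv_im (A s - W s) (B s).
  move=> sI; have := N0 s sI; rewrite /L /N /inv_re /inv_im WE// /A /B.
  case: (g s) => a b /= _.
  by rewrite !subr0; split; ring.
have cN : {within `[0, t], continuous N}.
  have cWs : {within `[0, t], continuous W} by exact: continuous_subspaceT.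
  by move=> s; apply: cvgD; apply: cvgM;
    [apply: cvgB; [exact: cA|exact: cWs]|apply: cvgB; [exact: cA|exact: cWs]
    |exact: cB|exact: cB].
(* The minimum mu of |g - U|^2 is positive and bounds the decay of the height. *)
have [s1 s1I minN] := EVT_min t0 cN.
rewrite in_itv/= in s1I; have mu0 := N0 _ s1I.
set mu := N s1 in mu0 minN.
have Nmu s : 0 <= s <= t -> mu <= N s by move=> sI; apply: minN; rewrite in_itv.
pose k := 4 / mu; have k0 : 0 < k by rewrite divr_gt0.
have B2 s : 0 <= s <= t -> y ^+ 2 <= B s ^+ 2 * expR (k * s).
  move=> /andP[s0 st]; rewrite -lerN2.
  pose f u := - (B u ^+ 2 * expR (k * u)).
  have -> : - y ^+ 2 = f 0 by rewrite /f mulr0 expR0 mulr1 B0.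
  have sub : `[0, s]%classic `<=` `[0, t]%classic.
    by move=> u; rewrite /= !in_itv/= => /andP[-> us]; rewrite (le_trans us).
  apply: (@nincr_within _ f (fun u => - (B u ^+ 2 * (expR (k * u) * k) +
    (2 * B u * complex.Im (L u)) * expR (k * u)))) => //.
  - have cBs := continuous_subspaceW sub cB.
    have ce : {within `[0, s], continuous (fun u => expR (k * u))}.
      by apply: continuous_subspaceT => u; exact: (is_derive_continuous (isd_expM _ _)).
    move=> u; apply: cvgN; apply: cvgM; last exact: ce.
    by apply: cvgM; exact: cBs.
  - move=> u /andP[u0 us]; apply: isd_opp; apply: isd_mul; last exact: isd_expM.
    by apply: isd_sqr; apply: dB; rewrite u0 (lt_le_trans us).
  - move=> u /andP[u0 us]; have uI : 0 <= u <= t by rewrite (ltW u0) (le_trans (ltW us)).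
    have [_ ->] := LE _ uI; rewrite oppr_le0 /inv_im -/(N u) /k.
    have -> : B u ^+ 2 * (expR (4 / mu * u) * (4 / mu)) +
        2 * B u * (- 2 * (B u / N u)) * expR (4 / mu * u) =
        4 * expR (4 / mu * u) * B u ^+ 2 * (mu^-1 - (N u)^-1) by ring.
    apply: mulr_ge0; last by rewrite subr_ge0 lef_pV2 ?posrE ?Nmu ?N0.
    by apply: mulr_ge0; [rewrite mulr_ge0// expR_ge0 | exact: sqr_ge0].
pose m := y * expR (- (k / 2) * t).
have m0 : 0 < m by rewrite mulr_gt0// expR_gt0.
have B2m s : 0 <= s <= t -> m ^+ 2 <= B s ^+ 2.
  move=> sI; have h := B2 s sI; rewrite /m exprMn -expRM_natl.
  have -> : 2 * (- (k / 2) * t) = - (k * t) by field.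
  rewrite expRN ler_pdivrMr ?expR_gt0//; apply: (le_trans h).
  rewrite ler_wpM2l ?sqr_ge0// ler_expR ler_pM2l//.
  by case/andP: sI.
have Bpos s : 0 <= s <= t -> 0 < B s.
  move=> /andP[s0 st]; rewrite ltNge; apply/negP => Bs.
  have sub : `[0, s]%classic `<=` `[0, t]%classic.
    by move=> u; rewrite /= !in_itv/= => /andP[-> us]; rewrite (le_trans us).
  have [|c] := @IVT _ B 0 s 0 s0 (continuous_subspaceW sub cB).
    by rewrite ge_min Bs orbT/= le_max B0 (ltW y0).
  rewrite in_itv/= => /andP[c0 cs] Bc.
  have := B2m c; rewrite c0 (le_trans cs st) Bc expr0n/= => /(_ isT).
  by rewrite leNgt exprn_gt0.
have Bm s : 0 <= s <= t -> m <= B s.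
  by move=> sI; rewrite -ler_sqr ?nnegrE ?(ltW m0) ?(ltW (Bpos _ sI))// B2m.
have [a [b [a0 b0 G]]] := trunc_exists 2 x y cW m0 t0.
exists a, b; split => //; apply: (trunc_down_flow m0 G) => s /andP[s0 st].
have subI r : r \in [set` `[0, s]] -> 0 <= r <= t.
  by rewrite inE/= in_itv/= => /andP[-> rs]; rewrite (le_trans rs).
have subo r : 0 < r < s -> 0 < r < t.
  by move=> /andP[-> rs]; rewrite (lt_le_trans rs).
have oI r : 0 < r < t -> 0 <= r <= t by move=> /andP[/ltW -> /ltW ->].
have sub : `[0, s]%classic `<=` `[0, t]%classic.
  by move=> u; rewrite /= !in_itv/= => /andP[-> us]; rewrite (le_trans us).
have ca : {within `[0, s], continuous a}.
  apply/continuous_in_subspaceT => r /subI /G [da _].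
  exact: is_derive_continuous da.
have cb : {within `[0, s], continuous b}.
  apply/continuous_in_subspaceT => r /subI /G [_ db].
  exact: is_derive_continuous db.
have := @trunc_gronwall _ 2 W m s a b A B m0 s0 ca cb
  (continuous_subspaceW sub cA) (continuous_subspaceW sub cB).
rewrite a0 b0 A0 B0 !subrr expr0n/= addr0 mul0r => H.
have {}H : (a s - A s) ^+ 2 + (b s - B s) ^+ 2 <= 0.
  apply: H => r /subo rt; first exact: G (oI _ rt).
  rewrite /trunc_eq max_l ?Bm ?oI//.
  have [<- <-] := LE _ (oI _ rt); split; [exact: dA | exact: dB].
have [_ ->] : a s = A s /\ b s = B s.
  by apply: sqr_dist_eq => q q0; apply: (le_trans H); exact: ltW.
by apply: Bm; rewrite s0.
Qed.

(** * The complement of the hull *)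

Lemma mkc_eta (R : realType) (z : Cplx R) : z = complex.Re z +i* complex.Im z.
Proof. by case: z. Qed.

(** The complement of the hull consists of the points that survive. *)
Lemma hull_complementP (R : realType) (T : R) (U : R -> R) (t : R) (z : Cplx R) :
  0 < T -> BV0 T U -> 0 <= t <= T ->
  (upper_half_plane `\` hull T U t) z <->
  0 < complex.Im z /\ survives T U t (complex.Re z) (complex.Im z).
Proof.
move=> T0 BU /[dup] tI /andP[t0 tT].
have TI : 0 <= T <= T by rewrite lexx ltW.
have nz : 0 < complex.Im z -> (z == 0) = false.
  by move=> z0; apply/eqP => zE; rewrite zE ltxx in z0.
split=> [[z0 nh]|[z0 Sz]].
  have {}z0 : 0 < complex.Im z by [].
  split => //; apply: contrapT => nS; apply: nh; split; first exact: subset_closure.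
  rewrite /lifetime nz//; case: asboolP => sT.
    exfalso; apply: nS; apply: (survives_le tT); apply: solvable_survives => //.
    by rewrite -mkc_eta.
  apply: ge_ereal_sup => _ [t' [t'I st'] <-]; rewrite lee_fin leNgt; apply/negP => tt'.
  rewrite in_itv/= in t'I.
  apply: nS; apply: (survives_le (ltW tt')); apply: solvable_survives => //.
  by rewrite -mkc_eta.
split => // -[_]; rewrite /lifetime nz//; case: asboolP => sT.
  by rewrite leye_eq.
(* Before T the flow can be continued, so the lifetime exceeds t. *)
have tltT : t < T.
  rewrite lt_neqAle tT andbT; apply/eqP => tE; apply: sT.
  by rewrite [z]mkc_eta; apply: (survives_solvable TI); rewrite -{2}tE.
have tI' : 0 <= t < T by rewrite t0.
have [t' /andP[tt' t'T] St'] := survives_extend T0 BU tI' Sz.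
have t'I : 0 <= t' <= T by rewrite t'T andbT (le_trans t0)// ltW.
move=> h; have : (t'%:E <= t%:E)%E.
  apply: le_trans h; apply: ereal_sup_ubound; exists t' => //; split.
    by rewrite in_itv.
  by rewrite [z]mkc_eta; exact: survives_solvable St'.
by rewrite lee_fin leNgt tt'.
Qed.

(** * The trace *)

(** The curve of tips, started at 0; it vanishes off [0, T], as the curves on
    [0, T] do.  The default (0, 0) is not taken when [U] is in BV_LR. *)
Definition trace_fun (R : realType) (T : R) (U : R -> R) (t : R) : Cplx R :=
  if 0 < t <= T then
    let p := xget (0, 0) [set p | 0 < p.2 /\ is_tip T U t p.1 p.2] in p.1 +i* p.2
  else 0.

Lemma trace_funP (R : realType) (T : R) (U : R -> R) (t : R) : 0 < T ->
  BV_LR T U -> 0 < t <= T -> 0 < complex.Im (trace_fun T U t) /\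
  is_tip T U t (complex.Re (trace_fun T U t)) (complex.Im (trace_fun T U t)).
Proof.
move=> T0 LU tT; rewrite /trace_fun tT.
have [p pP] := tip_exists T0 LU tT.
by have := xgetPex (0, 0) (ex_intro _ p pP : [set p | 0 < p.2 /\ is_tip T U t p.1 p.2] !=set0).
Qed.

Lemma trace_fun0 (R : realType) (T : R) (U : R -> R) : trace_fun T U 0 = 0.
Proof. by rewrite /trace_fun ltxx. Qed.

Lemma trace_fun_out (R : realType) (T : R) (U : R -> R) (t : R) :
  t \notin `[0, T] -> trace_fun T U t = 0.
Proof.
rewrite in_itv/= /trace_fun; case: ifPn => // /andP[/ltW -> ->] //.
Qed.

(** Joint continuity of the tip in the driver and in time. *)
Lemma trace_near (R : realType) (T : R) (U : R -> R) (t e : R) : 0 < T ->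
  BV_LR T U -> 0 <= t <= T -> 0 < e -> exists2 rho, 0 < rho &
  forall U' t', BV_LR T U' -> (total_variation 0 T (U' \- U)%R <= rho%:E)%E ->
    0 <= t' <= T -> `|t' - t| < rho ->
    normc (trace_fun T U' t' - trace_fun T U t) <= e.
Proof.
move=> T0 LU /andP[t0 tT] e0; have BU : BV0 T U by case: LU.
have e2 : 0 < e ^+ 2 by rewrite exprn_gt0.
have nle (z : Cplx R) : complex.Re z ^+ 2 + complex.Im z ^+ 2 <= e ^+ 2 -> normc z <= e.
  by move=> h; rewrite -ler_sqr ?nnegrE ?normc_ge0 ?(ltW e0)// normc_sqr.
have [t00|tn0] := eqVneq t 0.
  have [rho rho0 H] := tip_near0 T0 BU e2.
  exists rho => // U' t' LU' UU' /andP[t'0 t'T]; rewrite t00 subr0 trace_fun0 subr0 => t'r.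
  have BU' : BV0 T U' by case: LU'.
  have [->|t'n0] := eqVneq t' 0; first by rewrite trace_fun0 normc0 ltW.
  have t'I : 0 < t' <= T by rewrite lt_neqAle eq_sym t'n0 t'0.
  have [_ tip] := trace_funP T0 LU' t'I.
  apply: nle; apply: (H U' t') => //.
  by rewrite (le_trans (ler_norm _))// ltW.
have tpos : 0 < t by rewrite lt_neqAle eq_sym tn0.
have tI : 0 < t <= T by rewrite tpos.
have [_ tip] := trace_funP T0 LU tI.
have [rho rho0 H] := tip_near T0 tip e2.
exists (Num.min rho t); first by rewrite lt_min rho0.
move=> U' t' LU' UU' /andP[t'0 t'T]; rewrite lt_min => /andP[tr tt].
have BU' : BV0 T U' by case: LU'.
have t'I : 0 < t' <= T.
  by rewrite t'T andbT; move: tt; rewrite ltr_norml => /andP[+ _]; clear; lra.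
have [_ tip'] := trace_funP T0 LU' t'I.
apply: nle.
have -> : complex.Re (trace_fun T U' t' - trace_fun T U t) =
  complex.Re (trace_fun T U' t') - complex.Re (trace_fun T U t).
  by case: (trace_fun T U' t') (trace_fun T U t) => ? ? [].
have -> : complex.Im (trace_fun T U' t' - trace_fun T U t) =
  complex.Im (trace_fun T U' t') - complex.Im (trace_fun T U t).
  by case: (trace_fun T U' t') (trace_fun T U t) => ? ? [].
apply: (H U' t') => //; last exact: ltW.
apply: (le_trans UU'); by rewrite lee_fin ge_min lexx.
Qed.

Lemma tv_self (R : realType) (T : R) (U : R -> R) : 0 <= T ->
  total_variation 0 T (U \- U)%R = 0%E.
Proof.
move=> T0; have -> : (U \- U)%R = cst 0 by apply/funext => w /=; rewrite subrr.
by rewrite nondecreasing_total_variation//= subrr.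
Qed.

Lemma trace_continuous (R : realType) (T : R) (U : R -> R) : 0 < T ->
  BV_LR T U -> {within `[0, T], continuous (trace_fun T U)}.
Proof.
move=> T0 LU; apply/subspace_continuousP => t; rewrite /= in_itv/= => tI.
apply/cvg_normc => e e0; have e20 : 0 < e / 2 by rewrite divr_gt0.
have [rho rho0 H] := trace_near T0 LU tI e20.
apply/nbhs_ballP; exists rho => //= t'; rewrite /ball/= distrC => tt.
rewrite in_itv/= => t'I.
apply: (@le_lt_trans _ _ (e / 2)); last by rewrite ltr_pdivrMr// ltr_pMr// ltr1n.
by apply: H => //; rewrite tv_self ?lee_fin ?(ltW T0)// ltW.
Qed.

Lemma trace_half_plane (R : realType) (T : R) (U : R -> R) (t : R) : 0 < T ->
  BV_LR T U -> t \in `[0, T] -> closure upper_half_plane (trace_fun T U t).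
Proof.
move=> T0 LU; rewrite in_itv/= => /andP[t0 tT].
have [->|tn0] := eqVneq t 0; first by rewrite trace_fun0; exact: closure_half_plane0.
apply: subset_closure; have [] // := trace_funP T0 LU (t := t).
by rewrite lt_neqAle eq_sym tn0 t0.
Qed.

(** The hull is the trace: a point of the half-plane is on the trace up to time
    t exactly when it does not survive up to time t. *)
Lemma trace_image (R : realType) (T : R) (U : R -> R) (t : R) (z : Cplx R) :
  0 < T -> BV_LR T U -> 0 <= t <= T -> 0 < complex.Im z ->
  (trace_fun T U @` `[0, t]) z <-> ~ survives T U t (complex.Re z) (complex.Im z).
Proof.
move=> T0 LU tI z0; have BU : BV0 T U by case: LU.
have /andP[t0 tT] := tI; split.
  move=> [s /= + zE]; rewrite in_itv/= => /andP[s0 st] Sz.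
  have sn0 : s != 0 by apply/eqP => sE; move: z0; rewrite -zE sE trace_fun0 ltxx.
  have sI : 0 < s <= T by rewrite lt_neqAle eq_sym sn0 s0 (le_trans st).
  have [_ tip] := trace_funP T0 LU sI; rewrite zE in tip.
  by apply: (tip_dies T0 BU sI tip); exact: survives_le Sz.
move=> nS; have [s /andP[s0 st] H] := dies_tip T0 BU tI z0 nS.
have sI : 0 < s <= T by rewrite s0 (le_trans st).
have [_ /H[e1 e2]] := trace_funP T0 LU sI.
exists s; first by rewrite /= in_itv/= (ltW s0).
by rewrite [RHS]mkc_eta -e1 -e2 -mkc_eta.
Qed.

Lemma trace_complement (R : realType) (T : R) (U : R -> R) (t : R) : 0 < T ->
  BV_LR T U -> 0 <= t <= T ->
  upper_half_plane `\` trace_fun T U @` `[0, t] = upper_half_plane `\` hull T U t.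
Proof.
move=> T0 LU tI; have BU : BV0 T U by case: LU.
apply/seteqP; split=> z.
  move=> [z0 nz]; apply/hull_complementP => //; split => //.
  by apply: contrapT => /(trace_image T0 LU tI z0).
move=> /(hull_complementP z T0 BU tI)[z0 Sz]; split => //.
by move=> /(trace_image T0 LU tI z0).
Qed.

(** * The complement of the hull is connected and unbounded *)

(** Without perturbation the gap does not increase, as in the Schwarz-Pick
    lemma; hence the endpoint depends continuously on the starting point. *)
Lemma gap_nincr (R : realType) (W : R -> R) (S : R) (x1 y1 x2 y2 : R -> R) :
  0 <= S -> up_flow W S x1 y1 -> up_flow W S x2 y2 ->
  gap x1 y1 x2 y2 S <= gap x1 y1 x2 y2 0.
Proof.
move=> S0 F1 F2.
apply: (nincr_derive S0 (fun s sS => gap_derive F1 F2 sS)) => s sS.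
have [a1 _ _] := F1 _ sS; have [a2 _ _] := F2 _ sS.
have m0 : 0 < Num.min (y1 s) (y2 s) by rewrite lt_min a1.
have h := @gap_algebra R (x1 s - W s) (y1 s) (x2 s - W s) (y2 s) 0
  (x1 s - x2 s) (y1 s - y2 s) (Num.min (y1 s) (y2 s)) 0
  (`|x1 s - x2 s| + `|y1 s - y2 s|) 0.
apply: (le_trans (h _ _ m0 _ _ _ _ _)) => //.
- by rewrite addr0; ring.
- by rewrite ge_min lexx.
- by rewrite ge_min lexx orbT.
- by rewrite normr0.
- by rewrite mulr_ge0// sqr_ge0.
- by rewrite mulr0 oppr0 !mul0r addr0.
Qed.

Lemma gapE (R : realType) (x1 y1 x2 y2 : R -> R) (s : R) : 0 < y1 s -> 0 < y2 s ->
  (x1 s - x2 s) ^+ 2 + (y1 s - y2 s) ^+ 2 = gap x1 y1 x2 y2 s * (y1 s * y2 s).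
Proof. by move=> a b; rewrite /gap mulfVK// gt_eqF// mulr_gt0. Qed.

(** The inverse of the Loewner flow at time t, as a map [f] from the half-plane
    onto the complement of the hull: [f a h] is the endpoint of the upward flow
    from [U t + (a + ih)].  The last clause is a local Lipschitz bound. *)
Lemma endpoint_map (R : realType) (T : R) (U : R -> R) (t : R) : 0 < T ->
  BV0 T U -> 0 <= t <= T -> exists f : R -> R -> R * R, [/\
    forall a h, 0 < h -> h <= (f a h).2,
    forall a h, 0 < h -> survives T U t (f a h).1 (f a h).2,
    forall x y, 0 < y -> survives T U t x y ->
      exists a h, 0 < h /\ f a h = (x, y) &
    forall a h a' h', 0 < h -> 0 < h' ->
      ((f a h).1 - (f a' h').1) ^+ 2 + ((f a h).2 - (f a' h').2) ^+ 2 <=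
      ((a - a') ^+ 2 + (h - h') ^+ 2) / (h * h') *
      ((h ^+ 2 + h' ^+ 2 + 8 * T))].
Proof.
move=> T0 BU /andP[t0 tT].
have ex (ah : R * R) : exists xy : (R -> R) * (R -> R), 0 < ah.2 ->
    flow_from T U t ah.1 ah.2 xy.1 xy.2.
  have [h0|] := boolP (0 < ah.2); last by exists (cst 0, cst 0).
  have [x [y F]] := flow_from_exists ah.1 T0 BU t0 h0.
  by exists (x, y).
have [F FP] := choice ex.
have tI : 0 <= t <= t by rewrite t0 lexx.
have cmp x1 y1 x2 y2 a h a' h' : 0 < h -> 0 < h' ->
    flow_from T U t a h x1 y1 -> flow_from T U t a' h' x2 y2 ->
    (x1 t - x2 t) ^+ 2 + (y1 t - y2 t) ^+ 2 <=
      ((a - a') ^+ 2 + (h - h') ^+ 2) / (h * h') * (h ^+ 2 + h' ^+ 2 + 8 * T).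
  move=> h0 h'0 [F1 X1 Y1] [F2 X2 Y2].
  have [y1t _ _] := F1 _ tI; have [y2t _ _] := F2 _ tI.
  rewrite gapE//.
  have g0 : gap x1 y1 x2 y2 0 = ((a - a') ^+ 2 + (h - h') ^+ 2) / (h * h').
    rewrite /gap X1 X2 Y1 Y2; congr (_ / _); congr (_ ^+ 2 + _); ring.
  rewrite -g0.
  apply: ler_pM.
  - by rewrite /gap divr_ge0 ?addr_ge0 ?sqr_ge0// mulr_ge0// ltW.
  - by rewrite mulr_ge0// ltW.
  - exact: (gap_nincr t0 F1 F2).
  - have k1 := up_flow_sqr_le t0 F1; have k2 := up_flow_sqr_le t0 F2.
    rewrite Y1 in k1; rewrite Y2 in k2.
    have := sqr_ge0 (y1 t - y2 t); have := sqr_ge0 (y1 t); have := sqr_ge0 (y2 t).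
    by move: k1 k2 tT; move: (y1 t) (y2 t) => u v; clear; nra.
exists (fun a h => ((F (a, h)).1 t, (F (a, h)).2 t)); split => /=.
- move=> a h h0; have [G _ Y] := FP (a, h) h0.
  by rewrite -[X in X <= _]Y; apply: (up_flow_mono G).
- move=> a h h0; have [b [c [D b0 c0 _ _]]] := flow_from_down t0 (FP (a, h) h0).
  by exists b, c.
- move=> x y y0 [b [c [D b0 c0]]]; have [ct _ _] := D _ tI.
  exists (b t - U t), (c t); split => //.
  have G : flow_from T U t (b t - U t) (c t) (fun s => b (t - s)) (fun s => c (t - s)).
    split; first exact: down_flow_rev D.
      by rewrite subr0 addrC subrK.
    by rewrite subr0.
  have H := cmp _ _ _ _ _ _ _ _ ct ct (FP (b t - U t, c t) ct) G.
  rewrite !subrr expr0n/= addr0 !mul0r b0 c0 in H.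
  have [-> ->] : (F (b t - U t, c t)).1 t = x /\ (F (b t - U t, c t)).2 t = y.
    by apply: sqr_dist_eq => q q0; apply: (le_trans H); exact: ltW.
  by [].
- by move=> a h a' h' h0 h'0; apply: cmp => //; exact: FP.
Qed.

(** A set whose points are joined to a common point by paths is connected. *)
Lemma path_connected (R : realType) (A : set (Cplx R)) (c : Cplx R) :
  (forall z, A z -> exists p : R -> Cplx R, [/\ {within `[0, 1], continuous p},
     p 0 = c, p 1 = z & forall s, 0 <= s <= 1 -> A (p s)]) ->
  connected A.
Proof.
move=> H; have /choice[p pP] (z : Cplx R) : exists p : R -> Cplx R, A z ->
    [/\ {within `[0, 1], continuous p},
     p 0 = c, p 1 = z & forall s, 0 <= s <= 1 -> A (p s)].
  have [/H[p pP]|] := pselect (A z); first by exists p.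
  by exists (cst 0).
have I0 : (0 : R) \in `[0, 1] by rewrite in_itv/= lexx ler01.
have I1 : (1 : R) \in `[0, 1] by rewrite in_itv/= lexx ler01.
have -> : A = \bigcup_(z in A) (p z @` `[0, 1]).
  apply/seteqP; split=> z.
    by move=> Az; exists z => //; exists 1 => //; have [] := pP z Az.
  move=> [w Aw [s /=]]; rewrite in_itv/= => sI <-.
  by have [_ _ _] := pP w Aw; exact.
apply: bigcup_connected.
  by exists c => z Az; exists 0 => //; have [] := pP z Az.
move=> z Az; apply: connected_continuous_connected; first exact: segment_connected.
by have [] := pP z Az.
Qed.

Lemma within_continuous_normc (R : realType) (p : R -> Cplx R) (a b : R) :
  (forall s e, a <= s <= b -> 0 < e -> exists2 d, 0 < d & forall r, a <= r <= b ->
    `|r - s| < d -> normc (p r - p s) < e) ->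
  {within `[a, b], continuous p}.
Proof.
move=> H; apply/subspace_continuousP => s; rewrite /= in_itv/= => sI.
apply/cvg_normc => e e0; have [d d0 {}H] := H s e sI e0.
apply/nbhs_ballP; exists d => //= r; rewrite /ball/= distrC => rs.
by rewrite in_itv/= => rI; exact: H.
Qed.

(** The segment from [c] to [z], as a path. *)
Lemma segment_path (R : realType) (c z : Cplx R) :
  {within `[0, 1], continuous (fun s : R => c + s%:C * (z - c) : Cplx R)}.
Proof.
apply: within_continuous_normc => s e _ e0.
have k0 : 0 < 1 + normc (z - c) by rewrite ltr_pwDl// normc_ge0.
exists (e / (1 + normc (z - c))); first by rewrite divr_gt0.
move=> r _ rs.
have -> : (c + r%:C * (z - c)) - (c + s%:C * (z - c)) = (r - s)%:C * (z - c) :> R[i].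
  by rewrite rmorphB/=; ring.
rewrite normcM normc_real; move: rs; rewrite ltr_pdivlMr// => rs.
apply: le_lt_trans rs; rewrite ler_wpM2l// lerDr//.
Qed.

Lemma hull_complement_connected (R : realType) (T : R) (U : R -> R) (t : R) :
  0 < T -> BV0 T U -> 0 <= t <= T ->
  connected (upper_half_plane `\` hull T U t : set (Cplx R)).
Proof.
move=> T0 BU tI; have [f [fh fS fsurj fcont]] := endpoint_map T0 BU tI.
pose mk (p : R * R) : Cplx R := p.1 +i* p.2.
apply: (@path_connected _ _ (mk (f 0 1))) => z.
move=> /(hull_complementP z T0 BU tI)[z0 Sz].
have [a [h [h0 fE]]] := fsurj _ _ z0 Sz.
have H0 s : 0 <= s <= 1 -> 0 < 1 + s * (h - 1).
  move=> /andP[s0 s1]; have [->|sn0] := eqVneq s 0; first by rewrite mul0r addr0.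
  have sp : 0 < s by rewrite lt_neqAle eq_sym sn0.
  have : 0 < s * h by exact: mulr_gt0.
  by move: s1; clear; lra.
exists (fun s => mk (f (s * a) (1 + s * (h - 1)))); split.
- apply: within_continuous_normc => s e sI e0.
  have hs := H0 s sI; set hs' := 1 + s * (h - 1) in hs *.
  pose m := Num.min 1 h; have m0 : 0 < m by rewrite lt_min ltr01.
  have [m1 mh] : m <= 1 /\ m <= h by apply/andP; rewrite -le_min.
  have Hm r : 0 <= r <= 1 -> m <= 1 + r * (h - 1) /\ 1 + r * (h - 1) <= 1 + h.
    by move=> /andP[r0 r1]; move: r0 r1 m1 mh h0; clear => *; split; nra.
  pose K := (a ^+ 2 + (h - 1) ^+ 2) / (m ^+ 2) * (2 * (1 + h) ^+ 2 + 8 * T).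
  have K0 : 0 <= K.
    rewrite /K mulr_ge0//; first by rewrite divr_ge0 ?addr_ge0 ?sqr_ge0.
    by apply: addr_ge0; apply: mulr_ge0 => //; [exact: sqr_ge0 | exact: ltW].
  have K1 : 0 < K + 1 by rewrite ltr_wpDl.
  exists (Num.min 1 (e ^+ 2 / (K + 1))).
    by rewrite lt_min ltr01 divr_gt0// exprn_gt0.
  move=> r rI; rewrite lt_min => /andP[rs1 rse].
  have hr := H0 r rI.
  rewrite -ltr_sqr ?nnegrE ?normc_ge0 ?(ltW e0)// normc_sqr /mk /=.
  have := fcont (r * a) (1 + r * (h - 1)) (s * a) (1 + s * (h - 1)) hr hs.
  set D := ((f (r * a) _).1 - _) ^+ 2 + _ => HD.
  have [q1 q2] := Hm r rI; have [q3 q4] := Hm s sI.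
  apply: (le_lt_trans HD).
  have -> : r * a - s * a = (r - s) * a by ring.
  have -> : 1 + r * (h - 1) - (1 + s * (h - 1)) = (r - s) * (h - 1) by ring.
  have -> : ((r - s) * a) ^+ 2 + ((r - s) * (h - 1)) ^+ 2 =
    (r - s) ^+ 2 * (a ^+ 2 + (h - 1) ^+ 2) by ring.
  have mm : (1 + r * (h - 1)) * (1 + s * (h - 1)) >= m ^+ 2.
    by rewrite expr2; apply: ler_pM => //; exact: ltW.
  have m20 : 0 < m ^+ 2 by rewrite exprn_gt0.
  have step : (r - s) ^+ 2 * (a ^+ 2 + (h - 1) ^+ 2) /
      ((1 + r * (h - 1)) * (1 + s * (h - 1))) *
      ((1 + r * (h - 1)) ^+ 2 + (1 + s * (h - 1)) ^+ 2 + 8 * T) <= (r - s) ^+ 2 * K.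
    rewrite /K [leRHS]mulrA [in leRHS]mulrA.
    have p0 : 0 <= (r - s) ^+ 2 * (a ^+ 2 + (h - 1) ^+ 2).
      by apply: mulr_ge0; [exact: sqr_ge0 | rewrite addr_ge0 ?sqr_ge0].
    apply: ler_pM.
    - by rewrite divr_ge0// mulr_ge0// ltW.
    - by rewrite !addr_ge0 ?sqr_ge0// mulr_ge0// ltW.
    - by rewrite ler_wpM2l// lef_pV2// posrE mulr_gt0.
    - rewrite lerD2r mulr_natl mulr2n; apply: lerD;
      by rewrite ler_sqr ?nnegrE ?(ltW hr) ?(ltW hs)// addr_ge0// ltW.
  apply: (le_lt_trans step).
  have rr : (r - s) ^+ 2 <= `|r - s|.
    by rewrite -(real_normK (num_real (r - s))) expr2 ler_piMl// ltW.
  apply: (@le_lt_trans _ _ (`|r - s| * (K + 1))).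
    apply: ler_pM => //; first exact: sqr_ge0.
    by rewrite lerDl.
  by rewrite -ltr_pdivlMr.
- by rewrite !mul0r addr0.
- by rewrite !mul1r addrC subrK fE /mk /= -mkc_eta.
- move=> s sI; apply/hull_complementP => //=; split; last exact/fS/H0.
  exact: lt_le_trans (H0 s sI) (fh _ _ (H0 s sI)).
Qed.

Lemma hull_complement_unbounded (R : realType) (T : R) (U : R -> R) (t : R) :
  0 < T -> BV0 T U -> 0 <= t <= T ->
  ~ bounded_set (upper_half_plane `\` hull T U t : set (Cplx R)).
Proof.
move=> T0 BU tI [M [Mreal HM]].
have [f [fh fS _ _]] := endpoint_map T0 BU tI.
have h0 : 0 < `|complex.Re M| + 2 by rewrite ltr_wpDl.
have ME : M = (complex.Re M)%:C.
  move: Mreal {HM h0}; rewrite realE; case: M => a b.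
  by rewrite !lecE /= => /orP[] /andP[/eqP bE _]; [rewrite bE | rewrite -bE].
have MM : M < (complex.Re M + 1)%:C by rewrite [X in X < _]ME ltcR ltrDl.
have Im0 := lt_le_trans h0 (fh 0 _ h0).
pose z : Cplx R := (f 0 (`|complex.Re M| + 2)).1 +i* (f 0 (`|complex.Re M| + 2)).2.
have Hz : (upper_half_plane `\` hull T U t) z.
  by apply/hull_complementP => //=; split => //; exact: fS.
have hz := HM _ MM z Hz.
have {}hz : normc z <= complex.Re M + 1 by rewrite -lecR.
have := le_trans (Im_le_normc z) hz; rewrite /= => h1.
have := le_trans (le_trans (fh 0 _ h0) (ler_norm _)) h1.
by have := ler_norm (complex.Re M); clear; lra.
Qed.

Lemma hull_complement_neq0 (R : realType) (T : R) (U : R -> R) (t : R) :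
  0 < T -> BV0 T U -> 0 <= t <= T ->
  exists z : Cplx R, (upper_half_plane `\` hull T U t) z.
Proof.
move=> T0 BU tI; have [f [fh fS _ _]] := endpoint_map T0 BU tI.
exists ((f 0 1).1 +i* (f 0 1).2); apply/hull_complementP => //=.
by split; [exact: lt_le_trans (fh 0 1 ltr01) | exact: fS].
Qed.

(** * Existence and uniqueness of the trace *)

Lemma trace_is_trace (R : realType) (T : R) (U : R -> R) : 0 < T -> BV_LR T U ->
  is_trace T U (trace_fun T U).
Proof.
move=> T0 LU; have BU : BV0 T U by case: LU.
split.
- exact: trace_continuous.
- by move=> t tI; exact: trace_half_plane.
- exact: trace_fun0.
- move=> t; rewrite in_itv/= => tI; rewrite trace_complement//.
  have [z Hz] := hull_complement_neq0 T0 BU tI; split.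
    exists z => //; rewrite connected_component_id//.
    exact: hull_complement_connected.
  exact: hull_complement_unbounded.
Qed.

(** Any trace passes through the tip at time t by time t, since the tip is a
    boundary point of the component; it cannot do so earlier, since the tip
    survives until time t. *)
Lemma is_trace_unique (R : realType) (T : R) (U : R -> R) (g : R -> Cplx R) :
  0 < T -> BV_LR T U -> is_trace T U g ->
  forall t, 0 <= t <= T -> g t = trace_fun T U t.
Proof.
move=> T0 LU [cg _ g0 comp] t /andP[t0 tT]; have BU : BV0 T U by case: LU.
have [->|tn0] := eqVneq t 0; first by rewrite trace_fun0.
have tpos : 0 < t by rewrite lt_neqAle eq_sym tn0.
have tI : 0 < t <= T by rewrite tpos.
have tI' : 0 <= t <= T by rewrite t0.
have [p0 tip] := trace_funP T0 LU tI.
set p := trace_fun T U t in p0 tip *.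
have dead : ~ (upper_half_plane `\` hull T U t) p.
  by move=> /(hull_complementP p T0 BU tI')[_]; exact: (tip_dies T0 BU tI tip).
have [r rI gr] : exists2 r, 0 <= r <= t & g r = p.
  suff [r + gr] : (g @` `[0, t]) p.
    by rewrite /= in_itv/= => rI; exists r.
  apply: contrapT => np.
  have [|[c Ac cE] _] := comp t; first by rewrite in_itv.
  have cgt : {within `[0, t], continuous g}.
    apply: continuous_subspaceW cg => s; rewrite /= !in_itv/= => /andP[-> st].
    exact: le_trans tT.
  have clK : closed (g @` `[0, t]).
    apply: compact_closed; first exact: norm_hausdorff.
    by apply: continuous_compact => //; exact: segment_compact.
  have : nbhs p (~` (g @` `[0, t])).
    by apply: open_nbhs_nbhs; split => //; exact: closed_openC.
  move=> /nbhs_normc[e e0 He].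
  pose d := Num.min e (complex.Im p).
  have d0 : 0 < d by rewrite lt_min e0.
  have ball_sub w : normc (w - p) < d -> (upper_half_plane `\` g @` `[0, t]) w.
    rewrite lt_min => /andP[we wp]; split; last exact: He.
    have := le_lt_trans (Im_le_normc _) wp; rewrite /upper_half_plane /=.
    case: w {we wp} => a b /=; case: p {dead np He d d0 p0 tip e0} => a' b' /=.
    by rewrite ltr_norml => /andP[+ _]; clear; lra.
  have d2 : 0 < (d / 2) ^+ 2 by rewrite exprn_gt0// divr_gt0.
  have [rho rho0 H] := tip_approx T0 BU tI tip d2.
  have [|x [y [F G]]] := H rho; first by rewrite rho0 lexx.
  have [b [c' [D b0 c0 _ _]]] := flow_from_down t0 F.
  have y0 : 0 < y t.
    by have [|+ _ _] := D 0; [rewrite lexx | rewrite c0].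
  pose z : Cplx R := x t +i* y t.
  have zp : normc (z - p) <= d / 2.
    rewrite -ler_sqr ?nnegrE ?normc_ge0 ?divr_ge0 ?(ltW d0)// normc_sqr.
    by move: G; rewrite /z; case: (p).
  have Hz : (upper_half_plane `\` hull T U t) z.
    by apply/hull_complementP => //=; split => //; exists b, c'.
  apply: dead; rewrite cE.
  have zc : connected_component (upper_half_plane `\` g @` `[0, t]) c z.
    by rewrite -cE.
  rewrite (same_connected_component zc).
  (* Were the tip off the curve, the segment to it from a surviving point would
     stay in the component. *)
  pose q (s : R) : Cplx R := z + s%:C * (p - z).
  have qz : q 0 = z by rewrite /q mul0r addr0.
  have qp : q 1 = p by rewrite /q mul1r addrC subrK.
  have I0 : (0 : R) \in `[0, 1] by rewrite in_itv/= lexx ler01.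
  have I1 : (1 : R) \in `[0, 1] by rewrite in_itv/= lexx ler01.
  apply: (@connected_component_max _ _ (q @` `[0, 1])).
  - by exists 0.
  - move=> w [s /=]; rewrite in_itv/= => /andP[s0 s1] <-; apply: ball_sub.
    have -> : q s - p = (1 - s)%:C * (z - p) :> R[i].
      by rewrite /q rmorphB/= rmorph1; ring.
    rewrite normcM normc_real ger0_norm ?subr_ge0//.
    apply: (@le_lt_trans _ _ (1 * (d / 2))).
      apply: ler_pM => //; rewrite ?subr_ge0 ?normc_ge0//.
      by rewrite gerBl.
    by rewrite mul1r ltr_pdivrMr// ltr_pMr// ltr1n.
  - apply: connected_continuous_connected; first exact: segment_connected.
    exact: segment_path.
  - by exists 1.
have /andP[r0 rt] := rI; rewrite -gr.
move: rt; rewrite le_eqVlt => /orP[/eqP -> //|rt]; exfalso.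
have rT : 0 <= r <= T by rewrite r0 (le_trans (ltW rt)).
have Sr : survives T U r (complex.Re p) (complex.Im p).
  by apply: (tip_survives T0 LU tI tip); rewrite r0.
have [|[c _ cE] _] := comp r; first by rewrite in_itv.
have : (upper_half_plane `\` hull T U r) p by apply/hull_complementP.
rewrite cE => /connected_component_sub[_]; apply.
by exists r => //; rewrite /= in_itv/= r0 lexx.
Qed.

Lemma Psi_trace (R : realType) (T : {posnum R}) (U : bvLR T) (t : R) :
  t \in `[0, T%:num] -> Psi U t = trace_fun T%:num U t.
Proof.
move=> tI; have T0 : 0 < T%:num by [].
have LU := bvLR_bv U.
have /(xgetPex hcurve0) : [set c : hcurve T | is_trace T%:num U c] !=set0.
  exists (@HCurve R T (trace_fun T%:num U)
    (fun t => @trace_fun_out R T%:num U t) (trace_continuous T0 LU)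
    (fun t => @trace_half_plane R T%:num U t T0 LU)).
  exact: trace_is_trace.
by move=> tr; apply: (is_trace_unique T0 LU tr); rewrite in_itv/= in tI.
Qed.

(** * Continuity of the trace in the driver *)

Lemma trace_near_uniform (R : realType) (T : R) (U : R -> R) (e : R) : 0 < T ->
  BV_LR T U -> 0 < e -> exists2 rho, 0 < rho &
  forall U' t, BV_LR T U' -> (total_variation 0 T (U' \- U)%R <= rho%:E)%E ->
    0 <= t <= T -> normc (trace_fun T U' t - trace_fun T U t) <= e.
Proof.
move=> T0 LU e0.
pose P a b : Prop := exists2 rho, 0 < rho & forall U' t, BV_LR T U' ->
  (total_variation 0 T (U' \- U)%R <= rho%:E)%E ->
  0 <= t <= T -> a <= t <= b -> normc (trace_fun T U' t - trace_fun T U t) <= e.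
suff [rho rho0 H] : P 0 T.
  by exists rho => // U' t LU' UU' tI; exact: H.
apply: interval_induction; first exact: ltW.
  move=> a b c _ _ [r1 r10 H1] [r2 r20 H2].
  exists (Num.min r1 r2); first by rewrite lt_min r10.
  move=> U' t LU' UU' tI /andP[at_ tc]; have [tb|/ltW bt] := leP t b.
    apply: H1 => //; last by rewrite at_.
    by apply: (le_trans UU'); rewrite lee_fin ge_min lexx.
  apply: H2 => //; last by rewrite bt.
  by apply: (le_trans UU'); rewrite lee_fin ge_min lexx orbT.
move=> t tI; have e20 : 0 < e / 2 by rewrite divr_gt0.
have [rho rho0 H] := trace_near T0 LU tI e20.
exists rho => // a b /andP[_ at_] /andP[tb _] ta bt.
exists rho => // U' s LU' UU' sI /andP[as_ sb].
have st : `|s - t| < rho.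
  by rewrite ltr_distl; apply/andP; split; move: ta bt as_ sb; clear; lra.
have h1 := H U' s LU' UU' sI st.
have h2 : normc (trace_fun T U s - trace_fun T U t) <= e / 2.
  by apply: H => //; rewrite tv_self ?lee_fin ?(ltW T0)// ltW.
have -> : trace_fun T U' s - trace_fun T U s =
  (trace_fun T U' s - trace_fun T U t) - (trace_fun T U s - trace_fun T U t).
  by rewrite opprB addrA subrK.
apply: (le_trans (le_normcD _ _)); rewrite normcN.
by move: h1 h2; clear; lra.
Qed.

Theorem theorem1p2 (R : realType) (T : {posnum R}) :
  continuous (@Psi R T).
Proof.
move=> U B /nbhs_ballP[e /= e0 eB].
have T0 : 0 < T%:num by [].
have e20 : 0 < e / 2 by rewrite divr_gt0.
have [rho rho0 H] := trace_near_uniform T0 (bvLR_bv U) e20.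
apply/nbhs_ballP; exists rho => // V UV; apply: eB.
have {}UV : bv_dist U V < rho by [].
suff : sup_dist (Psi U) (Psi V) <= e / 2.
  move=> h; suff : sup_dist (Psi U) (Psi V) < e by [].
  by apply: (le_lt_trans h); rewrite ltr_pdivrMr// ltr_pMr// ltr1n.
apply: sup_dist_le => t tI.
have swap (a b a' b' : Cplx R) : a = a' -> b = b' -> normc (b' - a') <= e / 2 ->
    normc (a - b) <= e / 2 by move=> -> ->; rewrite normcB.
apply: (swap _ _ _ _ (Psi_trace U tI) (Psi_trace V tI)).
apply: H; [exact: bvLR_bv | | by rewrite in_itv in tI].
rewrite -(fineK (bv_dist_fin V U)) lee_fin -/(bv_dist V U) bv_dist_sym.
exact: ltW.
Qed.
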